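(* Let $M\subset\mathbb{R}^3$ be a smooth compact surface, diffeomorphic to $S^2$, with positive Gauss curvature everywhere, and rotationally symmetric about the $x_3$-axis. Let $\xi\in C^\infty(M)$ satisfy $J\nabla\xi=-X_3$, let $f=f(\xi)$ be a smooth real-valued zonal function on $M$, $w=\Delta f=w(\xi)$, $\chi=\chi(\xi)$, and $\Omega\in\mathbb{R}$. Let $\Gamma$ be the operator on $L^2_b(M)$ given by $$\Gamma\zeta=f'(\xi)X_3\zeta+\bigl(\Omega\chi'(\xi)-w'(\xi)\bigr)X_3\Delta^{-1}\zeta,$$ and put $\alpha_0=\min_M\xi$, $\alpha_1=\max_M\xi$. If $\Gamma$ has an eigenvalue with nonzero real part, then $$w'(s)-\Omega\chi'(s)\ \text{ must change sign in } s\in(\alpha_0,\alpha_1),$$ and $$\forall\,K\in\mathbb{R},\ \exists\,s\in(\alpha_0,\alpha_1)\ \text{such that}\ \bigl(w'(s)-\Omega\chi'(s)\bigr)\bigl(f'(s)-K\bigr)<0.$$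
   Context: $M$ carries the metric induced from $\mathbb{R}^3$; $\Delta$ is its Laplace–Beltrami operator and $\Delta^{-1}$ is defined to annihilate constants and have range orthogonal to constants. $\nu$ is the unit outward normal, $\chi(x)=e_3\cdot\nu(x)$ with $e_3=(0,0,1)$; $J:T_xM\to T_xM$ is counterclockwise rotation by $90^\circ$ (orientation given by $\nu$); $X_3$ is the vector field on $M$ generating the $2\pi$-periodic rotation about the $x_3$-axis. A function $f$ is zonal if $X_3f=0$. Under the hypotheses on $M$, rotation-invariant smooth functions on $M$ (such as $f,w,\chi$) are smooth functions of $\xi$; a prime denotes $d/d\xi$. $L^2_b(M)=\{\zeta\in L^2(M):\int_M\zeta\,dS=0\}$ (complex-valued). $\Gamma$ arises by linearizing the vorticity equation at the stationary solution $J\nabla f$; it commutes with $X_3$ and equals $\bigoplus_{k\in\mathbb{Z}}\Gamma_k$ with $\Gamma_k=\Gamma|_{V_k}$ bounded on $V_k=\{\zeta\in L^2_b(M):X_3\zeta=ik\zeta\}$. *)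

(* Defs.v *)
From HB Require Import structures.
From mathcomp Require Export all_boot all_order all_algebra.
From mathcomp Require Export all_classical all_reals all_analysis.
From mathcomp Require Export complex.
Export Order.TTheory GRing.Theory Num.Theory.
Export numFieldNormedType.Exports.

Set Implicit Arguments.
Unset Strict Implicit.
Unset Printing Implicit Defensive.

Local Open Scope classical_set_scope.
Local Open Scope ring_scope.

Section Smooth.
Context (R : realType).

Fixpoint smooth_upto (n : nat) (V W : normedModType R) (U : set V)
    (f : V -> W) : Prop :=
  if n is n'.+1 then
    (forall x, U x -> differentiable f x) /\
    (forall v : V, smooth_upto n' U (fun x => 'D_v f x))
  else forall x, U x -> {for x, continuous f}.

(* Meant for open U: then only the values of f on U matter. *)
Definition smooth_in (V W : normedModType R) (U : set V) (f : V -> W) : Prop :=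
  forall n, smooth_upto n U f.

End Smooth.

Section Space.
Context (R : realType).

(* Pairs and triples carry the sup norm, which only serves for topology and
   differentiation; lengths and angles are taken from [dot]. *)

Definition dot (p q : R * R * R) : R :=
  p.1.1 * q.1.1 + p.1.2 * q.1.2 + p.2 * q.2.

Definition enorm (p : R * R * R) : R := Num.sqrt (dot p p).

Definition cross (p q : R * R * R) : R * R * R :=
  (p.1.2 * q.2 - p.2 * q.1.2,
   p.2 * q.1.1 - p.1.1 * q.2,
   p.1.1 * q.1.2 - p.1.2 * q.1.1).

Definition e3 : R * R * R := (0, 0, 1).

Definition rot (t : R) (p : R * R * R) : R * R * R :=
  (cos t * p.1.1 - sin t * p.1.2, sin t * p.1.1 + cos t * p.1.2, p.2).

(* The velocity of t |-> rot t p at t = 0. *)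
Definition X3_vec (p : R * R * R) : R * R * R := (- p.1.2, p.1.1, 0).

Definition X3 (u : R * R * R -> R) (p : R * R * R) : R :=
  derive1 (fun t : R => u (rot t p)) 0.

End Space.

Section Surface.
Context (R : realType).
Implicit Types (M : set (R * R * R)) (U : set (R * R)) (X : R * R -> R * R * R).

Definition du (W : normedModType R) (f : R * R -> W) : R * R -> W :=
  fun q => 'D_((1, 0) : R * R) f q.
Definition dv (W : normedModType R) (f : R * R -> W) : R * R -> W :=
  fun q => 'D_((0, 1) : R * R) f q.

Definition chart_normal X (q : R * R) : R * R * R := cross (du X q) (dv X q).

(* Injectivity and the last clause together say that X is a homeomorphism
   from U onto a relatively open subset of M. *)
Definition local_param M U X : Prop :=
  [/\ open U,
      smooth_in U X,
      (forall q, U q -> chart_normal X q != 0),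
      (forall q q', U q -> U q' -> X q = X q' -> q = q') &
      (forall U', open U' -> U' `<=` U ->
         exists2 V : set (R * R * R), open V & X @` U' = M `&` V)].

Definition regular_surface M : Prop :=
  forall p, M p -> exists U X, local_param M U X /\ (X @` U) p.

Definition smooth_on M (W : normedModType R) (F : R * R * R -> W) : Prop :=
  forall U X, local_param M U X -> smooth_in U (F \o X).

Definition sphere : set (R * R * R) := [set p | dot p p = 1].

Definition diffeomorphic (M N : set (R * R * R)) : Prop :=
  exists F G : R * R * R -> R * R * R,
    [/\ smooth_on M F, smooth_on N G,
        (forall p, M p -> N (F p) /\ G (F p) = p) &
        (forall p, N p -> M (G p) /\ F (G p) = p)].

Definition metE X q : R := dot (du X q) (du X q).
Definition metF X q : R := dot (du X q) (dv X q).
Definition metG X q : R := dot (dv X q) (dv X q).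
Definition metdet X q : R := metE X q * metG X q - metF X q ^+ 2.

Definition chart_unit_normal X (q : R * R) : R * R * R :=
  (enorm (chart_normal X q))^-1 *: chart_normal X q.

(* det II / det I *)
Definition gauss_curvature X (q : R * R) : R :=
  let n := chart_unit_normal X q in
  (dot n (du (du X) q) * dot n (dv (dv X) q) - dot n (du (dv X) q) ^+ 2)
    / metdet X q.

Definition positive_curvature M : Prop :=
  forall U X, local_param M U X -> forall q, U q -> 0 < gauss_curvature X q.

Definition rotation_symmetric M : Prop :=
  forall (t : R) p, M p -> M (rot t p).

Definition exterior M : set (R * R * R) :=
  [set x | (~` M) x /\ ~ bounded_set (connected_component (~` M) x)].

Definition outward_unit_normal M (nu : R * R * R -> R * R * R) : Prop :=
  (forall U X, local_param M U X -> forall q, U q ->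
     [/\ dot (nu (X q)) (nu (X q)) = 1,
         dot (nu (X q)) (du X q) = 0 &
         dot (nu (X q)) (dv X q) = 0]) /\
  (forall p, M p -> \forall t \near 0^'+, exterior M (p + t *: nu p)).

(* g is the gradient of u for the induced metric. *)
Definition is_gradient M (u : R * R * R -> R) (g : R * R * R -> R * R * R) :
    Prop :=
  forall U X, local_param M U X -> forall q, U q ->
    [/\ exists a b : R, g (X q) = a *: du X q + b *: dv X q,
        dot (g (X q)) (du X q) = du (u \o X) q &
        dot (g (X q)) (dv X q) = dv (u \o X) q].

(* (det g)^(-1/2) d_i ((det g)^(1/2) g^(ij) d_j (u o X)) *)
Definition chart_laplacian X (u : R * R * R -> R) (q : R * R) : R :=
  let ux := u \o X in
  (Num.sqrt (metdet X q))^-1 *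
  (du (fun q => (metG X q * du ux q - metF X q * dv ux q)
                / Num.sqrt (metdet X q)) q +
   dv (fun q => (metE X q * dv ux q - metF X q * du ux q)
                / Num.sqrt (metdet X q)) q).

Definition is_laplacian M (u h : R * R * R -> R) : Prop :=
  forall U X, local_param M U X -> forall q, U q ->
    h (X q) = chart_laplacian X u q.

(* sigma is the Riemannian area dS on the Borel subsets of M; its values off M
   are irrelevant, since only integrals over M are taken. *)
Definition is_area_measure M
    (sigma : {measure set (R * R * R) -> \bar R}) : Prop :=
  forall U X, local_param M U X ->
  forall B : set (R * R * R), measurable B -> B `<=` X @` U ->
    sigma B = (\int[(@lebesgue_measure R \x @lebesgue_measure R)%E]_(q in
                 U `&` X @^-1` B) (enorm (chart_normal X q))%:E)%E.

End Surface.

Section Operators.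
Context (R : realType).
Variables (M : set (R * R * R)) (sigma : {measure set (R * R * R) -> \bar R}).
Implicit Types (u v : R * R * R -> R) (zeta psi eta : R * R * R -> R[i]).

Definition L2 u : Prop :=
  measurable_fun M u /\ sigma.-integrable M (fun p => (u p ^+ 2)%:E).

Definition L2_cvg (u_ : nat -> R * R * R -> R) u : Prop :=
  (fun n => (\int[sigma]_(p in M) ((u_ n p - u p) ^+ 2)%:E)%E) @ \oo --> 0%E.

(* The self-adjoint Laplace-Beltrami operator on L^2(M), as the closure of
   Laplace-Beltrami on C^oo(M). *)
Definition L2_laplacian u v : Prop :=
  [/\ L2 u, L2 v &
      exists u_ v_ : nat -> R * R * R -> R,
        [/\ (forall n, smooth_on M (u_ n)),
            (forall n, is_laplacian M (u_ n) (v_ n)),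
            L2_cvg u_ u & L2_cvg v_ v]].

Definition average u : R :=
  Rintegral sigma M u / fine (sigma M).

(* u is the inverse Laplacian of v: it has mean zero, and the mean of v is
   discarded first. *)
Definition inverse_laplacian v u : Prop :=
  Rintegral sigma M u = 0 /\ L2_laplacian u (fun p => v p - average v).

Definition cRe zeta : R * R * R -> R := fun p => complex.Re (zeta p).
Definition cIm zeta : R * R * R -> R := fun p => complex.Im (zeta p).

Definition cintegral zeta : R[i] :=
  Complex (Rintegral sigma M (cRe zeta)) (Rintegral sigma M (cIm zeta)).

Definition L2b zeta : Prop :=
  [/\ L2 (cRe zeta), L2 (cIm zeta) & cintegral zeta = 0].

Definition inverse_laplacianC zeta psi : Prop :=
  inverse_laplacian (cRe zeta) (cRe psi) /\
  inverse_laplacian (cIm zeta) (cIm psi).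

(* The graph of zeta |-> a(xi) X_3 zeta + b(xi) X_3 psi on L^2_b(M), where psi
   is the inverse Laplacian of zeta.  X_3 is taken in the sense of
   distributions: it is divergence free and annihilates a(xi) and b(xi), so
   that the pairing of c(xi) X_3 u with a test function phi is minus the
   integral of c(xi) u X_3 phi.  The domain is the maximal one, which is that
   of the direct sum of the restrictions to the eigenspaces of X_3. *)
Definition zonal_operator (xi : R * R * R -> R) (a b : R -> R) zeta eta : Prop :=
  [/\ L2b zeta, L2b eta &
      exists2 psi, inverse_laplacianC zeta psi &
      forall phi : R * R * R -> R, smooth_on M phi ->
        cintegral (fun p => eta p * (phi p)%:C%C) =
        - cintegral (fun p =>
            ((a (xi p))%:C%C * zeta p + (b (xi p))%:C%C * psi p)
              * (X3 phi p)%:C%C)].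

(* The values of the derivatives at the two poles do not matter here, since
   these form a null set. *)
Definition Gamma (xi : R * R * R -> R) (f w chi : R -> R) (Omega : R) :
    (R * R * R -> R[i]) -> (R * R * R -> R[i]) -> Prop :=
  zonal_operator xi (derive1 f) (fun s => Omega * derive1 chi s - derive1 w s).

Definition eigenvalue_of
    (T : (R * R * R -> R[i]) -> (R * R * R -> R[i]) -> Prop) (lambda : R[i]) :
    Prop :=
  exists zeta,
    ~ {ae sigma, forall p, M p -> zeta p = 0} /\
    T zeta (fun p => lambda * zeta p).

End Operators.

(* Main.v *)
From HB Require Import structures.
Require Import Defs.
From mathcomp Require Import measurable_realfun ring lra.

Set Implicit Arguments.
Unset Strict Implicit.
Unset Printing Implicit Defensive.

Local Open Scope classical_set_scope.
Local Open Scope ring_scope.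

(** Let zeta = z1 + i z2 be an eigenfunction for lambda = mu + i om with mu <> 0, let psi = s1 + i s2
be its inverse Laplacian, and put a = f'(xi), b = Omega chi'(xi) - w'(xi), so that
lambda zeta = a X3 zeta + b X3 psi. Three facts about X3 drive the proof: it is skew, it commutes
with multiplication by functions of xi, and it commutes with the Laplacian. By the first two, the
real part of the integral of G a (X3 zeta) conj(zeta) vanishes for every real function G of xi, and
the equation multiplied by G conj(zeta) leaves

  mu int G |zeta|^2 = Re int b G (X3 psi) conj(zeta).

By the third, the right-hand side vanishes when b G is constant. If b has constant sign, take
G = 1 / b: the integral of |zeta|^2 / b vanishes, and so does zeta. If b (K - a) >= 0, take
G = (K - a) / b: the constant K contributes nothing and, by the equation multiplied by conj(psi),
the term in a gives

  int ((K - a) / b) |zeta|^2 = int psi conj(zeta) = - int |grad psi|^2,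

whose two sides have opposite signs; psi is then constant and zeta = 0. These two cases are
[no_growth_sign] and [no_growth_shear], and the theorem is their contrapositive.

Three things have to be made rigorous. First, zeta is only square integrable, and the equation holds
in the sense of distributions. The field X3 is replaced by the symmetric difference quotient [Dq h]
along the rotations, which has the three properties above; [weak_lim] shows that a test function may
be any L2 limit of smooth functions if X3 is read as the limit of [Dq h], because the mean value
theorem bounds the quotients independently of h. The quotients of psi are bounded by the Dirichlet
integral ([lapl_Dq_bound]), which rests on Green's identity ([Green]) for the Laplacian defined by
charts. Secondly, b may vanish: 1 / b is replaced by b / (b^2 + d^2), and [defect_energy], the same
identity with G = d^2 / (b^2 + d^2), shows that the error disappears with d. Thirdly, the derivatives
with respect to xi are smooth only off the axis of rotation. All coefficients are multiplied by smooth
functions of the distance to the axis that vanish near the axis and tend to 1 off it; the axis has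
measure zero ([sigma_axis]), so that these cutoffs disappear in the limit.

The geometry that is used: off the axis xi has a nonzero gradient, so that it takes its extremal
values only on the axis ([xi_interior]) and functions of xi can be differentiated in xi
([zonal_derive]); and the normal, hence chi, is a smooth function there because it can be expressed
through the gradient of xi ([smooth_on_chi]). *)

(** * Calculus of smooth functions *)

Section Differentials.
Context (R : realType) (V W : normedModType R).
Implicit Types (f g : V -> W) (x : V).

Lemma near_shift0 x (P : set V) :
  (\forall y \near x, P y) <-> (\forall h \near (0 : V), P (h + x)).
Proof.
by rewrite (near_shift 0 x) subr0; split=> h; near do rewrite /= ; exact: h.
Unshelve. all: by end_near. Qed.

Lemma diff_approx f x : differentiable f x ->
  forall e, 0 < e ->
  \forall y \near x, `|f y - f x - 'd f x (y - x)| <= e * `|y - x|.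
Proof.
move=> /diff_locallyP [_ /eqaddoP fo] e e0.
apply/near_shift0; have := fo _ e0; apply: filterS => h /=.
by rewrite addrK !fctE /= opprD addrA.
Qed.

(** Differentials are handled through linear approximations with an explicit error: the inverse of
a chart is composed with curves before any differentiability of the inverse is known. *)
Lemma approx_differentiable f x (df : {linear V -> W}) : continuous df ->
  (forall e, 0 < e ->
    \forall y \near x, `|f y - f x - df (y - x)| <= e * `|y - x|) ->
  differentiable f x /\ 'd f x = df :> (V -> W).
Proof.
move=> dfc H.
have H1 : f \o shift x = cst (f x) + df +o_ 0 id.
  apply/eqaddoP => e e0; have /near_shift0 := H _ e0; apply: filterS => h /=.
  by rewrite addrK !fctE /= opprD addrA.
have H2 := diff_unique dfc H1.
by split=> //; apply/diff_locallyP; rewrite H2.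
Qed.

Lemma near_eq_differentiable f g x : (\forall y \near x, f y = g y) ->
  differentiable f x -> differentiable g x.
Proof.
move=> fg df; apply: (proj1 (@approx_differentiable _ _ ('d f x) _ _)).
  exact: diff_continuous.
move=> e e0; have := diff_approx df e0.
rewrite -(nbhs_singleton fg) => H; near=> y.
by rewrite -(near fg y)//; near: y.
Unshelve. all: by end_near. Qed.

End Differentials.

Section SmoothCalculus.
Context (R : realType) (V : normedModType R).
Implicit Types (U : set V) (x : V).

Lemma smooth_uptoP (W : normedModType R) n U (f : V -> W) :
  smooth_upto n U f <-> forall x, U x -> smooth_upto n [set x] f.
Proof.
elim: n f => [|n IH] f /=.
  split=> [H x Ux y -> |H x Ux]; first exact: H.
  exact: H Ux _ erefl.
split=> [[H1 H2] x Ux|H].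
  split=> [y -> |v]; first exact: H1.
  by have /IH := H2 v; apply.
split=> [x Ux|v]; first exact: (proj1 (H x Ux)).
by apply/IH => x Ux; apply: (proj2 (H x Ux)).
Qed.

Lemma smooth_uptoW (W : normedModType R) n U (f : V -> W) :
  smooth_upto n.+1 U f -> smooth_upto n U f.
Proof.
elim: n f => [|n IH] f; first by case=> H _ x Ux; exact: differentiable_continuous (H x Ux).
by case=> H1 H2; split=> // v; apply: IH; exact: H2.
Qed.

Lemma smooth_upto_near (W : normedModType R) n x (f g : V -> W) :
  (\forall y \near x, f y = g y) ->
  smooth_upto n [set x] f -> smooth_upto n [set x] g.
Proof.
elim: n f g => [|n IH] f g fg /=.
  move=> H y -> ; have {}H := H _ erefl.
  rewrite /prop_for /continuous_at -(nbhs_singleton fg).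
  by apply: cvg_trans H; apply: near_eq_cvg.
case=> H1 H2; split=> [y -> |v].
  exact: near_eq_differentiable fg (H1 _ erefl).
apply: IH (H2 v).
have := near_join fg; apply: filterS => y fgy.
exact: near_eq_derive.
Qed.

Lemma smooth_upto_eq (W : normedModType R) n U (f g : V -> W) : open U ->
  (forall x, U x -> f x = g x) -> smooth_upto n U f -> smooth_upto n U g.
Proof.
move=> oU fg /smooth_uptoP H; apply/smooth_uptoP => x Ux.
apply: smooth_upto_near (H x Ux); have := open_nbhs_nbhs (conj oU Ux).
by apply: filterS => y; exact: fg.
Qed.

Lemma smooth_uptoS (W : normedModType R) n U U' (f : V -> W) :
  U `<=` U' -> smooth_upto n U' f -> smooth_upto n U f.
Proof. by move=> UU /smooth_uptoP H; apply/smooth_uptoP => x /UU; exact: H. Qed.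

Lemma smooth_upto_continuous (W : normedModType R) n U (f : V -> W) x : smooth_upto n U f -> U x ->
  {for x, continuous f}.
Proof.
case: n => [|n] /=; first by move=> H; exact: H.
by case=> H _ Ux; exact: differentiable_continuous (H x Ux).
Qed.

Lemma smooth_upto_cst (W : normedModType R) n U (c : W) : smooth_upto n U (fun=> c).
Proof.
elim: n c => [|n IH] c /=; first by move=> x _; exact: cvg_cst.
split=> [x _|v]; first exact: differentiable_cst.
have -> : (fun x : V => 'D_v (fun=> c) x) = fun=> 0; last exact: IH.
by apply/funext => x; rewrite derive_cst.
Qed.

Lemma smooth_uptoD (W : normedModType R) n U (f g : V -> W) : open U ->
  smooth_upto n U f -> smooth_upto n U g ->
  smooth_upto n U (fun x => f x + g x).
Proof.
move=> oU; elim: n f g => [|n IH] f g /=.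
  by move=> Hf Hg x Ux; apply: cvgD; [exact: Hf|exact: Hg].
move=> [f1 f2] [g1 g2]; split=> [x Ux|v].
  by apply: differentiableD; [exact: f1|exact: g1].
apply: (@smooth_upto_eq _ _ _ (fun x => 'D_v f x + 'D_v g x)) => //; last exact: IH.
by move=> x Ux; rewrite deriveD//; apply: diff_derivable; [exact: f1|exact: g1].
Qed.

Lemma smooth_upto_lin (W W' : normedModType R) n U (L : {linear W -> W'}) (f : V -> W) :
  open U -> continuous L -> smooth_upto n U f -> smooth_upto n U (fun x => L (f x)).
Proof.
move=> oU cL; elim: n f => [|n IH] f /=.
  by move=> Hf x Ux; apply: continuous_comp; [exact: Hf|exact: cL].
move=> [f1 f2]; have dL y : differentiable L y by exact: linear_differentiable.
split=> [x Ux|v].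
  by apply: differentiable_comp; [exact: f1|exact: dL].
apply: (@smooth_upto_eq _ _ _ (fun x => L ('D_v f x))) => //; last exact: IH.
move=> x Ux; rewrite !deriveE//; last exact: f1.
  by rewrite (@diff_comp _ _ _ _ f L) ?diff_lin//; exact: f1.
by apply: differentiable_comp; [exact: f1|exact: dL].
Qed.

Lemma smooth_uptoM n U (f g : V -> R) : open U ->
  smooth_upto n U f -> smooth_upto n U g ->
  smooth_upto n U (fun x => f x * g x).
Proof.
move=> oU; elim: n f g => [|n IH] f g.
  by move=> Hf Hg x Ux; apply: cvgM; [exact: Hf|exact: Hg].
move=> F G; move: (F) (G) => [f1 f2] [g1 g2]; split=> [x Ux|v].
  by apply: differentiableM; [exact: f1|exact: g1].
apply: (@smooth_upto_eq _ _ _ (fun x => f x * 'D_v g x + g x * 'D_v f x)) => //.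
  by move=> x Ux; rewrite deriveM//; apply: diff_derivable; [exact: f1|exact: g1].
by apply: smooth_uptoD => //; apply: IH => //; first [exact: smooth_uptoW F | exact: smooth_uptoW G | exact: f2 | exact: g2].
Qed.

Lemma derive_comp1 (h : R -> R) (f : V -> R) x v dh :
  is_derive (f x) 1 h dh -> differentiable f x ->
  differentiable (h \o f) x /\ 'D_v (h \o f) x = dh * 'D_v f x.
Proof.
move=> [hd hE] df.
have dhf : differentiable h (f x) by exact/derivable1_diffP.
split; first exact: differentiable_comp.
rewrite deriveE; last exact: differentiable_comp.
by rewrite diff_comp//= deriveE// diff1E//= derive1E hE /= mulrC.
Qed.

(** Differentiating [h \o f] brings in [h' \o f]: smoothness is obtained one order at a time, along a
family of functions of one variable that is stable under differentiation. *)
Lemma smooth_upto_comp1 n U (h h' : R -> R) (f : V -> R) : open U ->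
  smooth_upto n.+1 U f ->
  (forall x, U x -> is_derive (f x) 1 h (h' (f x))) ->
  smooth_upto n U (h' \o f) -> smooth_upto n.+1 U (h \o f).
Proof.
move=> oU F Hd Hh; move: (F) => [f1 f2]; split=> [x Ux|v].
  exact: (proj1 (derive_comp1 0 (Hd x Ux) (f1 x Ux))).
apply: (@smooth_upto_eq _ _ _ (fun x => (h' \o f) x * 'D_v f x)) => //.
  by move=> x Ux; rewrite (proj2 (derive_comp1 v (Hd x Ux) (f1 x Ux))).
by apply: smooth_uptoM => //; exact: f2.
Qed.

Lemma smooth_in_eq (W : normedModType R) U (f g : V -> W) : open U ->
  (forall x, U x -> f x = g x) -> smooth_in U f -> smooth_in U g.
Proof. by move=> oU fg H n; apply: smooth_upto_eq (H n). Qed.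

Lemma smooth_in_local (W : normedModType R) U (f : V -> W) :
  (forall x, U x -> exists N g, [/\ open N, N x, smooth_in N g & forall y, N y -> g y = f y]) ->
  smooth_in U f.
Proof.
move=> H n; apply/smooth_uptoP => x /H [N [g [oN Nx sg gf]]].
apply: smooth_uptoS (smooth_upto_eq oN gf (sg n)).
by move=> _ ->.
Qed.

Lemma smooth_inS (W : normedModType R) U U' (f : V -> W) : U `<=` U' -> smooth_in U' f -> smooth_in U f.
Proof. by move=> UU H n; apply: smooth_uptoS UU (H n). Qed.

Lemma smooth_in_cst (W : normedModType R) U (c : W) : smooth_in U (fun=> c).
Proof. by move=> n; exact: smooth_upto_cst. Qed.

Lemma smooth_inD (W : normedModType R) U (f g : V -> W) : open U -> smooth_in U f -> smooth_in U g ->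
  smooth_in U (fun x => f x + g x).
Proof. by move=> oU F G n; apply: smooth_uptoD. Qed.

Lemma smooth_in_lin (W W' : normedModType R) U (L : {linear W -> W'}) (f : V -> W) :
  open U -> continuous L -> smooth_in U f -> smooth_in U (fun x => L (f x)).
Proof. by move=> oU cL F n; apply: smooth_upto_lin. Qed.

Lemma smooth_inM U (f g : V -> R) : open U -> smooth_in U f -> smooth_in U g ->
  smooth_in U (fun x => f x * g x).
Proof. by move=> oU F G n; apply: smooth_uptoM. Qed.

Lemma smooth_inN U (f : V -> R) : open U -> smooth_in U f -> smooth_in U (fun x => - f x).
Proof.
move=> oU F; apply: (@smooth_in_eq _ _ (fun x => (-1) * f x)) => //.
  by move=> x _; rewrite mulN1r.
by apply: smooth_inM => //; exact: smooth_in_cst.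
Qed.

Lemma smooth_inB U (f g : V -> R) : open U -> smooth_in U f -> smooth_in U g ->
  smooth_in U (fun x => f x - g x).
Proof. by move=> oU F G; apply: smooth_inD => //; exact: smooth_inN. Qed.

Lemma smooth_inX U (f : V -> R) k : open U -> smooth_in U f ->
  smooth_in U (fun x => f x ^+ k).
Proof.
move=> oU F; elim: k => [|k IH].
  by under eq_fun do rewrite expr0; exact: smooth_in_cst.
by under eq_fun do rewrite exprS; exact: smooth_inM.
Qed.

Lemma smooth_in_differentiable (W : normedModType R) U (f : V -> W) x : smooth_in U f -> U x -> differentiable f x.
Proof. by move=> /(_ 1%N)[H _]; exact: H. Qed.

Lemma smooth_in_continuous (W : normedModType R) U (f : V -> W) x : smooth_in U f -> U x -> {for x, continuous f}.
Proof. by move=> H Ux; exact: smooth_upto_continuous (H 0%N) Ux. Qed.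

Lemma smooth_in_derive (W : normedModType R) U (f : V -> W) v : smooth_in U f -> smooth_in U (fun x => 'D_v f x).
Proof. by move=> H n; have [_ ] := H n.+1; exact. Qed.

Lemma smooth_inV U (f : V -> R) : open U -> smooth_in U f ->
  (forall x, U x -> f x != 0) -> smooth_in U (fun x => (f x)^-1).
Proof.
move=> oU F f0; elim=> [|n IH].
  by move=> x Ux; apply: cvgV; [exact: f0|exact: (smooth_in_continuous F)].
apply: (@smooth_upto_comp1 _ _ GRing.inv (fun y => - (y^-1 * y^-1))) => //.
  move=> x Ux; have dI := @derivable_id _ R (f x) 1.
  apply: DeriveDef; first exact: (derivableV (f0 x Ux) dI).
  by rewrite (deriveV (f0 x Ux) dI) derive_id /= expr2 invfM scaleNr /GRing.scale /= mulr1.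
have -> : (fun y => - (y^-1 * y^-1)) \o f = fun x => (-1) * ((f x)^-1 * (f x)^-1).
  by apply/funext => x /=; rewrite mulN1r.
by apply: smooth_uptoM => //; [exact: smooth_upto_cst|exact: smooth_uptoM].
Qed.

Lemma smooth_in_sqrt U (f : V -> R) : open U -> smooth_in U f ->
  (forall x, U x -> 0 < f x) -> smooth_in U (fun x => Num.sqrt (f x)).
Proof.
move=> oU F f0; elim=> [|n IH].
  move=> x Ux; apply: continuous_comp; first exact: (smooth_in_continuous F).
  exact: sqrt_continuous.
apply: (@smooth_upto_comp1 _ _ Num.sqrt (fun y => (2 * Num.sqrt y)^-1)) => //.
  by move=> x Ux; apply: is_derive1_sqrt; exact: f0.
have H : smooth_upto n U (fun x => 2^-1 * ((f x)^-1 * Num.sqrt (f x))).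
  apply: smooth_uptoM => //; first exact: smooth_upto_cst.
  by apply: smooth_uptoM => //; apply: smooth_inV => // x /f0; rewrite lt0r => /andP[].
apply: smooth_upto_eq H => // x Ux /=; rewrite invfM; congr (_ * _).
have s0 : Num.sqrt (f x) != 0 by rewrite gt_eqF// sqrtr_gt0 f0.
by rewrite -[in X in X^-1](@sqr_sqrtr _ (f x)) ?ltW ?f0// expr2 invfM mulfVK.
Qed.

End SmoothCalculus.

(** * A flat function *)

Section Flat.
Context (R : realType).

(** [flatn 0] is exp(-1/x) extended by zero; the powers of 1/x make the family stable under
differentiation. *)
Definition flatn (k : nat) (x : R) : R :=
  if 0 < x then x^-1 ^+ k * expR (- x^-1) else 0.

Lemma flatn_gt k x : 0 < x -> flatn k x = x^-1 ^+ k * expR (- x^-1).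
Proof. by rewrite /flatn => ->. Qed.

Lemma flatn_le k x : x <= 0 -> flatn k x = 0.
Proof. by rewrite /flatn leNgt => /negbTE ->. Qed.

Lemma flatn_ge0 k x : 0 <= flatn k x.
Proof.
rewrite /flatn; case: ifP => // x0; apply: mulr_ge0; last exact: expR_ge0.
by rewrite exprn_ge0// invr_ge0 ltW.
Qed.

(** The exponential beats every power; a quadratic bound makes the derivative at the origin zero. *)
Lemma flatn_quadratic k x : flatn k x <= k.+2%:R ^+ k.+2 * x ^+ 2.
Proof.
have [x0|x0] := ltP 0 x; last first.
  by rewrite flatn_le//; apply: mulr_ge0; [exact: exprn_ge0|exact: sqr_ge0].
rewrite flatn_gt//; set m := k.+2.
have m0 : 0 < m%:R :> R by rewrite ltr0n.
have H : (x^-1 / m%:R) ^+ m <= expR (x^-1).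
  have -> : expR (x^-1) = expR (x^-1 / m%:R) ^+ m.
    by rewrite -expRM_natl// mulrC divfK// gt_eqF.
  apply: lerXn2r.
  - by rewrite nnegrE divr_ge0 ?invr_ge0// ltW.
  - by rewrite nnegrE expR_ge0.
  - by apply: le_trans (expR_ge1Dx _); rewrite lerDr.
rewrite expRN ler_pdivrMr ?expR_gt0//.
apply: le_trans (ler_wpM2l _ H); last by rewrite mulr_ge0 ?exprn_ge0// ltW.
rewrite le_eqVlt; apply/orP; left; apply/eqP.
rewrite expr_div_n mulrA mulrAC [X in X * _]mulrAC -/m.
rewrite mulrAC divff ?expf_neq0 ?gt_eqF// mul1r /m exprSr exprSr.
by rewrite -!mulrA mulrC -!mulrA; field; rewrite gt_eqF.
Qed.

Lemma is_derive_flatn k x :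
  is_derive (x : R) (1 : R) (flatn k : R -> R) (flatn k.+2 x - k%:R * flatn k.+1 x).
Proof.
have [x0|x0|x0] := ltgtP 0 x.
- have E : \forall y \near x, y^-1 ^+ k * expR (- y^-1) = flatn k y.
    near=> y; rewrite flatn_gt//; near: y; exact: lt_nbhsr.
  apply: near_eq_is_derive E _.
  have xn0 : x != 0 by rewrite gt_eqF.
  have dV : is_derive x 1 (fun y : R => y^-1) (- x ^- 2).
    have dI := @derivable_id _ R x 1.
    apply: DeriveDef; first exact: (derivableV xn0 dI).
    by rewrite (deriveV xn0 dI) derive_id /= /GRing.scale /= mulr1.
  have dE : is_derive x 1 (fun y : R => expR (- y^-1)) (expR (- x^-1) * x ^- 2).
    have := @is_derive1_comp _ expR (fun y : R => - y^-1) x _ _ (is_derive_expR _) (is_deriveN _).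
    by move=> /(_ _ dV) H; apply: is_derive_eq; rewrite opprK.
  have H := is_deriveM (is_deriveX k dV) dE.
  have {}E : GRing.inv ^+ k * (fun y : R => expR (- y^-1))
      = (fun y : R => y^-1 ^+ k * expR (- y^-1)) by rewrite !fctE.
  rewrite E in H; apply: (is_derive_eq H).
  rewrite !flatn_gt// /GRing.scale /= !fctE.
  case: k {H E} => [|k]; first by rewrite !mul0r; field.
  by rewrite /= !exprSr; field.
- have E : \forall y \near x, 0 = flatn k y.
    near=> y; rewrite flatn_le//; apply: ltW; near: y; exact: lt_nbhsl.
  apply: near_eq_is_derive E _.
  by rewrite !flatn_le ?ltW// mulr0 subr0; exact: is_derive_cst.
- rewrite -x0 !flatn_le// mulr0 subr0.
  have H : h^-1 *: (flatn k (h *: 1 + 0) - flatn k 0) @[h --> 0^'] --> (0 : R).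
    apply/cvgrPdist_le => e e0.
    have C0 : 0 < k.+2%:R ^+ k.+2 :> R by rewrite exprn_gt0.
    near=> h.
    rewrite sub0r normrN (flatn_le k (lexx 0)) subr0 addr0 /GRing.scale /= mulr1.
    rewrite normrM normfV (ger0_norm (flatn_ge0 _ _)).
    have h0 : 0 < `|h| by rewrite normr_gt0; near: h; exact: nbhs_dnbhs_neq.
    rewrite mulrC ler_pdivrMr//; apply: le_trans (flatn_quadratic _ _) _.
    rewrite -real_normK ?num_real// expr2 mulrA ler_pM2r// mulrC -ler_pdivlMr//.
    near: h; apply: dnbhs0_le; exact: divr_gt0.
  apply: DeriveDef; first by apply/cvg_ex; exists 0.
  exact: cvg_lim H.
Unshelve. all: by end_near. Qed.

Definition flat : R -> R := flatn 0.

Lemma flat_gt0 x : 0 < x -> 0 < flat x.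
Proof. by move=> x0; rewrite /flat flatn_gt// expr0 mul1r expR_gt0. Qed.

Lemma flat_ge0 x : 0 <= flat x. Proof. exact: flatn_ge0. Qed.

Lemma flat_le0 x : x <= 0 -> flat x = 0. Proof. exact: flatn_le. Qed.

Lemma flat_le1 x : flat x <= 1.
Proof.
have [x0|x0] := ltP 0 x; last by rewrite flat_le0.
by rewrite /flat flatn_gt// expr0 mul1r expR_le1 oppr_le0 invr_ge0 ltW.
Qed.

Lemma smooth_in_flat (V : normedModType R) (U : set V) (f : V -> R) : open U -> smooth_in U f ->
  smooth_in U (fun x => flat (f x)).
Proof.
move=> oU F n; rewrite /flat.
elim: n 0%N => [|n IH] k.
  move=> x Ux; apply: continuous_comp; first exact: (smooth_in_continuous F).
  apply/differentiable_continuous/derivable1_diffP.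
  by have [] := is_derive_flatn k (f x).
apply: (@smooth_upto_comp1 _ _ _ _ (flatn k) (fun x => flatn k.+2 x - k%:R * flatn k.+1 x)) => //.
  by move=> x _; exact: is_derive_flatn.
have H : smooth_upto n U (fun x => flatn k.+2 (f x) + (- k%:R) * flatn k.+1 (f x)).
  apply: smooth_uptoD => //; apply: smooth_uptoM => //; exact: smooth_upto_cst.
by apply: smooth_upto_eq H => // x _; rewrite /= mulNr.
Qed.

Lemma flat_cvg1 (c : nat -> R) : c @ \oo --> +oo -> flat (c n) @[n --> \oo] --> (1 : R).
Proof.
move=> cy.
have H : expR (- (c n)^-1) @[n --> \oo] --> (1 : R).
  rewrite -expR0; apply: continuous_cvg; first exact: continuous_expR.
  rewrite -oppr0; apply: cvgN; apply/gtr0_cvgV0.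
    by near=> n; near: n; exact: cvgry_gt.
  exact: cy.
apply: cvg_trans H; apply: near_eq_cvg; near=> n.
rewrite /flat flatn_gt ?expr0 ?mul1r//; near: n; exact: cvgry_gt.
Unshelve. all: by end_near. Qed.

End Flat.

(** * Tangent vectors and curves on a parametrized surface *)

Section Coordinates.
Context (R : realType).

Lemma fst_linear (V W : normedModType R) : linear (@fst V W).
Proof. by []. Qed.
HB.instance Definition _ (V W : normedModType R) :=
  GRing.isLinear.Build R (V * W)%type V _ (@fst V W) (@fst_linear V W).

Lemma snd_linear (V W : normedModType R) : linear (@snd V W).
Proof. by []. Qed.
HB.instance Definition _ (V W : normedModType R) :=
  GRing.isLinear.Build R (V * W)%type W _ (@snd V W) (@snd_linear V W).

Lemma fst_continuous (V W : normedModType R) : continuous (@fst V W).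
Proof. by move=> x; exact: cvg_fst. Qed.

Lemma snd_continuous (V W : normedModType R) : continuous (@snd V W).
Proof. by move=> x; exact: cvg_snd. Qed.

Lemma derive_lin (V W W' : normedModType R) (L : {linear W -> W'}) (f : V -> W) x v :
  continuous L -> differentiable f x ->
  differentiable (L \o f) x /\ 'D_v (L \o f) x = L ('D_v f x).
Proof.
move=> cL df; have dL y : differentiable L y by exact: linear_differentiable.
have dLf : differentiable (L \o f) x by exact: differentiable_comp.
by split=> //; rewrite !deriveE// diff_comp// diff_lin.
Qed.

Definition px (p : R * R * R) : R := p.1.1.
Definition py (p : R * R * R) : R := p.1.2.
Definition pz (p : R * R * R) : R := p.2.

Lemma px_linear : linear px. Proof. by []. Qed.
Lemma py_linear : linear py. Proof. by []. Qed.
Lemma pz_linear : linear pz. Proof. by []. Qed.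
HB.instance Definition _ := GRing.isLinear.Build R (R * R * R)%type R _ px px_linear.
HB.instance Definition _ := GRing.isLinear.Build R (R * R * R)%type R _ py py_linear.
HB.instance Definition _ := GRing.isLinear.Build R (R * R * R)%type R _ pz pz_linear.

Lemma px_continuous : continuous px.
Proof. by move=> x; apply: continuous_comp; exact: fst_continuous. Qed.
Lemma py_continuous : continuous py.
Proof. by move=> x; apply: continuous_comp; [exact: fst_continuous|exact: snd_continuous]. Qed.
Lemma pz_continuous : continuous pz.
Proof. by move=> x; exact: snd_continuous. Qed.

Lemma smooth_in_coord (V : normedModType R) (U : set V) (X : V -> R * R * R) : open U ->
  smooth_in U X -> [/\ smooth_in U (px \o X), smooth_in U (py \o X) & smooth_in U (pz \o X)].
Proof.
by move=> oU sX; split; apply: smooth_in_lin => //;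
  [exact: px_continuous|exact: py_continuous|exact: pz_continuous].
Qed.

Lemma smooth_in_dot (V : normedModType R) (U : set V) (X Y : V -> R * R * R) : open U ->
  smooth_in U X -> smooth_in U Y -> smooth_in U (fun q => dot (X q) (Y q)).
Proof.
move=> oU /(smooth_in_coord oU)[? ? ?] /(smooth_in_coord oU)[? ? ?].
by rewrite /dot; apply: smooth_inD => //; [apply: smooth_inD => //|]; exact: smooth_inM.
Qed.

Lemma diff2E (W : normedModType R) (f : R * R -> W) q h : differentiable f q ->
  'd f q h = h.1 *: du f q + h.2 *: dv f q.
Proof.
move=> df; rewrite /du /dv !deriveE// -!linearZ/= -linearD; congr ('d f q _).
by case: h => a b; rewrite /GRing.scale/= /GRing.add /= /add_pair /= /GRing.scale /= !mulr1 !mulr0 addr0 add0r.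
Qed.

Lemma dotC (p q : R * R * R) : dot p q = dot q p.
Proof. by rewrite /dot; ring. Qed.
Lemma dotDl (p q r : R * R * R) : dot (p + q) r = dot p r + dot q r.
Proof. by rewrite /dot /=; ring. Qed.
Lemma dotZl a (p r : R * R * R) : dot (a *: p) r = a * dot p r.
Proof. by rewrite /dot /= /GRing.scale/=; ring. Qed.
Lemma dotDr (p q r : R * R * R) : dot r (p + q) = dot r p + dot r q.
Proof. by rewrite dotC dotDl !(dotC r). Qed.
Lemma dotZr a (p r : R * R * R) : dot r (a *: p) = a * dot r p.
Proof. by rewrite dotC dotZl (dotC r). Qed.

Lemma dot_ge0 (p : R * R * R) : 0 <= dot p p.
Proof. by rewrite /dot !addr_ge0// -expr2 sqr_ge0. Qed.

Lemma dot_eq0 (p : R * R * R) : dot p p = 0 -> p = 0.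
Proof.
case: p => [[a b] c]; rewrite /dot /= => H.
have : a ^+ 2 + b ^+ 2 + c ^+ 2 = 0 by rewrite !expr2.
move=> /eqP; rewrite !paddr_eq0 ?addr_ge0 ?sqr_ge0// !sqrf_eq0.
by move=> /andP[/andP[/eqP -> /eqP ->] /eqP ->].
Qed.

Lemma lagrange (p q : R * R * R) :
  dot (cross p q) (cross p q) = dot p p * dot q q - dot p q ^+ 2.
Proof. by rewrite /dot /cross /=; ring. Qed.

End Coordinates.

Section Charts.
Context (R : realType).
Implicit Types (M : set (R * R * R)) (U : set (R * R)) (X : R * R -> R * R * R).

Definition tangent X q (a : R * R) : R * R * R := a.1 *: du X q + a.2 *: dv X q.

(** The inverse of [tangent X q] on the tangent plane, by inversion of the Gram matrix of the
coordinate vectors. *)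
Definition tcoord X q (p : R * R * R) : R * R :=
  ((metG X q * dot p (du X q) - metF X q * dot p (dv X q)) / metdet X q,
   (metE X q * dot p (dv X q) - metF X q * dot p (du X q)) / metdet X q).

Lemma tcoord_eq X q p c d : dot p (du X q) = c -> dot p (dv X q) = d ->
  tcoord X q p = ((metG X q * c - metF X q * d) / metdet X q,
                  (metE X q * d - metF X q * c) / metdet X q).
Proof. by move=> <- <-. Qed.

Lemma metdet_normal X q : metdet X q = dot (chart_normal X q) (chart_normal X q).
Proof. by rewrite lagrange. Qed.

Lemma metdet_gt0 X q : chart_normal X q != 0 -> 0 < metdet X q.
Proof.
move=> n0; rewrite lt0r metdet_normal dot_ge0 andbT.
by apply: contra_neq n0 => /dot_eq0.
Qed.

Lemma enorm_normal X q : enorm (chart_normal X q) = Num.sqrt (metdet X q).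
Proof. by rewrite metdet_normal. Qed.

Lemma tcoordK X q a : metdet X q != 0 -> tcoord X q (tangent X q a) = a.
Proof.
rewrite /tcoord /tangent /metdet /metE /metF /metG.
move: (du X q) (dv X q) => u v; case: a => a b /=.
rewrite !(dotDl, dotZl) (dotC v u).
move: (dot u u) (dot u v) (dot v v) => e f g D0.
by congr (_, _); field.
Qed.

Lemma tcoord_linear X q : linear (tcoord X q).
Proof.
move=> k x y; rewrite /tcoord.
move: (metE X q) (metF X q) (metG X q) (metdet X q) (du X q) (dv X q) => e f g d u v.
rewrite !(dotDl, dotZl).
have -> (a b a' b' : R) : k *: (a, b) + (a', b') = (k * a + a', k * b + b') by [].
by congr (_, _); ring.
Qed.

HB.instance Definition _ X q :=
  GRing.isLinear.Build R (R * R * R)%type (R * R)%type _ (tcoord X q) (tcoord_linear X q).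

Lemma tcoord_continuous X q : continuous (tcoord X q).
Proof.
have H (b : R * R * R) : continuous (fun p => dot p b).
  move=> p; rewrite /dot; apply: cvgD; last by apply: cvgM (@cvg_cst _ _ _ _ _); exact: pz_continuous.
  by apply: cvgD; apply: cvgM (@cvg_cst _ _ _ _ _); [exact: px_continuous|exact: py_continuous].
have H2 (a b d : R) (u v : R * R * R) : continuous (fun p => (a * dot p u - b * dot p v) / d).
  by move=> p; apply: cvgM (@cvg_cst _ _ _ _ _); apply: cvgB;
    apply: cvgM (@cvg_cst _ _ _ _ _) (H _ _).
move=> p; exact: (cvg_pair (H2 _ _ _ _ _ p) (H2 _ _ _ _ _ p)).
Qed.

(** The inverse of a chart is only known to be continuous; the injectivity of the differential of X
makes it differentiable along curves. *)
Lemma chart_lift M U X q0 (c : R -> R * R * R) : local_param M U X -> U q0 ->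
  c 0 = X q0 -> (\forall s \near (0 : R), M (c s)) -> differentiable c 0 ->
  exists g : R -> R * R,
    [/\ g 0 = q0, \forall s \near (0 : R), U (g s) /\ X (g s) = c s,
        differentiable g 0, 'D_1 g 0 = tcoord X q0 ('D_1 c 0) &
        tangent X q0 ('D_1 g 0) = 'D_1 c 0].
Proof.
move=> [oU sX n0 inj homeo] Uq0 c0 Mc dc.
have cc := differentiable_continuous dc.
pose g s := xget q0 [set q | U q /\ X q = c s].
have gP q s : U q -> X q = c s -> g s = q.
  move=> Uq Xq; have [Ug Xg] : [set q | U q /\ X q = c s] (g s) by apply: (@xgetI _ _ _ q).
  by apply: inj => //; rewrite Xg.
have g0 : g 0 = q0 by apply: gP.
have lift U' : open U' -> U' `<=` U -> U' q0 ->
    \forall s \near (0 : R), U' (g s) /\ X (g s) = c s.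
  move=> oU' sU' U'q0; have [V oV E] := homeo U' oU' sU'.
  have Vc : V (c 0).
    by have : (M `&` V) (X q0); [rewrite -E; exists q0|rewrite c0 => -[]].
  have nV : \forall s \near (0 : R), V (c s) by apply: cc; exact: open_nbhs_nbhs.
  near=> s.
  have : (M `&` V) (c s) by split; near: s.
  by rewrite -E => -[q U'q Xq]; rewrite (gP q)//; exact: sU'.
have gU := lift U oU (fun x => id) Uq0.
have cg : g s @[s --> (0 : R)] --> q0.
  move=> N /= Nq0; have [N' [oN' N'q0] N'N] := nbhs_interior Nq0.
  have := lift (N° `&` U) (openI (open_interior N) oU) (@subIsetr _ _ _) (conj (nbhs_singleton (nbhs_interior Nq0)) Uq0).
  by apply: filterS => s [[/interior_subset]].
have dX := smooth_in_differentiable sX Uq0.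
have D0 : metdet X q0 != 0 by rewrite gt_eqF// metdet_gt0// n0.
pose L : {linear (R * R * R)%type -> (R * R)%type} := tcoord X q0.
have cL : continuous L by exact: tcoord_continuous.
have [k k0 kL] := linear_lipschitz cL.
have LX h : L ('d X q0 h) = h by rewrite diff2E//; exact: tcoordK.
set t := 'D_1 c 0; pose a : R * R := L t.
have dct s : 'd c 0 s = s *: t by rewrite /t deriveE// -linearZ /= [_%:A]mulr1.
(* the increment of g is controlled by that of c *)
have key e : 0 < e -> \forall s \near (0 : R),
    `|g s - q0 - s *: a| <= k * e * `|s| + k * e * `|g s - q0|.
  move=> e0; have nc := diff_approx dc e0.
  have nX : \forall s \near (0 : R), `|X (g s) - X q0 - 'd X q0 (g s - q0)| <= e * `|g s - q0|.
    exact: (cg _ (diff_approx dX e0)).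
  near=> s.
  have [_ Xg] : U (g s) /\ X (g s) = c s by near: s.
  have -> : g s - q0 - s *: a = L (c s - c 0 - 'd c 0 (s - 0)) - L (X (g s) - X q0 - 'd X q0 (g s - q0)).
    rewrite Xg c0 subr0 dct; set A := c s - X q0; set h := g s - q0.
    have -> : L (A - s *: t) = L A - s *: a by rewrite linearB linearZ.
    have -> : L (A - 'd X q0 h) = L A - h by rewrite linearB /= -/L LX.
    by rewrite opprB [RHS]addrC addrA subrK.
  apply: le_trans (ler_normB _ _) _; rewrite -!mulrA; apply: lerD;
    apply: le_trans (kL _) _; rewrite ler_pM2l//.
    by rewrite -[X in e * `|X|]subr0; near: s.
  by near: s.
pose da0 (s : R) : R * R := s *: a.
have da0l : linear da0 by move=> ? ? ?; rewrite /da0 scalerDl scalerA.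
pose da1 := GRing.isLinear.Build _ _ _ _ _ da0l.
pose da : {linear R -> (R * R)%type} := HB.pack da0 da1.
have dac : continuous da by exact: scalel_continuous.
have Lip : \forall s \near (0 : R), `|g s - q0| <= (2 * `|a| + 1) * `|s|.
  have e0 : 0 < (2 * k)^-1 by rewrite invr_gt0 mulr_gt0.
  near=> s; have : `|g s - q0 - s *: a| <= k * (2 * k)^-1 * `|s| + k * (2 * k)^-1 * `|g s - q0| by near: s; exact: key.
  have -> : k * (2 * k)^-1 = 2^-1 by field; rewrite gt_eqF.
  have : `|g s - q0| <= `|g s - q0 - s *: a| + `|s *: a|.
    by rewrite -[X in `|X| <= _](subrK (s *: a)); exact: ler_normD.
  by rewrite normrZ; lra.
have [dg dgE] : differentiable g 0 /\ 'd g 0 = da :> (R -> R * R).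
  apply: approx_differentiable => // e e0.
  (* K bounds 1 + |g s - q0| / |s|, by Lip *)
  pose K := 2 * `|a| + 2.
  have K0 : 0 < K by rewrite /K ltr_wpDl// mulr_ge0.
  have e1 : 0 < e / (k * K) by rewrite divr_gt0 ?mulr_gt0.
  near=> s; rewrite g0 subr0.
  have : `|g s - q0 - s *: a| <= k * (e / (k * K)) * `|s| + k * (e / (k * K)) * `|g s - q0| by near: s; exact: key.
  move=> /le_trans; apply.
  have -> : k * (e / (k * K)) = e / K by field; rewrite !gt_eqF.
  rewrite -mulrDr mulrAC ler_pdivrMr// -mulrA ler_pM2l//.
  have : `|g s - q0| <= (2 * `|a| + 1) * `|s| by near: s.
  by rewrite /K; lra.
have dg1 : 'd g 0 1 = a by rewrite dgE; exact: scale1r.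
have Dg : 'D_1 g 0 = a by rewrite deriveE.
exists g; split => //.
have Xgc : \forall s \near (0 : R), X (g s) = c s by apply: filterS gU => s [].
have : 'D_1 (X \o g) 0 = 'D_1 c 0 by apply: near_eq_derive.
have dXg : differentiable X (g 0) by rewrite g0.
rewrite deriveE; last exact: differentiable_comp.
by rewrite diff_comp//= dg1 g0 diff2E// -Dg.
Unshelve. all: by end_near. Qed.
End Charts.

Section Gradients.
Context (R : realType).
Implicit Types (M : set (R * R * R)) (U : set (R * R)) (X Y : R * R -> R * R * R).
Implicit Types (phi psi : R * R * R -> R).

(** The derivative of a function along a curve is computed in any chart through the lift of the
curve. *)
Lemma chart_curve_derive M U X q0 (c : R -> R * R * R) phi : local_param M U X -> U q0 ->
  c 0 = X q0 -> (\forall s \near (0 : R), M (c s)) -> differentiable c 0 ->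
  differentiable (phi \o X) q0 ->
  let a := tcoord X q0 ('D_1 c 0) in
  [/\ tangent X q0 a = 'D_1 c 0, differentiable (phi \o c) 0 &
      'D_1 (phi \o c) 0 = a.1 * du (phi \o X) q0 + a.2 * dv (phi \o X) q0].
Proof.
move=> lp Uq0 c0 Mc dc dphi a.
have [g [g0 gU dg Dg tg]] := chart_lift lp Uq0 c0 Mc dc.
have E : \forall s \near (0 : R), (phi \o X \o g) s = (phi \o c) s.
  by apply: filterS gU => s [_ /= ->].
have dphig : differentiable (phi \o X) (g 0) by rewrite g0.
have d1 : differentiable (phi \o X \o g) 0 by exact: differentiable_comp.
split; first by rewrite /a -Dg.
  exact: near_eq_differentiable E d1.
have dg1 : 'd g 0 1 = a by rewrite -deriveE// Dg.
by rewrite -(near_eq_derive _ E) deriveE// diff_comp//= dg1 g0 diff2E.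
Qed.

(** The scalar product of the two gradients in the coordinates of [X]. *)
Definition gdot X q phi psi : R :=
  (metG X q * (du (phi \o X) q * du (psi \o X) q)
   - metF X q * (du (phi \o X) q * dv (psi \o X) q + dv (phi \o X) q * du (psi \o X) q)
   + metE X q * (dv (phi \o X) q * dv (psi \o X) q)) / metdet X q.

Lemma gdot_sym X q phi psi : gdot X q phi psi = gdot X q psi phi.
Proof. by rewrite /gdot; congr (_ / _); ring. Qed.

(** The image of a coordinate line of one chart lifts to the other one. The coordinate vectors of the
first chart are thus combinations of those of the second, and derivatives of functions transform with
the same coefficients. *)
Lemma gdot_chart M U V X Y q q' phi psi :
  local_param M U X -> local_param M V Y -> U q -> V q' -> X q = Y q' ->
  smooth_on M phi -> smooth_on M psi -> gdot X q phi psi = gdot Y q' phi psi.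
Proof.
move=> lX lY Uq Vq' XY sphi spsi.
have dX : differentiable X q by case: lX => _ sX _ _ _; exact: smooth_in_differentiable Uq.
have D0 : metdet X q != 0 by case: lX => _ _ n0 _ _; rewrite gt_eqF// metdet_gt0// n0.
have D1 : metdet Y q' != 0 by case: lY => _ _ n0 _ _; rewrite gt_eqF// metdet_gt0// n0.
(* a coordinate direction of X in the coordinates of Y *)
have step (h : R * R) : exists a : R * R, 'D_h X q = tangent Y q' a /\
    forall f, smooth_on M f -> 'D_h (f \o X) q = a.1 * du (f \o Y) q' + a.2 * dv (f \o Y) q'.
  pose l (s : R) : R * R := s *: h + q.
  have dl s : differentiable l s.
    by apply: differentiableD; [exact: differentiableZl|exact: differentiable_cst].
  have l0 : l 0 = q by rewrite /l scale0r add0r.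
  have Dl (W : normedModType R) (F : R * R -> W) : 'D_1 (F \o l) 0 = 'D_h F q.
    have E : (fun k : R => k^-1 *: (((F \o l) \o shift 0) (k *: 1) - (F \o l) 0))
        = (fun k : R => k^-1 *: ((F \o shift q) (k *: h) - F q)).
      by apply/funext => k /=; rewrite l0 /l addr0 [_%:A]mulr1.
    by rewrite /derive E.
  have dXl : differentiable (X \o l) 0 by apply: differentiable_comp => //; rewrite l0.
  have Mc : \forall s \near (0 : R), M ((X \o l) s).
    have nU : \forall s \near (0 : R), U (l s).
      case: lX => oU _ _ _ _.
      apply: (differentiable_continuous (dl 0)); rewrite l0.
      exact: open_nbhs_nbhs.
    apply: filterS nU => s Us; case: lX => oU _ _ _ /(_ U oU (fun x => id)) [W _ E].
    by have : (M `&` W) (X (l s)); [rewrite -E; exists (l s)|case].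
  have c0 : (X \o l) 0 = Y q' by rewrite /= l0.
  exists (tcoord Y q' ('D_h X q)); rewrite -(Dl _ X); split=> [|f sf].
    by have [-> _ _] := chart_curve_derive lY Vq' c0 Mc dXl
       (smooth_in_differentiable (sphi _ _ lY) Vq').
  rewrite -Dl.
  by have [_ _ <-] := chart_curve_derive lY Vq' c0 Mc dXl
       (smooth_in_differentiable (sf _ _ lY) Vq').
have [[a1 a2] [Xu fu]] := step (1, 0); have [[b1 b2] [Xv fv]] := step (0, 1).
rewrite /gdot; move: D0 D1; rewrite /metdet /metE /metF /metG.
have -> : du X q = tangent Y q' (a1, a2) by [].
have -> : dv X q = tangent Y q' (b1, b2) by [].
have -> : du (phi \o X) q = a1 * du (phi \o Y) q' + a2 * dv (phi \o Y) q' by exact: fu.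
have -> : du (psi \o X) q = a1 * du (psi \o Y) q' + a2 * dv (psi \o Y) q' by exact: fu.
have -> : dv (phi \o X) q = b1 * du (phi \o Y) q' + b2 * dv (phi \o Y) q' by exact: fv.
have -> : dv (psi \o X) q = b1 * du (psi \o Y) q' + b2 * dv (psi \o Y) q' by exact: fv.
move: (du (phi \o Y) q') (dv (phi \o Y) q') (du (psi \o Y) q') (dv (psi \o Y) q') => p1 p2 r1 r2.
rewrite /tangent /=; move: (du Y q') (dv Y q') => u v.
rewrite !(dotDl, dotZl, dotDr, dotZr) (dotC v u).
move: (dot u u) (dot u v) (dot v v) => e f g D0 D1.
by field; rewrite D1.
Qed.

Lemma gdot_ge0 X q phi : chart_normal X q != 0 -> 0 <= gdot X q phi phi.
Proof.
move=> /metdet_gt0 D0; rewrite /gdot; apply: divr_ge0; last exact: ltW.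
move: D0; rewrite /metdet.
have E0 : 0 <= metE X q by exact: dot_ge0.
move: (metE X q) (metF X q) (metG X q) E0 => e f g e0 D0.
have {}e0 : 0 < e.
  rewrite lt0r e0 andbT; apply/eqP => e1; move: D0; rewrite e1 mul0r sub0r oppr_gt0.
  by rewrite ltNge sqr_ge0.
move: (du _ _) (dv _ _) => p r.
rewrite -(pmulr_rge0 _ e0).
have -> : e * (g * (p * p) - f * (p * r + r * p) + e * (r * r)) =
   (e * g - f ^+ 2) * p ^+ 2 + (e * r - f * p) ^+ 2 by ring.
by rewrite addr_ge0 ?sqr_ge0// mulr_ge0 ?sqr_ge0// ltW.
Qed.

Lemma gdot_CS X q phi (a : R * R) : chart_normal X q != 0 ->
  (a.1 * du (phi \o X) q + a.2 * dv (phi \o X) q) ^+ 2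
  <= dot (tangent X q a) (tangent X q a) * gdot X q phi phi.
Proof.
move=> /metdet_gt0 D0; rewrite /gdot mulrA ler_pdivlMr//.
move: D0; rewrite /metdet /metE /metF /metG /tangent => _.
move: (du X q) (dv X q) (du _ _) (dv _ _) => u v p r.
rewrite !(dotDl, dotZl, dotDr, dotZr) (dotC v u).
move: (dot u u) (dot u v) (dot v v) => e f g; rewrite -subr_ge0.
set rhs := (X in 0 <= X).
have -> : rhs = ((e * a.1 + f * a.2) * r - (f * a.1 + g * a.2) * p) ^+ 2.
  by rewrite /rhs; ring.
exact: sqr_ge0.
Qed.

End Gradients.

Section Rotations.
Context (R : realType).
Implicit Types (M : set (R * R * R)) (U : set (R * R)) (X : R * R -> R * R * R).
Implicit Types (p q : R * R * R).

Lemma rot0 p : rot 0 p = p.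
Proof. by case: p => [[x y] z]; rewrite /rot /= cos0 sin0 !mul1r !mul0r subr0 add0r. Qed.

Lemma rotD s t p : rot (s + t) p = rot s (rot t p).
Proof.
by rewrite /rot /= cosD sinD; congr (_, _, _); ring.
Qed.

Lemma rotK t : cancel (@rot R t) (rot (- t)).
Proof. by move=> p; rewrite -rotD addNr rot0. Qed.

Lemma rotNK t : cancel (@rot R (- t)) (rot t).
Proof. by move=> p; rewrite -rotD addrN rot0. Qed.

Lemma rot_linear t : linear (@rot R t).
Proof.
move=> k [[x y] z] [[x' y'] z']; rewrite /rot /=.
transitivity (k * (cos t * x - sin t * y) + (cos t * x' - sin t * y'),
  k * (sin t * x + cos t * y) + (sin t * x' + cos t * y'), k * z + z') => //.
by rewrite /GRing.scale /=; congr (_, _, _); ring.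
Qed.
HB.instance Definition _ t := GRing.isLinear.Build R (R * R * R)%type (R * R * R)%type _
  (@rot R t) (rot_linear t).

Lemma rot_continuous t : continuous (@rot R t).
Proof.
have cx k : continuous (fun p : R * R * R => k * px p).
  by move=> p; apply: cvgM (@cvg_cst _ _ _ _ _) (@px_continuous _ p).
have cy k : continuous (fun p : R * R * R => k * py p).
  by move=> p; apply: cvgM (@cvg_cst _ _ _ _ _) (@py_continuous _ p).
have c1 : continuous (fun p : R * R * R => cos t * px p - sin t * py p).
  by move=> p; exact: cvgB (cx _ p) (cy _ p).
have c2 : continuous (fun p : R * R * R => sin t * px p + cos t * py p).
  by move=> p; exact: cvgD (cx _ p) (cy _ p).
move=> p; exact: (cvg_pair (cvg_pair (c1 p) (c2 p)) (@pz_continuous _ p)).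
Qed.

Lemma dot_rot t p q : dot (rot t p) (rot t q) = dot p q.
Proof.
rewrite /dot /rot /=.
transitivity ((cos t ^+ 2 + sin t ^+ 2) * (p.1.1 * q.1.1 + p.1.2 * q.1.2) + p.2 * q.2); first by ring.
by rewrite cos2Dsin2 mul1r.
Qed.

Lemma cross_rot t p q : cross (rot t p) (rot t q) = rot t (cross p q).
Proof.
rewrite /cross /rot /=; congr (_, _, _); try ring.
transitivity ((cos t ^+ 2 + sin t ^+ 2) * (p.1.1 * q.1.2 - p.1.2 * q.1.1)); first by ring.
by rewrite cos2Dsin2 mul1r.
Qed.

Lemma rot_differentiable p : differentiable (fun t => rot t p) 0 /\
  'D_1 (fun t => rot t p) 0 = X3_vec p.
Proof.
pose v1 : R * R * R := (p.1.1, p.1.2, 0); pose v2 := X3_vec p.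
pose v3 : R * R * R := (0, 0, p.2).
have E : (fun t => rot t p) = (fun t => cos t *: v1 + sin t *: v2 + v3).
  apply/funext => t; rewrite /rot /v1 /v2 /v3 /X3_vec.
  transitivity (cos t * p.1.1 + sin t * - p.1.2 + 0, cos t * p.1.2 + sin t * p.1.1 + 0,
    cos t * 0 + sin t * 0 + p.2) => //.
  by congr (_, _, _); ring.
have dc : differentiable (@cos R) 0 by exact/derivable1_diffP.
have ds : differentiable (@sin R) 0 by exact/derivable1_diffP.
have d1 : differentiable (fun t : R => cos t *: v1) 0 by exact: differentiableZl.
have d2 : differentiable (fun t : R => sin t *: v2) 0 by exact: differentiableZl.
have {}E : (fun t => rot t p) = (fun t => cos t *: v1) + (fun t => sin t *: v2) + cst v3 by rewrite E.
have d3 : differentiable (cst v3 : R -> R * R * R) 0 by exact: differentiable_cst.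
have d12 : differentiable ((fun t => cos t *: v1) + (fun t => sin t *: v2)) 0 by exact: differentiableD.
rewrite E; split; first exact: differentiableD.
rewrite deriveE; last exact: differentiableD.
have e1 : 'd (fun t => cos t *: v1) 0 1 = 0.
  by rewrite (diffZl v1 dc) -(deriveE _ dc) derive_val sin0 oppr0 scale0r.
have e2 : 'd (fun t => sin t *: v2) 0 1 = v2.
  by rewrite (diffZl v2 ds) -(deriveE _ ds) derive_val cos0 scale1r.
have e3 : 'd (cst v3 : R -> R * R * R) 0 1 = 0 by rewrite diff_cst.
have H1 := congr1 (fun F : R -> R * R * R => F 1) (diffD d12 d3).
have H2 := congr1 (fun F : R -> R * R * R => F 1) (diffD d1 d2).
have E12 := etrans H2 (congr2 +%R e1 e2).
by rewrite (etrans H1 (congr2 +%R E12 e3)) add0r addr0.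
Qed.

Lemma local_param_rot M U X t : rotation_symmetric M -> local_param M U X ->
  local_param M U (rot t \o X).
Proof.
move=> Mrot [oU sX n0 inj homeo].
have duE (q v : R * R) : U q -> 'D_v (rot t \o X) q = rot t ('D_v X q).
  move=> Uq; have dX := smooth_in_differentiable sX Uq.
  exact: (derive_lin v (@rot_continuous t) dX).2.
split.
- exact: oU.
- by apply: (smooth_in_lin oU _ sX); exact: rot_continuous.
- move=> q Uq; rewrite /chart_normal /du /dv !duE// cross_rot.
  apply: contra_neq (n0 q Uq) => H.
  by rewrite -[LHS](rotK t) /chart_normal H linear0.
- by move=> q q' Uq Uq' /= /(can_inj (rotK t)); exact: inj.
- move=> U' oU' sU'; have [V oV E] := homeo U' oU' sU'.
  exists (rot (- t) @^-1` V).
    by apply: open_comp => // x _; exact: rot_continuous.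
  rewrite eqEsubset; split=> p.
    case=> q U'q <-; have : (M `&` V) (X q) by rewrite -E; exists q.
    by case=> MX VX; split; [exact: Mrot|rewrite /= rotK].
  case=> Mp Vp; have : (M `&` V) (rot (- t) p) by split; [exact: Mrot|].
  by rewrite -E => -[q U'q Xq]; exists q => //=; rewrite Xq rotNK.
Qed.

Lemma D_rot_chart M U X t (q v : R * R) : local_param M U X -> U q ->
  'D_v (rot t \o X) q = rot t ('D_v X q).
Proof.
move=> [_ sX _ _ _] Uq; have dX := smooth_in_differentiable sX Uq.
exact: (derive_lin v (@rot_continuous t) dX).2.
Qed.

Lemma smooth_on_rot M (u : R * R * R -> R) t : rotation_symmetric M -> smooth_on M u ->
  smooth_on M (u \o rot t).
Proof. by move=> Mrot su U X lX; exact: su (local_param_rot t Mrot lX). Qed.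

Lemma chart_laplacian_eq X Y (u v : R * R * R -> R) (q : R * R) :
  (\forall q' \near q, [/\ metE X q' = metE Y q', metF X q' = metF Y q' & metG X q' = metG Y q']) ->
  u \o X = v \o Y -> chart_laplacian X u q = chart_laplacian Y v q.
Proof.
move=> nE uv; rewrite /chart_laplacian uv; move: (v \o Y) => {u v uv} w.
have D : \forall q' \near q, metdet X q' = metdet Y q'.
  by apply: filterS nE => q' [e f g]; rewrite /metdet e f g.
(* the two components of the gradient field, for either chart *)
pose P Z (q' : R * R) : R := (metG Z q' * du w q' - metF Z q' * dv w q') / Num.sqrt (metdet Z q').
pose Q Z (q' : R * R) : R := (metE Z q' * dv w q' - metF Z q' * du w q') / Num.sqrt (metdet Z q').
have EP : \forall q' \near q, P X q' = P Y q'.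
  by apply: filterS2 nE D => q' [e f g] d; rewrite /P d f g.
have EQ : \forall q' \near q, Q X q' = Q Y q'.
  by apply: filterS2 nE D => q' [e f g] d; rewrite /Q d e f.
have E1 : 'D_((1, 0) : R * R) (P X) q = 'D_((1, 0) : R * R) (P Y) q := near_eq_derive _ EP.
have E2 : 'D_((0, 1) : R * R) (Q X) q = 'D_((0, 1) : R * R) (Q Y) q := near_eq_derive _ EQ.
have F (m m' x x' y y' : R) : m = m' -> x = x' -> y = y' ->
  (Num.sqrt m)^-1 * (x + y) = (Num.sqrt m')^-1 * (x' + y') by move=> -> -> ->.
exact: (F _ _ _ _ _ _ (nbhs_singleton D) E1 E2).
Qed.

(** A rotated chart is a chart with the same metric coefficients. *)
Lemma is_laplacian_rot M (u h : R * R * R -> R) t : rotation_symmetric M -> is_laplacian M u h ->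
  is_laplacian M (u \o rot t) (h \o rot t).
Proof.
move=> Mrot lap U X lX q Uq; have oU : open U by case: lX.
rewrite -[LHS]/(h ((rot t \o X) q)) (lap _ _ (local_param_rot t Mrot lX) q Uq).
have nU : \forall q' \near q, U q' by exact: open_nbhs_nbhs.
apply: chart_laplacian_eq; last by [].
apply: filterS nU => q' Uq'; rewrite /metE /metF /metG.
have -> : du (rot t \o X) q' = rot t (du X q') by exact: D_rot_chart lX Uq'.
have -> : dv (rot t \o X) q' = rot t (dv X q') by exact: D_rot_chart lX Uq'.
by split; exact: dot_rot.
Qed.

(** The orbits of the rotations are curves on the surface with tangent vector [X3_vec]. *)
Lemma X3_chart M U X (q : R * R) (phi : R * R * R -> R) : rotation_symmetric M ->
  local_param M U X -> U q -> smooth_on M phi ->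
  let a := tcoord X q (X3_vec (X q)) in
  [/\ tangent X q a = X3_vec (X q),
      X3 phi (X q) = a.1 * du (phi \o X) q + a.2 * dv (phi \o X) q,
      is_derive (0 : R) (1 : R) (fun t => phi (rot t (X q)) : R) (X3 phi (X q)) &
      (X3 phi (X q)) ^+ 2 <= dot (X3_vec (X q)) (X3_vec (X q)) * gdot X q phi phi].
Proof.
move=> Mrot lX Uq sphi a; have [dr Dr] := rot_differentiable (X q).
have MX : M (X q).
  case: (lX) => oU _ _ _ /(_ U oU (fun x => id)) [W _ E].
  by have : (M `&` W) (X q); [rewrite -E; exists q|case].
have dphi := smooth_in_differentiable (sphi _ _ lX) Uq.
have Mc : \forall s \near (0 : R), M (rot s (X q)) by near=> s; exact: Mrot.
have := @chart_curve_derive _ M U X q (fun t => rot t (X q)) phi lX Uq (rot0 _) Mc dr dphi.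
rewrite Dr -/a => -[ta dphir Dphi].
have E : X3 phi (X q) = a.1 * du (phi \o X) q + a.2 * dv (phi \o X) q.
  by rewrite /X3 derive1E.
split=> //.
- by rewrite E -Dphi; apply: DeriveDef => //; exact/derivable1_diffP.
- rewrite E -ta; apply: gdot_CS; by case: lX => _ _ n0 _ _; exact: n0.
Unshelve. all: by end_near. Qed.

End Rotations.

(** * Measurability and integration on the surface *)

Section Borel.
Context (R : realType).

(** A countable base made of members of [m]. It shows that the product sigma-algebras contain the open
sets of the product topologies. *)
Definition has_basis_in (T : topologicalType) (m : set (set T)) :=
  exists B : nat -> set T, (forall n, m (B n)) /\
    forall x N, nbhs x N -> exists n, B n x /\ B n `<=` N.

Lemma has_basis_in_R : has_basis_in (@measurable _ R).
Proof.
pose B n : set R := if @unpickle (rat * rat)%type n is Some (a, b)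
  then `]ratr a, ratr b[%classic else set0.
exists B; split=> [n|x N [e /= e0 eN]].
  by rewrite /B; case: unpickle => [[a b]|] //; exact: measurable_itv.
have /rat_in_itvoo[a] : x - e < x by rewrite gtrBl.
rewrite in_itv/= => /andP[ea ax].
have /rat_in_itvoo[b] : x < x + e by rewrite ltrDl.
rewrite in_itv/= => /andP[xb be].
exists (pickle (a, b)); rewrite /B pickleK; split=> [|y] /=; rewrite in_itv/=.
  by rewrite ax xb.
by move=> /andP[ay yb]; apply: eN; rewrite /ball_ /= ltr_distlC; apply/andP; split; lra.
Qed.

Lemma has_basis_in_prod (T1 T2 : topologicalType) (m1 : set (set T1)) (m2 : set (set T2))
  (m : set (set (T1 * T2))) : (forall A B, m1 A -> m2 B -> m (A `*` B)) -> m set0 ->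
  has_basis_in m1 -> has_basis_in m2 -> has_basis_in m.
Proof.
move=> mX m0 [B1 [mB1 b1]] [B2 [mB2 b2]].
pose B n : set (T1 * T2) := if @unpickle (nat * nat)%type n is Some (a, b)
  then B1 a `*` B2 b else set0.
exists B; split=> [n|[x y] N [[N1 N2] /= [n1 n2] sN]].
  by rewrite /B; case: unpickle => [[a b]|] //; exact: mX.
have [a [ax sa]] := b1 _ _ n1; have [b [bx sb]] := b2 _ _ n2.
exists (pickle (a, b)); rewrite /B pickleK; split=> // -[u v] [/= /sa ? /sb ?].
exact: sN.
Qed.

Lemma basis_open (T : topologicalType) (m : set (set T)) (A : set T) : has_basis_in m -> m set0 ->
  (forall F : nat -> set T, (forall n, m (F n)) -> m (\bigcup_n F n)) -> open A -> m A.
Proof.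
move=> [B [mB b]] m0 mU oA.
have -> : A = \bigcup_n (if `[< B n `<=` A >] then B n else set0).
  rewrite eqEsubset; split=> [x Ax|x [n _]].
    have [n [Bx sB]] := b x A (open_nbhs_nbhs (conj oA Ax)).
    by exists n => //; case: asboolP.
  by case: asboolP => // sB /sB.
by apply: mU => n; case: asboolP.
Qed.

Lemma open_measurable2 (A : set (R * R)) : open A -> measurable A.
Proof.
apply: (@basis_open (R * R)%type (@measurable _ (R * R)%type)) => //; last by move=> F mF; exact: bigcupT_measurable.
apply: (has_basis_in_prod _ _ has_basis_in_R has_basis_in_R) => // ? ? ? ?.
exact: measurableX.
Qed.

Lemma open_measurable3 (A : set (R * R * R)) : open A -> measurable A.
Proof.
apply: (@basis_open (R * R * R)%type (@measurable _ (R * R * R)%type)) => //; last by move=> F mF; exact: bigcupT_measurable.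
apply: (@has_basis_in_prod (R * R)%type R measurable measurable _ _ _ _ has_basis_in_R) => //.
  by move=> ? ? ? ?; exact: measurableX.
apply: (has_basis_in_prod _ _ has_basis_in_R has_basis_in_R) => // ? ? ? ?.
exact: measurableX.
Qed.

Lemma closed_measurable3 (A : set (R * R * R)) : closed A -> measurable A.
Proof. by move=> cA; rewrite -[A]setCK; apply: measurableC; apply: open_measurable3; exact: closed_openC. Qed.

Lemma compact_measurable3 (A : set (R * R * R)) : compact A -> measurable A.
Proof. by move/compact_closed => /(_ (@norm_hausdorff _ _)); exact: closed_measurable3. Qed.

Lemma within_continuous_measurable2 (D : set (R * R)) (f : R * R -> R) : measurable D ->
  {within D, continuous f} -> measurable_fun D f.
Proof.
move=> mD /continuousP cf; apply: (measurability _ (RGenOpens.measurableE R)).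
move=> _ [_ [a [b ->] <-]].
have oab : open `]a, b[%classic by exact: interval_open.
have /open_subspaceP[V oV E] := cf _ oab.
by rewrite setIC -E; apply: measurableI => //; exact: open_measurable2.
Qed.

Lemma within_continuous_measurable3 (D : set (R * R * R)) (f : R * R * R -> R) : measurable D ->
  {within D, continuous f} -> measurable_fun D f.
Proof.
move=> mD /continuousP cf; apply: (measurability _ (RGenOpens.measurableE R)).
move=> _ [_ [a [b ->] <-]].
have oab : open `]a, b[%classic by exact: interval_open.
have /open_subspaceP[V oV E] := cf _ oab.
by rewrite setIC -E; apply: measurableI => //; exact: open_measurable3.
Qed.

(** A chart is only continuous on its domain, while images of measures are taken under functions
measurable on the whole plane. *)
Lemma measurable_extension (D : set (R * R)) (f : R * R -> R * R * R) : open D ->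
  (forall q, D q -> {for q, continuous f}) ->
  exists2 g : R * R -> R * R * R, measurable_fun setT g & forall q, D q -> g q = f q.
Proof.
move=> oD cf; have mD := open_measurable2 oD.
have cfD h : continuous h -> measurable_fun setT ((h \o f : R * R -> R) \_ D).
  move=> ch; apply/(measurable_restrictT _ mD).
  apply: within_continuous_measurable2 => //.
  by rewrite continuous_open_subspace// => q /set_mem Dq; apply: continuous_comp; [exact: cf|exact: ch].
have mx := cfD _ (@px_continuous R); have my := cfD _ (@py_continuous R).
have mz := cfD _ (@pz_continuous R).
exists (fun q => (((@px R \o f) \_ D) q, ((@py R \o f) \_ D) q, ((@pz R \o f) \_ D) q)).
  exact: (measurable_fun_pair (measurable_fun_pair mx my) mz).
by move=> q Dq; rewrite !patchE mem_set//= /px /py /pz; case: (f q) => [[]].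
Qed.

End Borel.

Section ChartTopology.
Context (R : realType).
Implicit Types (M : set (R * R * R)) (U : set (R * R)) (X : R * R -> R * R * R).

Lemma chart_sub M U X q : local_param M U X -> U q -> M (X q).
Proof.
move=> [oU _ _ _ /(_ U oU (fun x => id)) [W _ E]] Uq.
by have : (M `&` W) (X q); [rewrite -E; exists q|case].
Qed.

Lemma chart_open M U X : local_param M U X -> exists2 V, open V & X @` U = M `&` V.
Proof. by move=> [oU _ _ _ /(_ U oU (fun x => id))]. Qed.

(** The last clause of [local_param], applied to small neighbourhoods, is the continuity of the
inverse. *)
Lemma chart_inverse M U X : local_param M U X -> exists g : R * R * R -> R * R,
  (forall q, U q -> g (X q) = q) /\
  forall q, U q -> g @ within M (nbhs (X q)) --> q.
Proof.
move=> [oU sX n0 inj homeo].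
pose g p := xget 0 [set q | U q /\ X q = p].
have gP q : U q -> g (X q) = q.
  move=> Uq; have [Ug Xg] : [set q' | U q' /\ X q' = X q] (g (X q)) by apply: (@xgetI _ _ _ q).
  exact: inj.
exists g; split=> // q Uq N Nq.
have [V oV E] := homeo (N° `&` U) (openI (open_interior N) oU) (@subIsetr _ _ _).
have Vq : V (X q).
  have : (M `&` V) (X q); last by case.
  by rewrite -E; exists q => //; split => //; exact: nbhs_singleton (nbhs_interior Nq).
rewrite /nbhs /= /within /=; have := open_nbhs_nbhs (conj oV Vq).
apply: filterS => p Vp Mp; have : (M `&` V) p by [].
by rewrite -E => -[q' [Nq' Uq'] <-] /=; rewrite gP//; exact: interior_subset.
Qed.

Lemma smooth_on_continuous M (W : normedModType R) (F : R * R * R -> W) :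
  regular_surface M -> smooth_on M F -> {within M, continuous F}.
Proof.
move=> reg sF; apply/subspace_continuousP => p Mp.
have [U [X [lX [q Uq Xq]]]] := reg p Mp.
have [g [gX cg]] := chart_inverse lX; have [V oV E] := chart_open lX.
have cF : {for q, continuous (F \o X)} by exact: smooth_in_continuous (sF _ _ lX) Uq.
have H : (F \o X) \o g @ within M (nbhs p) --> (F \o X) q.
  have cgq := cg q Uq; rewrite Xq in cgq.
  exact: (cvg_comp _ _ cgq cF).
have Vp : V p by have : (M `&` V) p; [rewrite -E; exists q|case].
have HE : {near within M (nbhs p), ((F \o X) \o g) =1 F}.
  rewrite /prop_near1 /nbhs /= /within /=; have := open_nbhs_nbhs (conj oV Vp).
  apply: filterS => y Vy My; have : (M `&` V) y by [].
  by rewrite -E => -[q' Uq' <-]; rewrite /= gX.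
have := cvg_trans (near_eq_cvg HE) H; rewrite /= Xq => H2.
exact: H2.
Qed.

Lemma smooth_on_measurable M (u : R * R * R -> R) :
  regular_surface M -> compact M -> smooth_on M u -> measurable_fun M u.
Proof.
move=> reg cM su; apply: within_continuous_measurable3; first exact: compact_measurable3.
exact: smooth_on_continuous.
Qed.

Lemma smooth_on_bounded M (u : R * R * R -> R) :
  regular_surface M -> compact M -> smooth_on M u -> exists C, forall p, M p -> `|u p| <= C.
Proof.
move=> reg cM su.
have /compact_bounded[C [_ HC]] := continuous_compact (smooth_on_continuous reg su) cM.
exists (C + 1) => p Mp; apply: (HC (C + 1)); first by rewrite ltrDl.
by exists p.
Qed.

End ChartTopology.

Section WeightedImage.
Local Open Scope ereal_scope.
Context d1 d2 (S : measurableType d1) (T : measurableType d2) (R : realType).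
Variables (mu : {measure set S -> \bar R}) (nu : {measure set T -> \bar R}).
Variables (phi : S -> T) (N : S -> R) (E : set S) (A : set T).
Hypotheses (mphi : measurable_fun setT phi) (mN : measurable_fun setT N).
Hypotheses (N0 : forall x, (0 <= N x)%R) (mE : measurable E) (mA : measurable A).
Hypothesis nuE : forall B, measurable B -> B `<=` A ->
  nu B = \int[mu]_(x in E `&` phi @^-1` B) (N x)%:E.

Import HBNNSimple.

(** In a chart the area is the image of a weighted plane measure. The passage from sets to nonnegative
functions goes through increasing sequences of simple functions. *)
Lemma ge0_integral_weighted_image (f : T -> \bar R) :
  measurable_fun A f -> (forall y, A y -> 0 <= f y) ->
  \int[nu]_(y in A) f y = \int[mu]_(x in E `&` phi @^-1` A) (f (phi x) * (N x)%:E).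
Proof.
move=> mf f0; set D := E `&` _.
have mpre B : measurable B -> measurable (phi @^-1` B).
  by move=> mB; rewrite -(setTI (_ @^-1` _)); exact: mphi.
have mD : measurable D by apply: measurableI => //; exact: mpre.
pose f_ := nnsfun_approx mA mf.
have mfphi n : measurable_fun D (fun x => (f_ n (phi x))%:E * (N x)%:E).
  apply: emeasurable_funM.
    apply/measurable_EFinP; apply: measurable_funTS.
    by apply: measurableT_comp => //; exact: measurable_funP.
  by apply/measurable_EFinP; exact: measurable_funTS.
transitivity (limn (fun n => \int[nu]_(x in A) (f_ n x)%:E)).
  rewrite -monotone_convergence//.
  - apply: eq_integral => y /[!inE] yD; apply/esym/cvg_lim => //.
    by apply: cvg_nnsfun_approx.
  - by move=> n; apply/measurable_EFinP/measurable_funTS.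
  - by move=> n y _; rewrite lee_fin.
  - by move=> y _ m n mn; rewrite lee_fin; exact/lefP/nd_nnsfun_approx.
rewrite [X in limn X](_ : _ =
    (fun n => \int[mu]_(x in D) ((f_ n (phi x))%:E * (N x)%:E))).
  rewrite -monotone_convergence//; last 2 first.
    - by move=> n x _ /=; rewrite mule_ge0// lee_fin.
    - by move=> x _ m n mn; rewrite lee_wpmul2r ?lee_fin//; exact/lefP/nd_nnsfun_approx.
  apply: eq_integral => x /[!inE] -[Ex Ax] /=; apply/cvg_lim => //.
  apply: cvgeZr => //.
  exact: (cvg_nnsfun_approx _ _ f0 Ax).
apply/funext => n.
have H (k : R) : (0 <= k)%R \/ f_ n @^-1` [set k] = set0.
  have [k0|k0] := leP 0%R k; [by left|right].
  by rewrite preimage_nnfun0.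
transitivity (\sum_(k \in range (f_ n)) (k%:E * nu (f_ n @^-1` [set k] `&` A))).
  under eq_integral do rewrite fimfunE -fsumEFin//.
  rewrite ge0_integral_fsum//; last 2 first.
  - by move=> y; exact/measurable_EFinP/measurable_funM.
  - by move=> y x _; rewrite nnfun_muleindic_ge0.
  by apply: eq_fsbigr => r _; rewrite integralZl_indic_nnsfun// integral_indic.
transitivity (\sum_(k \in range (f_ n)) \int[mu]_(x in D)
     (k%:E * ((\1_(f_ n @^-1` [set k]) (phi x))%:E * (N x)%:E))).
  apply: eq_fsbigr => k _.
  have mB : measurable (f_ n @^-1` [set k]) by [].
  have mI : measurable_fun D (fun x => (\1_(f_ n @^-1` [set k]) (phi x))%:E * (N x)%:E).
    apply: emeasurable_funM; apply/measurable_EFinP; apply: measurable_funTS => //.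
    apply: measurableT_comp => //.
  have [k0|->] := H k; last first.
    by rewrite set0I measure0 mule0 integral0_eq// => x _; rewrite indic0 mul0e mule0.
  rewrite ge0_integralZl//; last by move=> x _; rewrite mule_ge0// lee_fin.
  congr (_ * _); rewrite nuE//; last exact: measurableI.
  have -> : E `&` phi @^-1` (f_ n @^-1` [set k] `&` A) = D `&` phi @^-1` (f_ n @^-1` [set k]).
    by rewrite preimage_setI (setIC (phi @^-1` _)) setIA.
  rewrite integral_mkcondr; apply: eq_integral => x _; rewrite patchE indicE.
  have [xB|xB] := boolP (x \in phi @^-1` (f_ n @^-1` [set k])).
    by rewrite (_ : (phi x \in _) = true) ?mul1e//; apply/mem_set; exact: (set_mem xB).
  rewrite (_ : (phi x \in _) = false) ?mul0e//; apply/negbTE; apply: contra xB => xB.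
  by apply/mem_set; exact: (set_mem xB).
rewrite -ge0_integral_fsum//.
- apply: eq_integral => x _; rewrite [in RHS]fimfunE -fsumEFin// ge0_mule_fsuml.
    by apply: eq_fsbigr => k _; rewrite muleA -EFinM.
  by move=> k; exact: nnfun_muleindic_ge0.
- move=> k; apply: emeasurable_funM => //; apply: emeasurable_funM; apply/measurable_EFinP.
    by apply: measurable_funTS; apply: measurableT_comp.
  exact: measurable_funTS.
- move=> k x _; rewrite muleA; apply: mule_ge0; last by rewrite lee_fin.
  exact: nnfun_muleindic_ge0.
Qed.
End WeightedImage.

Section PlaneIntegrals.
Context (R : realType).
Local Notation mu := (@lebesgue_measure R).
Local Notation lam := (@lebesgue_measure R \x @lebesgue_measure R)%E.

Definition square (K : R) : set (R * R) := `[- K, K]%classic `*` `[- K, K]%classic.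

Lemma squareP K q : square K q <-> `|q| <= K.
Proof.
rewrite prod_normE /= ge_max !ler_norml /square /=.
by rewrite !in_itv /=; split=> [[-> ->]//|/andP[]].
Qed.

Lemma measurable_square K : measurable (square K).
Proof. by apply: measurableX; exact: measurable_itv. Qed.

Lemma square_fin K : (lam (square K) < +oo)%E.
Proof.
rewrite /square product_measure1E//=; try exact: measurable_itv.
rewrite !lebesgue_measure_itv /=; case: ifP => _; last by rewrite mul0e.
by rewrite -EFinB -EFinM ltry.
Qed.

Lemma compact_fin_measure2 (K : set (R * R)) : compact K -> (lam K < +oo)%E.
Proof.
move=> cK; have /compact_bounded[C [_ HC]] := cK.
have mK : measurable K.
  rewrite -[K]setCK; apply: measurableC; apply: open_measurable2; apply: closed_openC.
  by apply: compact_closed => //; exact: norm_hausdorff.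
apply: le_lt_trans (square_fin (C + 1)); apply: le_measure; rewrite ?inE//.
  exact: measurable_square.
by move=> q Kq; apply/squareP; apply: HC Kq; rewrite ltrDl.
Qed.

Lemma integrable_square (g : R * R -> R) K : continuous g ->
  (forall q, K < `|q| -> g q = 0) -> lam.-integrable setT (EFin \o g).
Proof.
move=> cg g0.
have -> : EFin \o g = (EFin \o g) \_ (square K).
  apply/funext => q; rewrite patchE; case: ifPn => // /negP qK /=.
  rewrite g0// ltNge; apply/negP => H; apply: qK; apply/mem_set; exact/squareP.
have H := (@integrable_mkcond _ _ _ lam (square K) (EFin \o g) (measurable_square K)).
apply/H.
have mg : measurable_fun (square K) g.
  by apply: within_continuous_measurable2; [exact: measurable_square|exact: continuous_subspaceT].
apply: measurable_bounded_integrable => //.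
- exact: measurable_square.
- exact: square_fin.
- have cK : compact (square K) by apply: compact_setX; exact: segment_compact.
  have /compact_bounded[C [_ HC]] := continuous_compact (continuous_subspaceT cg) cK.
  by exists C; split; rewrite ?num_real// => x Cx q Kq; apply: HC => //; exists q.
Qed.

Lemma derive_outside (V : normedModType R) (P : V -> R) (K : R) v q :
  (forall q, K <= `|q| -> P q = 0) -> K < `|q| -> 'D_v P q = 0.
Proof.
move=> P0 Kq; have nK : \forall y \near q, K < `|y|.
  exact: (cvgr_gt _ (@norm_continuous _ V q)).
have E : \forall y \near q, 0 = P y by apply: filterS nK => y /ltW /P0 ->.
by rewrite -(near_eq_derive _ E) derive_cst.
Qed.

Lemma integral_derive_slice (h h' : R -> R) (K : R) : 0 < K ->
  (forall x : R, is_derive x (1 : R) h (h' x)) -> continuous h' ->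
  (forall x, K <= `|x| -> h x = 0) -> (\int[mu]_x (h' x)%:E = 0)%E.
Proof.
move=> K0 dh ch' h0.
have ch : continuous h.
  by move=> x; apply/differentiable_continuous/derivable1_diffP; have [] := dh x.
have h'0 x : K < `|x| -> h' x = 0.
  by move=> Kx; have [_ <-] := dh x; exact: derive_outside h0 Kx.
have -> : (fun x => (h' x)%:E) = ((fun x => (h' x)%:E) \_ `[- K, K]%classic : R -> \bar R).
  apply/funext => x; rewrite patchE; case: ifPn => // /negP xK /=.
  rewrite h'0// ltNge; apply/negP => H; apply: xK; apply/mem_set => /=.
  by rewrite in_itv /= -ler_norml.
rewrite -integral_mkcond (@continuous_FTC2 _ h' h)//.
- rewrite !h0 ?normrN; first by rewrite subee.
    by rewrite ger0_norm// ltW.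
  by rewrite ger0_norm// ltW.
- by rewrite gtrN.
- exact: continuous_subspaceT.
- split=> [x _||]; first by have [] := dh x.
    exact: cvg_at_right_filter (ch _).
  exact: cvg_at_left_filter (ch _).
- by move=> x _; rewrite derive1E; have [_ ->] := dh x.
Qed.

Lemma derive_slice1 (P : R * R -> R) x y : differentiable P (x, y) ->
  is_derive (x : R) (1 : R) (fun x => P (x, y) : R) (du P (x, y)).
Proof.
move=> dP; have dPu := @diff_derivable _ _ _ P (x, y) (1, 0) dP.
have E : (fun h : R => h^-1 *: (((fun x => P (x, y)) \o shift x) (h *: 1) - P (x, y)))
    = (fun h : R => h^-1 *: ((P \o shift (x, y)) (h *: (1, 0)) - P (x, y))).
  apply/funext => h /=; congr (_ *: (P _ - _)).
  by rewrite -[RHS]/(h * 1 + x, h * 0 + y) mulr0 add0r.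
by apply: DeriveDef; [rewrite /derivable E|rewrite /derive E].
Qed.

Lemma derive_slice2 (P : R * R -> R) x y : differentiable P (x, y) ->
  is_derive (y : R) (1 : R) (fun y => P (x, y) : R) (dv P (x, y)).
Proof.
move=> dP; have dPu := @diff_derivable _ _ _ P (x, y) (0, 1) dP.
have E : (fun h : R => h^-1 *: (((fun y => P (x, y)) \o shift y) (h *: 1) - P (x, y)))
    = (fun h : R => h^-1 *: ((P \o shift (x, y)) (h *: (0, 1)) - P (x, y))).
  apply/funext => h /=; congr (_ *: (P _ - _)).
  by rewrite -[RHS]/(h * 0 + x, h * 1 + y) mulr0 add0r.
by apply: DeriveDef; [rewrite /derivable E|rewrite /derive E].
Qed.

(** A derivative of a compactly supported function integrates to zero: Fubini's theorem, then the
fundamental theorem of calculus on each line. *)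
Lemma integral_du0 (P : R * R -> R) (K : R) : 0 < K -> (forall q, differentiable P q) ->
  continuous (du P) -> (forall q, K <= `|q| -> P q = 0) ->
  lam.-integrable setT (EFin \o du P) /\ (\int[lam]_q (du P q)%:E = 0)%E.
Proof.
move=> K0 dP cdP P0.
have du0 q : K < `|q| -> du P q = 0 by exact: derive_outside.
have iP := integrable_square cdP du0.
split=> //; rewrite -(integral21_prod_meas1 iP).
apply: integral0_eq => y _; apply: (@integral_derive_slice (fun x => P (x, y)) (fun x => du P (x, y)) K) => //.
- by move=> x; exact: derive_slice1.
- move=> x; apply: (continuous_comp _ (cdP (x, y))).
  exact: (cvg_pair cvg_id (@cvg_cst _ _ _ _ _)).
- move=> x Kx; apply: P0; rewrite prod_normE /=; apply: le_trans Kx _.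
  by rewrite le_max lexx.
Qed.

Lemma integral_dv0 (P : R * R -> R) (K : R) : 0 < K -> (forall q, differentiable P q) ->
  continuous (dv P) -> (forall q, K <= `|q| -> P q = 0) ->
  lam.-integrable setT (EFin \o dv P) /\ (\int[lam]_q (dv P q)%:E = 0)%E.
Proof.
move=> K0 dP cdP P0.
have du0 q : K < `|q| -> dv P q = 0 by exact: derive_outside.
have iP := integrable_square cdP du0.
split=> //; rewrite -(integral12_prod_meas1 iP).
apply: integral0_eq => x _; apply: (@integral_derive_slice (fun y => P (x, y)) (fun y => dv P (x, y)) K) => //.
- by move=> y; exact: derive_slice2.
- move=> y; apply: (continuous_comp _ (cdP (x, y))).
  exact: (cvg_pair (@cvg_cst _ _ _ _ _) cvg_id).
- move=> y Ky; apply: P0; rewrite prod_normE /=; apply: le_trans Ky _.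
  by rewrite le_max lexx orbT.
Qed.

End PlaneIntegrals.

Section AreaMeasure.
Context (R : realType) (M : set (R * R * R)).
Context (sigma : {measure set (R * R * R) -> \bar R}).
Implicit Types (U : set (R * R)) (X : R * R -> R * R * R) (A B : set (R * R * R)).
Local Notation lam := (@lebesgue_measure R \x @lebesgue_measure R)%E.
Local Notation area X q := (enorm (chart_normal X q)).

Hypotheses (reg : regular_surface M) (cM : compact M) (Mrot : rotation_symmetric M).
Hypothesis sarea : is_area_measure M sigma.

Lemma measurable_surface : measurable M.
Proof. exact: compact_measurable3. Qed.
Local Notation mM := measurable_surface.

Lemma measurable_chart_image U X : local_param M U X -> measurable (X @` U).
Proof.
move=> lX; have [V oV ->] := chart_open lX.
by apply: measurableI; [exact: mM|exact: open_measurable3].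
Qed.

Lemma smooth_in_metric M' U X : local_param M' U X ->
  [/\ smooth_in U (metE X), smooth_in U (metF X), smooth_in U (metG X) &
      smooth_in U (metdet X)].
Proof.
move=> [oU sX _ _ _].
have sEFG : [/\ smooth_in U (metE X), smooth_in U (metF X) & smooth_in U (metG X)].
  by split; apply: smooth_in_dot => //; exact: smooth_in_derive sX.
case: sEFG => sE sF sG; split=> //; apply: smooth_inB => //.
  exact: smooth_inM.
exact: smooth_inX.
Qed.

Lemma smooth_in_area M' U X : local_param M' U X -> smooth_in U (fun q => area X q).
Proof.
move=> lX; have [_ _ _ sD] := smooth_in_metric lX; have [oU _ n0 _ _] := lX.
have -> : (fun q => area X q) = (fun q => Num.sqrt (metdet X q)).
  by apply/funext => q; rewrite enorm_normal.
by apply: smooth_in_sqrt => // q Uq; exact: metdet_gt0 (n0 q Uq).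
Qed.

Lemma chart_integral_ge0 U X A (f : R * R * R -> \bar R) : local_param M U X ->
  measurable A -> A `<=` X @` U -> measurable_fun A f -> (forall y, A y -> 0 <= f y)%E ->
  (\int[sigma]_(y in A) f y = \int[lam]_(q in U `&` X @^-1` A) (f (X q) * (area X q)%:E))%E.
Proof.
move=> lX mA AU mf f0; have [oU sX _ _ _] := lX.
have mU := open_measurable2 oU.
have [Xe mXe XeE] := measurable_extension oU (fun q Uq => smooth_in_continuous sX Uq).
pose N : R * R -> R := (fun q => area X q) \_ U.
have mN : measurable_fun setT N.
  apply/(measurable_restrictT _ mU); apply: within_continuous_measurable2 => //.
  rewrite continuous_open_subspace// => q /set_mem Uq.
  exact: smooth_in_continuous (smooth_in_area lX) Uq.
have N0 q : 0 <= N q by rewrite /N patchE; case: ifPn => // _; exact: sqrtr_ge0.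
have preE B : U `&` Xe @^-1` B = U `&` X @^-1` B.
  by apply/seteqP; split=> q [Uq /=]; rewrite XeE.
have NE B : (\int[lam]_(q in U `&` X @^-1` B) (N q)%:E = \int[lam]_(q in U `&` X @^-1` B) (area X q)%:E)%E.
  by apply: eq_integral => q /set_mem [Uq _]; rewrite /N patchE mem_set.
rewrite (@ge0_integral_weighted_image _ _ _ _ _ lam sigma Xe N U A)//.
  by rewrite preE; apply: eq_integral => q /set_mem [Uq _]; rewrite XeE// /N patchE mem_set.
by move=> B mB BA; rewrite preE NE; apply: sarea => //; exact: subset_trans AU.
Qed.

Lemma chart_integral U X A (f : R * R * R -> \bar R) : local_param M U X ->
  measurable A -> A `<=` X @` U -> measurable_fun A f ->
  (\int[sigma]_(y in A) f y = \int[lam]_(q in U `&` X @^-1` A) (f (X q) * (area X q)%:E))%E.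
Proof.
move=> lX mA AU mf; rewrite integralE [RHS]integralE.
have a0 q : 0 <= area X q by exact: sqrtr_ge0.
congr (_ - _)%E.
  rewrite (chart_integral_ge0 lX mA AU)//; last exact: measurable_funepos.
  apply: eq_integral => q _; rewrite [LHS]muleC [RHS]funeposE.
  by rewrite funeposE muleC maxe_pMl ?mul0e// lee_fin.
rewrite (chart_integral_ge0 lX mA AU)//; last exact: measurable_funeneg.
apply: eq_integral => q _; rewrite [LHS]muleC [RHS]funenegE funenegE -mulNe.
by rewrite muleC maxe_pMl ?mul0e// lee_fin.
Qed.

(** The preimage is the image of a compact set under the continuous inverse of the chart. *)
Lemma compact_chart_preimage U X (C : set (R * R * R)) : local_param M U X -> closed C ->
  M `&` C `<=` X @` U -> compact (U `&` X @^-1` C).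
Proof.
move=> lX cC MC; have [g [gX cg]] := chart_inverse lX.
have -> : U `&` X @^-1` C = g @` (M `&` C).
  apply/seteqP; split=> [q [Uq Cq]|_ [p [Mp Cp] <-]].
    by exists (X q); [split=> //; exact: chart_sub lX Uq|exact: gX].
  by have [q Uq Xq] := MC p (conj Mp Cp); rewrite -Xq gX//; split=> //=; rewrite Xq.
apply: continuous_compact; last exact: compact_closedI.
apply/subspace_continuousP => p [Mp Cp]; have [q Uq Xq] := MC p (conj Mp Cp).
have gp : g p = q by rewrite -Xq gX.
have cgq := cg q Uq; rewrite Xq in cgq.
rewrite /from_subspace gp; apply: cvg_trans cgq; apply: cvg_app.
by apply: within_subset => y [].
Qed.

Lemma dist_continuous (p : R * R * R) : continuous (fun y : R * R * R => `|p - y|).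
Proof.
by move=> y; apply: cvg_norm; apply: cvgB; [exact: cvg_cst|exact: cvg_id].
Qed.

(** Closed balls, and not only open ones, are required to lie in charts, in order that their
preimages be compact. *)
Lemma chart_cover : exists (s : seq (R * R * R)) (U : R * R * R -> set (R * R))
  (X : R * R * R -> R * R -> R * R * R) (r : R * R * R -> R),
  (forall p, p \in s -> [/\ local_param M (U p) (X p), 0 < r p &
     M `&` [set y | `|p - y| <= r p] `<=` X p @` U p]) /\
  (forall y, M y -> exists2 p, p \in s & `|p - y| < r p).
Proof.
have H p : exists d : set (R * R) * (R * R -> R * R * R) * R, M p ->
    [/\ local_param M d.1.1 d.1.2, 0 < d.2 & M `&` [set y | `|p - y| <= d.2] `<=` d.1.2 @` d.1.1].
  have [Mp|nMp] := pselect (M p); last by exists (set0, (fun=> 0), 0).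
  have [U [X [lX Xp]]] := reg Mp; have [V oV E] := chart_open lX.
  have Vp : V p by have : (M `&` V) p; [rewrite -E|case].
  have /nbhs_closedballP[e eV] : nbhs p V by exact: open_nbhs_nbhs.
  exists (U, X, e%:num) => _; split=> //= y [My py]; rewrite E; split=> //; apply: eV.
  by rewrite closed_ballE.
have [d dP] := choice H.
pose O p : set (R * R * R) := [set y | `|p - y| < (d p).2].
have oO p : M p -> open (O p).
  move=> Mp; have -> : O p = (fun y => `|p - y|) @^-1` [set x | x < (d p).2] by [].
  apply: open_comp; last exact: open_lt.
  by move=> y _; exact: dist_continuous.
have cM2 : cover_compact M by rewrite -(@compact_cover ((R * R * R)%type : normedModType R)).
have [] := cM2 _ M O oO.
  by move=> p Mp; exists p => //; rewrite /O /= subrr normr0; have [] := dP p Mp.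
move=> D sD cD; exists (finmap.enum_fset D), (fun p => (d p).1.1), (fun p => (d p).1.2), (fun p => (d p).2).
split=> [p pD|y My]; first by apply: dP; exact/set_mem/sD.
by have [p /= pD Oy] := cD y My; exists p.
Qed.

Lemma closed_cball (p : R * R * R) (e : R) : closed [set y : R * R * R | `|p - y| <= e].
Proof.
have -> : [set y : R * R * R | `|p - y| <= e] = (fun y => `|p - y|) @^-1` [set x | x <= e] by [].
apply: preimage_closed; last exact: closed_le.
by move=> y _; exact: dist_continuous.
Qed.

(** Additivity reduces a property of Borel subsets of the surface to subsets of the balls of
[chart_cover], where the formula for the area in a chart applies. *)
Lemma chart_induction (Q : set (R * R * R) -> Prop) :
  (forall U X C B, local_param M U X -> closed C -> M `&` C `<=` X @` U ->
    measurable B -> B `<=` M `&` C -> Q B) ->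
  (forall A B, measurable A -> measurable B -> A `&` B = set0 -> Q A -> Q B -> Q (A `|` B)) ->
  Q set0 -> forall B, measurable B -> B `<=` M -> Q B.
Proof.
move=> Qc QU Q0; have [s [U [X [r [sP sM]]]]] := chart_cover.
have H (s' : seq (R * R * R)) B : {subset s' <= s} -> measurable B -> B `<=` M ->
    (forall y, B y -> exists2 p, p \in s' & `|p - y| < r p) -> Q B.
  elim: s' B => [|p s' IH] B ss mB BM sB.
    suff -> : B = set0 by [].
    by apply/seteqP; split=> // y /sB[].
  have [lX r0 MX] := sP p (ss _ (mem_head _ _)).
  set C := [set y | `|p - y| <= r p] in MX.
  have cC : closed C by exact: closed_cball.
  have mC : measurable C by exact: closed_measurable3.
  rewrite -(setUIDK B C); apply: QU.
  - exact: measurableI.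
  - exact: measurableD.
  - by rewrite -setIA (setIC C) setDE -setIA setICl !setI0.
  - apply: (Qc (U p) (X p) C) => //; first exact: measurableI.
    by move=> y [By Cy]; split=> //; exact: BM.
  - apply: IH.
    + by move=> q qs; apply: ss; rewrite inE qs orbT.
    + exact: measurableD.
    + by move=> y [By _]; exact: BM.
    + move=> y [By nCy]; have [q] := sB y By.
      rewrite inE => /predU1P[->|qs] rq; last by exists q.
      by exfalso; apply: nCy; exact: ltW.
move=> B mB BM; apply: (H s) => // y By; exact: sM (BM _ By).
Qed.

Lemma sigma_fin : (sigma M < +oo)%E.
Proof.
apply: (@chart_induction (fun B => (sigma B < +oo)%E)); last 3 first.
- by rewrite measure0.
- exact: mM.
- by [].
- move=> U X C B lX cC MC mB BC.
  have mMC : measurable (M `&` C) by apply: measurableI; [exact: mM|exact: closed_measurable3].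
  apply: (@le_lt_trans _ _ (sigma (M `&` C))); first by apply: le_measure; rewrite ?inE.
  rewrite (sarea lX mMC MC); have cK := compact_chart_preimage lX cC MC.
  have -> : U `&` X @^-1` (M `&` C) = U `&` X @^-1` C.
    apply/seteqP; split=> q [Uq]; first by case.
    by move=> Cq; split=> //; split=> //; exact: chart_sub lX Uq.
  set K := U `&` _ in cK *.
  have ca : {within K, continuous (fun q => area X q)}.
    apply/subspace_continuousP => q [Uq _]; apply: cvg_within_filter.
    exact: smooth_in_continuous (smooth_in_area lX) Uq.
  have mK : measurable K.
    rewrite -[K]setCK; apply: measurableC; apply: open_measurable2; apply: closed_openC.
    by apply: compact_closed => //; exact: norm_hausdorff.
  have ma := within_continuous_measurable2 mK ca.
  have : lam.-integrable K (EFin \o (fun q => area X q)).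
    apply: measurable_bounded_integrable => //; first exact: compact_fin_measure2.
    have /compact_bounded[D [_ HD]] := continuous_compact ca cK.
    by exists D; split; rewrite ?num_real// => x Dx q Kq; apply: HD => //; exists q.
  move=> /integrableP[_]; apply: le_lt_trans; apply: ge0_le_integral => //.
  - by move=> q _; rewrite lee_fin sqrtr_ge0.
  - by apply/measurable_EFinP.
  - by apply: measurableT_comp => //; apply/measurable_EFinP.
  - by move=> q _ /=; rewrite lee_fin ler_norm.
- by move=> A B mA mB AB sA sB; rewrite measureU// lte_add_pinfty.
Qed.

Lemma chart_normal_rot U X t q : local_param M U X -> U q ->
  area (rot t \o X) q = area X q.
Proof.
move=> lX Uq; rewrite /chart_normal /enorm.
have -> : du (rot t \o X) q = rot t (du X q) by exact: D_rot_chart lX Uq.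
have -> : dv (rot t \o X) q = rot t (dv X q) by exact: D_rot_chart lX Uq.
by rewrite cross_rot; congr Num.sqrt; exact: dot_rot.
Qed.

Lemma measurable_rot t : measurable_fun setT (@rot R t).
Proof.
have c h : continuous h -> measurable_fun setT (h \o @rot R t : R * R * R -> R).
  move=> ch; apply: within_continuous_measurable3 => //; apply: continuous_subspaceT.
  by move=> p; apply: continuous_comp; [exact: rot_continuous|exact: ch].
have -> : @rot R t = (fun p => ((@px R \o rot t) p, (@py R \o rot t) p, (@pz R \o rot t) p)) by [].
apply: (measurable_fun_pair (measurable_fun_pair _ _) _).
- by apply: c; exact: px_continuous.
- by apply: c; exact: py_continuous.
- by apply: c; exact: pz_continuous.
Qed.

(** A rotated chart has the same area density. *)
Lemma sigma_rot t B : measurable B -> B `<=` M -> sigma (@rot R t @^-1` B) = sigma B.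
Proof.
have mpre A : measurable A -> measurable (@rot R t @^-1` A).
  by move=> mA; rewrite -[X in measurable X]setTI; exact: measurable_rot.
apply: (@chart_induction (fun B => sigma (rot t @^-1` B) = sigma B)).
- move=> U X C {}B lX cC MC mB BC.
  have BX : B `<=` X @` U by move=> y /BC; exact: MC.
  have lY := local_param_rot (- t) Mrot lX.
  have BY : rot t @^-1` B `<=` (rot (- t) \o X) @` U.
    by move=> y /= /BX[q Uq Xq]; exists q => //=; rewrite Xq rotK.
  rewrite (sarea lX mB BX) (sarea lY (mpre _ mB) BY).
  have EB : U `&` (rot (- t) \o X) @^-1` (rot t @^-1` B) = U `&` X @^-1` B.
    by apply/seteqP; split=> q [Uq] /=; rewrite rotNK.
  have Ea q (Uq : U q) := chart_normal_rot (- t) lX Uq.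
  rewrite EB; move: (rot (- t) \o X) Ea => Y Ea.
  apply: eq_integral => q /set_mem[Uq _]; exact: (congr1 EFin (Ea q Uq)).
- move=> A1 B1 mA mB AB sA sB.
  have AB' : rot t @^-1` A1 `&` rot t @^-1` B1 = set0 by rewrite -preimage_setI AB preimage_set0.
  rewrite preimage_setU (measureU _ mA mB AB) (measureU _ (mpre _ mA) (mpre _ mB) AB').
  exact: congr2 sA sB.
- by rewrite preimage_set0.
Qed.

Lemma rot_preimage_M t : @rot R t @^-1` M = M.
Proof.
apply/seteqP; split=> p /=; last exact: Mrot.
by move=> /(Mrot (- t)); rewrite rotK.
Qed.

Lemma integral_rot_ge0 t (f : R * R * R -> \bar R) : measurable_fun M f -> (forall y, M y -> 0 <= f y)%E ->
  (\int[sigma]_(p in M) f (rot t p) = \int[sigma]_(p in M) f p)%E.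
Proof.
move=> mf f0; have mr := @measurable_rot t.
have H : {in M, forall y, 0 <= f y}%E by move=> y /set_mem; exact: f0.
have := ge0_integral_pushforward mr sigma mM mf H.
rewrite rot_preimage_M => <-; apply: eq_measure_integral => B mB BM; exact: sigma_rot.
Qed.

Lemma measurable_comp_rot t d (T : measurableType d) (f : R * R * R -> T) : measurable_fun M f ->
  measurable_fun M (f \o rot t).
Proof.
move=> mf; apply: (measurable_comp mM _ mf); last exact: measurable_funTS (@measurable_rot t).
by move=> _ [p Mp <-]; exact: Mrot.
Qed.

Lemma integral_rot t (f : R * R * R -> \bar R) : measurable_fun M f ->
  (\int[sigma]_(p in M) f (rot t p) = \int[sigma]_(p in M) f p)%E.
Proof.
move=> mf; rewrite integralE [RHS]integralE; congr (_ - _)%E.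
  rewrite -(integral_rot_ge0 t (measurable_funepos mf))//.
  by apply: eq_integral => p _; rewrite !funeposE.
rewrite -(integral_rot_ge0 t (measurable_funeneg mf))//.
by apply: eq_integral => p _; rewrite !funenegE.
Qed.

End AreaMeasure.

(** * Green's identity *)

Section SmoothOn.
Context (R : realType) (M : set (R * R * R)).
Implicit Types (u v : R * R * R -> R).

Lemma local_param_open U X : local_param M U X -> open U. Proof. by case. Qed.

Lemma smooth_on_cst (c : R) : smooth_on M (fun=> c).
Proof. by move=> U X lX; exact: smooth_in_cst. Qed.

Lemma smooth_onD u v : smooth_on M u -> smooth_on M v -> smooth_on M (fun p => u p + v p).
Proof. by move=> su sv U X lX; apply: smooth_inD (local_param_open lX) (su _ _ lX) (sv _ _ lX). Qed.

Lemma smooth_onM u v : smooth_on M u -> smooth_on M v -> smooth_on M (fun p => u p * v p).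
Proof. by move=> su sv U X lX; apply: smooth_inM (local_param_open lX) (su _ _ lX) (sv _ _ lX). Qed.

Lemma smooth_onN u : smooth_on M u -> smooth_on M (fun p => - u p).
Proof. by move=> su U X lX; apply: smooth_inN (local_param_open lX) (su _ _ lX). Qed.

Lemma smooth_onB u v : smooth_on M u -> smooth_on M v -> smooth_on M (fun p => u p - v p).
Proof. by move=> su sv; apply: smooth_onD => //; exact: smooth_onN. Qed.

Lemma smooth_onV u : smooth_on M u -> (forall p, M p -> u p != 0) -> smooth_on M (fun p => (u p)^-1).
Proof.
move=> su u0 U X lX; apply: smooth_inV (local_param_open lX) (su _ _ lX) _.
by move=> q Uq; apply: u0; exact: chart_sub lX Uq.
Qed.

Lemma smooth_on_flat u : smooth_on M u -> smooth_on M (fun p => flat (u p)).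
Proof. by move=> su U X lX; apply: smooth_in_flat (local_param_open lX) (su _ _ lX). Qed.

Lemma smooth_on_coord : [/\ smooth_on M (@px R), smooth_on M (@py R) & smooth_on M (@pz R)].
Proof.
by split=> U X lX; have [oU sX _ _ _] := lX; have [] := smooth_in_coord oU sX.
Qed.

Lemma smooth_on_sum (T : Type) (s : seq T) (F : T -> R * R * R -> R) :
  (forall i, smooth_on M (F i)) -> smooth_on M (fun p => \sum_(i <- s) F i p).
Proof.
move=> sF; elim: s => [|i s IH].
  have -> : (fun p => \sum_(i <- [::]) F i p) = (fun=> 0) by apply/funext => p; rewrite big_nil.
  exact: smooth_on_cst.
have -> : (fun p => \sum_(j <- i :: s) F j p) = (fun p => F i p + \sum_(j <- s) F j p).
  by apply/funext => p; rewrite big_cons.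
exact: smooth_onD.
Qed.

(** The scalar product of gradients as a function on the surface; the choice of a chart is harmless by
[gdot_chart]. *)
Definition gip u v (p : R * R * R) : R :=
  xget 0 [set x | exists U X q, [/\ local_param M U X, U q, X q = p & x = gdot X q u v]].

Lemma gipE U X q u v : local_param M U X -> U q -> smooth_on M u -> smooth_on M v ->
  gip u v (X q) = gdot X q u v.
Proof.
move=> lX Uq su sv.
pose S := [set x | exists U' X' q', [/\ local_param M U' X', U' q', X' q' = X q & x = gdot X' q' u v]].
have [V [Y [q' [lY Vq' Yq' ->]]]] : S (gip u v (X q)).
  by apply: (@xgetI _ _ _ (gdot X q u v)); exists U, X, q.
exact: (gdot_chart lY lX Vq' Uq Yq').
Qed.

Lemma smooth_in_gdot U X u v : local_param M U X -> smooth_on M u -> smooth_on M v ->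
  smooth_in U (fun q => gdot X q u v).
Proof.
move=> lX su sv; have [sE sF sG sD] := smooth_in_metric lX; have oU := local_param_open lX.
have [su' sv'] := (su _ _ lX, sv _ _ lX).
have uu := smooth_in_derive ((1, 0) : R * R) su'; have uv := smooth_in_derive ((0, 1) : R * R) su'.
have vu := smooth_in_derive ((1, 0) : R * R) sv'; have vv := smooth_in_derive ((0, 1) : R * R) sv'.
have sDV : smooth_in U (fun q => (metdet X q)^-1).
  apply: (smooth_inV oU sD) => q Uq; rewrite gt_eqF// metdet_gt0//.
  by case: lX => _ _ n0 _ _; exact: n0.
have t1 := smooth_inM oU sG (smooth_inM oU uu vu).
have t2 := smooth_inM oU sF (smooth_inD oU (smooth_inM oU uu vv) (smooth_inM oU uv vu)).
have t3 := smooth_inM oU sE (smooth_inM oU uv vv).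
exact: (smooth_inM oU (smooth_inD oU (smooth_inB oU t1 t2) t3) sDV).
Qed.

Lemma smooth_on_gip u v : smooth_on M u -> smooth_on M v -> smooth_on M (gip u v).
Proof.
move=> su sv U X lX; have := smooth_in_gdot lX su sv.
by apply: smooth_in_eq (local_param_open lX) _ => q Uq; rewrite -[RHS]/(gip u v (X q)) (gipE lX Uq su sv).
Qed.

Hypothesis reg : regular_surface M.

Lemma gip_sym u v p : M p -> smooth_on M u -> smooth_on M v -> gip u v p = gip v u p.
Proof.
move=> Mp su sv; have [U [X [lX [q Uq <-]]]] := reg Mp.
by rewrite (gipE lX Uq su sv) (gipE lX Uq sv su) gdot_sym.
Qed.

Lemma gip_ge0 u p : M p -> smooth_on M u -> 0 <= gip u u p.
Proof.
move=> Mp su; have [U [X [lX [q Uq <-]]]] := reg Mp.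
by rewrite (gipE lX Uq su su); apply: gdot_ge0; case: lX => _ _ n0 _ _; exact: n0.
Qed.

Lemma D_chart_comb U X q (w : R * R) u v (a : R) : local_param M U X -> U q ->
  smooth_on M u -> smooth_on M v ->
  'D_w ((fun p => a * u p + v p) \o X) q = a * 'D_w (u \o X) q + 'D_w (v \o X) q.
Proof.
move=> lX Uq su sv.
have du_ := smooth_in_differentiable (su _ _ lX) Uq.
have dv_ := smooth_in_differentiable (sv _ _ lX) Uq.
have -> : (fun p => a * u p + v p) \o X = a *: (u \o X) + (v \o X) by [].
rewrite deriveD; [|exact: derivableZ (diff_derivable du_)|exact: diff_derivable].
by rewrite deriveZ//; exact: diff_derivable.
Qed.

Lemma gip_comb u v w p (a : R) : M p -> smooth_on M u -> smooth_on M v -> smooth_on M w ->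
  gip (fun p => a * u p + v p) w p = a * gip u w p + gip v w p.
Proof.
move=> Mp su sv sw; have [U [X [lX [q Uq <-]]]] := reg Mp.
have sauv : smooth_on M (fun p => a * u p + v p).
  by apply: smooth_onD => //; apply: smooth_onM => //; exact: smooth_on_cst.
rewrite (gipE lX Uq sauv sw) (gipE lX Uq su sw) (gipE lX Uq sv sw) /gdot /du /dv.
rewrite (D_chart_comb (1, 0) a lX Uq su sv) (D_chart_comb (0, 1) a lX Uq su sv).
move: ('D__ (u \o X) q) ('D__ (u \o X) q) ('D__ (v \o X) q) ('D__ (v \o X) q) ('D__ (w \o X) q) ('D__ (w \o X) q).
move: (metE X q) (metF X q) (metG X q) (metdet X q) => e f g d u1 u2 v1 v2 w1 w2; ring.
Qed.

Lemma gip_eq u v w p : M p -> smooth_on M u -> smooth_on M v -> smooth_on M w ->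
  (forall p, M p -> u p = v p) -> gip u w p = gip v w p.
Proof.
move=> Mp su sv sw uv; have [U [X [lX [q Uq <-]]]] := reg Mp.
rewrite (gipE lX Uq su sw) (gipE lX Uq sv sw).
have E : \forall q' \near q, (u \o X) q' = (v \o X) q'.
  have := open_nbhs_nbhs (conj (local_param_open lX) Uq).
  by apply: filterS => q' Uq' /=; apply: uv; exact: chart_sub lX Uq'.
by rewrite /gdot /du /dv (near_eq_derive ((1, 0) : R * R) E) (near_eq_derive ((0, 1) : R * R) E).
Qed.

Lemma smooth_on_laplacian u h : smooth_on M u -> is_laplacian M u h -> smooth_on M h.
Proof.
move=> su lap U X lX; have [sE sF sG sD] := smooth_in_metric lX; have oU := local_param_open lX.
have su' := su _ _ lX.
have uu := smooth_in_derive ((1, 0) : R * R) su'; have uv := smooth_in_derive ((0, 1) : R * R) su'.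
have D0 q : U q -> 0 < metdet X q.
  by move=> Uq; apply: metdet_gt0; case: lX => _ _ n0 _ _; exact: n0.
have sS : smooth_in U (fun q => (Num.sqrt (metdet X q))^-1).
  apply: (smooth_inV oU (smooth_in_sqrt oU sD D0)) => q Uq.
  by rewrite gt_eqF// sqrtr_gt0 D0.
have t1 := smooth_inM oU (smooth_inB oU (smooth_inM oU sG uu) (smooth_inM oU sF uv)) sS.
have t2 := smooth_inM oU (smooth_inB oU (smooth_inM oU sE uv) (smooth_inM oU sF uu)) sS.
have t3 := smooth_inD oU (smooth_in_derive ((1, 0) : R * R) t1) (smooth_in_derive ((0, 1) : R * R) t2).
apply: (@smooth_in_eq _ _ _ _ (chart_laplacian X u) _ oU); last exact: (smooth_inM oU sS t3).
by move=> q Uq; rewrite -(lap _ _ lX q Uq).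
Qed.

End SmoothOn.

Section Green.
Context (R : realType) (M : set (R * R * R)).
Context (sigma : {measure set (R * R * R) -> \bar R}).
Implicit Types (u v phi h : R * R * R -> R) (U : set (R * R)) (X : R * R -> R * R * R).
Local Notation lam := (@lebesgue_measure R \x @lebesgue_measure R)%E.
Local Notation area X q := (enorm (chart_normal X q)).
Hypotheses (reg : regular_surface M) (cM : compact M).
Hypothesis sarea : is_area_measure M sigma.

Lemma smooth_on_integrable u : smooth_on M u -> sigma.-integrable M (EFin \o u).
Proof.
move=> su; apply: measurable_bounded_integrable.
- exact: measurable_surface.
- exact: sigma_fin.
- exact: smooth_on_measurable.
- have [C HC] := smooth_on_bounded reg cM su.
  by exists C; split; rewrite ?num_real// => x Cx p Mp; exact: le_trans (HC p Mp) (ltW Cx).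
Qed.

(** [fieldU] and [fieldV] are the components of sqrt(det g) grad v, a field whose divergence in the
plane is the Laplacian of v times the area density. *)
Definition fieldU (X : R * R -> R * R * R) v (q : R * R) : R :=
  (metG X q * du (v \o X) q - metF X q * dv (v \o X) q) / Num.sqrt (metdet X q).
Definition fieldV (X : R * R -> R * R * R) v (q : R * R) : R :=
  (metE X q * dv (v \o X) q - metF X q * du (v \o X) q) / Num.sqrt (metdet X q).

Lemma smooth_in_field U X v : local_param M U X -> smooth_on M v ->
  smooth_in U (fieldU X v) /\ smooth_in U (fieldV X v).
Proof.
move=> lX sv; have [sE sF sG sD] := smooth_in_metric lX; have oU := local_param_open lX.
have sv' := sv _ _ lX.
have vu := smooth_in_derive ((1, 0) : R * R) sv'; have vv := smooth_in_derive ((0, 1) : R * R) sv'.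
have D0 q' : U q' -> 0 < metdet X q'.
  by move=> Uq'; apply: metdet_gt0; case: lX => _ _ n0 _ _; exact: n0.
have sS : smooth_in U (fun q => (Num.sqrt (metdet X q))^-1).
  apply: (smooth_inV oU (smooth_in_sqrt oU sD D0)) => q' Uq'.
  by rewrite gt_eqF// sqrtr_gt0 D0.
split; [exact: (smooth_inM oU (smooth_inB oU (smooth_inM oU sG vu) (smooth_inM oU sF vv)) sS)|].
exact: (smooth_inM oU (smooth_inB oU (smooth_inM oU sE vv) (smooth_inM oU sF vu)) sS).
Qed.

(** The product rule for the divergence of phi grad v. *)
Lemma div_chart U X phi v h (q : R * R) : local_param M U X -> U q ->
  smooth_on M phi -> smooth_on M v -> is_laplacian M v h ->
  (phi (X q) * h (X q) + gip M phi v (X q)) * area X q =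
    du (fun q => phi (X q) * fieldU X v q : R) q + dv (fun q => phi (X q) * fieldV X v q : R) q.
Proof.
move=> lX Uq sphi sv lap.
have [sA sB] := smooth_in_field lX sv.
have sphi' := sphi _ _ lX.
have D0 : 0 < metdet X q by apply: metdet_gt0; case: lX => _ _ n0 _ _; exact: n0.
have dphi (w : R * R) : derivable (phi \o X) q w.
  by apply: diff_derivable; exact: smooth_in_differentiable sphi' Uq.
have dA (w : R * R) : derivable (fieldU X v) q w.
  by apply: diff_derivable; exact: smooth_in_differentiable sA Uq.
have dB (w : R * R) : derivable (fieldV X v) q w.
  by apply: diff_derivable; exact: smooth_in_differentiable sB Uq.
have e1 : du (fun q => phi (X q) * fieldU X v q : R) q = phi (X q) * 'D_(1, 0) (fieldU X v) q + fieldU X v q * 'D_(1, 0) (phi \o X) q.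
  exact: (deriveM (dphi (1, 0)) (dA (1, 0))).
have e2 : dv (fun q => phi (X q) * fieldV X v q : R) q = phi (X q) * 'D_(0, 1) (fieldV X v) q + fieldV X v q * 'D_(0, 1) (phi \o X) q.
  exact: (deriveM (dphi (0, 1)) (dB (0, 1))).
rewrite e1 e2 (lap _ _ lX q Uq) (gipE lX Uq sphi sv) enorm_normal.
rewrite -[chart_laplacian X v q]/((Num.sqrt (metdet X q))^-1 * ('D_(1, 0) (fieldU X v) q + 'D_(0, 1) (fieldV X v) q)).
have S0 : Num.sqrt (metdet X q) != 0 by rewrite gt_eqF// sqrtr_gt0 D0.
have S2 : metdet X q = Num.sqrt (metdet X q) ^+ 2 by rewrite sqr_sqrtr// ltW// D0.
move: ('D_(1, 0) (fieldU X v) q) ('D_(0, 1) (fieldV X v) q) => DA DB.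
rewrite /gdot /fieldU /fieldV /du /dv.
move: ('D__ (phi \o X) q) ('D__ (phi \o X) q) ('D__ (v \o X) q) ('D__ (v \o X) q) (phi (X q)).
move: (metE X q) (metF X q) (metG X q) => e f g p1 p2 v1 v2 ph.
move: (Num.sqrt (metdet X q)) S0 S2 => S S0 ->.
by field.
Qed.

(** The field of [div_chart] vanishes outside a compact subset of the chart domain, so that its
divergence integrates to zero. *)
Lemma green_local U X (C : set (R * R * R)) phi v h : local_param M U X -> closed C ->
  M `&` C `<=` X @` U -> smooth_on M phi -> (forall p, ~ C p -> phi p = 0) ->
  smooth_on M v -> is_laplacian M v h ->
  (\int[sigma]_(p in M) (phi p * h p + gip M phi v p)%:E = 0)%E.
Proof.
move=> lX cC MC sphi phi0 sv lap; have oU := local_param_open lX.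
have sh := smooth_on_laplacian sv lap.
pose W p := phi p * h p + gip M phi v p.
have sW : smooth_on M W by exact: smooth_onD (smooth_onM sphi sh) (smooth_on_gip sphi sv).
have W0 p : M p -> ~ C p -> W p = 0.
  move=> Mp nCp; rewrite /W phi0// mul0r add0r.
  have [V [Y [lY [q Vq Yq]]]] := reg Mp; rewrite -Yq (gipE lY Vq sphi sv).
  have E : \forall q' \near q, 0 = (phi \o Y) q'.
    have cY : {for q, continuous Y} by case: lY => _ sY _ _ _; exact: smooth_in_continuous sY Vq.
    have nC : nbhs (Y q) (~` C) by apply: open_nbhs_nbhs; split; [exact: closed_openC|rewrite Yq].
    have nYC : \forall q' \near q, ~ C (Y q') by exact: (cY _ nC).
    by apply: filterS nYC => q' /= nCq'; rewrite phi0.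
  have du0 : du (phi \o Y) q = 0 by rewrite /du -(near_eq_derive _ E) derive_cst.
  have dv0 : dv (phi \o Y) q = 0 by rewrite /dv -(near_eq_derive _ E) derive_cst.
  rewrite /gdot du0 dv0; move: (du _ q) (dv _ q) (metE Y q) (metF Y q) (metG Y q) (metdet Y q).
  by move=> a b e f g d; rewrite !mul0r addr0 !mulr0 subr0 add0r mul0r.
have mM := measurable_surface cM.
have mXU := measurable_chart_image cM lX.
have XM : X @` U `<=` M by move=> _ [q Uq <-]; exact: chart_sub lX Uq.
have -> : (\int[sigma]_(p in M) (W p)%:E = \int[sigma]_(p in X @` U) (W p)%:E)%E.
  rewrite [LHS]integral_mkcond [RHS]integral_mkcond; apply: eq_integral => p _.
  rewrite !patchE; case: ifPn => [/set_mem Mp|nMp]; case: ifPn => [/set_mem Up|nUp] //.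
    rewrite /= W0// => Cp; move/negP: nUp; apply; apply/mem_set; exact: MC.
  by exfalso; move/negP: nMp; apply; apply/mem_set; exact: XM.
have mW : measurable_fun (X @` U) (EFin \o W).
  apply/measurable_EFinP; apply: (measurable_funS mM XM); exact: smooth_on_measurable.
rewrite (chart_integral sarea lX mXU (fun _ => id) mW).
have -> : U `&` X @^-1` (X @` U) = U by apply/seteqP; split=> [q []//|q Uq]; split=> //; exists q.
have cK := compact_chart_preimage cM lX cC MC; set K := U `&` _ in cK.
have closedK : closed K by apply: compact_closed => //; exact: norm_hausdorff.
have /compact_bounded[k0 [_ Kk]] := cK; pose k := Num.max 1 (k0 + 1).
have k_gt0 : 0 < k by rewrite /k lt_max ltr01.
have Kk' q : k < `|q| -> ~ K q.
  move=> kq Kq; have : `|q| <= k0 + 1 by apply: Kk Kq; rewrite ltrDl.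
  by rewrite leNgt => /negP; apply; apply: le_lt_trans kq; rewrite /k le_max lexx orbT.
(* extension by zero of the components of the field *)
have ext (Z : R * R -> R) : smooth_in U Z ->
    exists P : R * R -> R, [/\ forall q, differentiable P q, continuous (du P), continuous (dv P),
      forall q, k + 1 <= `|q| -> P q = 0 &
      [/\ forall q, U q -> \forall q' \near q, P q' = phi (X q') * Z q',
          forall q, ~ U q -> du P q = 0 & forall q, ~ U q -> dv P q = 0]].
  move=> sZ; pose P : R * R -> R := (fun q => phi (X q) * Z q) \_ U.
  have PU q : U q -> \forall q' \near q, P q' = phi (X q') * Z q'.
    move=> Uq; have := open_nbhs_nbhs (conj oU Uq).
    by apply: filterS => q' Uq'; rewrite /P patchE mem_set.
  have P0 q : ~ K q -> P q = 0.
    move=> nK; rewrite /P patchE; case: ifPn => // /set_mem Uq.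
    by rewrite phi0 ?mul0r// => Cq; apply: nK.
  have sP : smooth_in setT P.
    apply: smooth_in_local => q _; have [Uq|nUq] := pselect (U q).
      exists U, (fun q => phi (X q) * Z q); split=> //; first exact: smooth_inM oU (sphi _ _ lX) sZ.
      by move=> q' Uq'; rewrite /P patchE mem_set.
    exists (~` K), (fun=> 0); split; [exact: closed_openC|by move=> [Uq _]|exact: smooth_in_cst|].
    by move=> q' /P0.
  have D0 (w q : R * R) : ~ U q -> 'D_w P q = 0.
    move=> nUq; have E : \forall q' \near q, 0 = P q'.
      have nK : nbhs q (~` K) by apply: open_nbhs_nbhs; split; [exact: closed_openC|case].
      by apply: filterS nK => q' /P0.
    by rewrite -(near_eq_derive _ E) derive_cst.
  exists P; split.
  - by move=> q; exact: smooth_in_differentiable sP I.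
  - by move=> q; exact: smooth_in_continuous (smooth_in_derive ((1, 0) : R * R) sP) I.
  - by move=> q; exact: smooth_in_continuous (smooth_in_derive ((0, 1) : R * R) sP) I.
  - by move=> q kq; apply: P0; apply: Kk'; apply: lt_le_trans kq; rewrite ltrDl.
  - by split=> // q; exact: D0.
have [sA sB] := smooth_in_field lX sv.
have [P [dP cuP _ P0 [PU Pu0 _]]] := ext _ sA.
have [Q [dQ _ cvQ Q0 [QU _ Qv0]]] := ext _ sB.
have k1 : 0 < k + 1 by rewrite addr_gt0.
have [iP zP] := integral_du0 k1 dP cuP P0.
have [iQ zQ] := integral_dv0 k1 dQ cvQ Q0.
transitivity (\int[lam]_q ((du P q)%:E + (dv Q q)%:E))%E; last first.
  by rewrite (integralD measurableT iP iQ) zP zQ adde0.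
rewrite integral_mkcond; apply: eq_integral => q _; rewrite patchE -EFinD.
case: ifPn => [/set_mem Uq|/negP nUq]; last first.
  have {}nUq : ~ U q by move=> Uq; apply: nUq; exact/mem_set.
  by rewrite Pu0// Qv0// addr0.
rewrite /= -EFinM /W (div_chart lX Uq sphi sv lap).
have -> : du P q = du (fun q => phi (X q) * fieldU X v q : R) q by exact: near_eq_derive (PU q Uq).
by have -> : dv Q q = dv (fun q => phi (X q) * fieldV X v q : R) q by exact: near_eq_derive (QU q Uq).
Qed.

(** A product of three functions of one variable, because the ambient norm is a maximum: the support is
then exactly a ball. *)
Definition bump (c : R * R * R) (r : R) (y : R * R * R) : R :=
  flat (r ^+ 2 - (px y - px c) ^+ 2) * flat (r ^+ 2 - (py y - py c) ^+ 2)
  * flat (r ^+ 2 - (pz y - pz c) ^+ 2).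

Lemma smooth_on_bump c r : smooth_on M (bump c r).
Proof.
have [sx sy sz] := smooth_on_coord M.
have H (f : R * R * R -> R) (a : R) : smooth_on M f -> smooth_on M (fun y => flat (r ^+ 2 - (f y - a) ^+ 2)).
  move=> sf; apply: smooth_on_flat; apply: smooth_onB; first exact: smooth_on_cst.
  have sfa : smooth_on M (fun y => f y - a) by apply: smooth_onB => //; exact: smooth_on_cst.
  have -> : (fun y => (f y - a) ^+ 2) = (fun y => (f y - a) * (f y - a)) by [].
  exact: smooth_onM.
exact: smooth_onM (smooth_onM (H _ _ sx) (H _ _ sy)) (H _ _ sz).
Qed.

Lemma norm3_lt (y : R * R * R) (r : R) : (`|y| < r) = [&& `|px y| < r, `|py y| < r & `|pz y| < r].
Proof. by case: y => [[a b] c]; rewrite !prod_normE /= !gt_max andbA. Qed.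

Lemma flat_square_gt0 (r a : R) : 0 < r -> (0 < flat (r ^+ 2 - a ^+ 2)) = (`|a| < r).
Proof.
move=> r0; apply/idP/idP => [|ar].
  apply: contraTT; rewrite -!leNgt => ra; rewrite flat_le0// subr_le0.
  by rewrite -[leRHS]real_normK ?num_real// lerXn2r ?nnegrE// ltW.
apply: flat_gt0; rewrite subr_gt0 -[ltLHS]real_normK ?num_real//.
by rewrite ltrXn2r// nnegrE// ltW.
Qed.

Lemma bump_gt0 c r y : 0 < r -> `|c - y| < r -> 0 < bump c r y.
Proof.
move=> r0; rewrite -normrN opprB norm3_lt => /and3P[cx cy cz].
by rewrite /bump !mulr_gt0// flat_square_gt0.
Qed.

Lemma bump_ge0 c r y : 0 <= bump c r y.
Proof. by rewrite /bump !mulr_ge0// flat_ge0. Qed.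

Lemma bump_eq0 c r y : 0 < r -> ~ (`|c - y| <= r) -> bump c r y = 0.
Proof.
move=> r0 H; apply/eqP; rewrite eq_le bump_ge0 andbT leNgt; apply/negP => b0; apply: H.
apply: ltW; rewrite -normrN opprB norm3_lt.
have g x : 0 < r -> flat (r ^+ 2 - x ^+ 2) != 0 -> `|x| < r.
  by move=> _ nz; rewrite -flat_square_gt0// lt0r nz flat_ge0.
have : bump c r y != 0 by rewrite gt_eqF.
rewrite /bump !mulf_eq0 !negb_or -andbA => /and3P[nx ny nz].
by rewrite !g.
Qed.

(** Bumps divided by their sum split [u] into functions supported in charts. *)
Lemma Green u v h : smooth_on M u -> smooth_on M v -> is_laplacian M v h ->
  (\int[sigma]_(p in M) (u p * h p + gip M u v p) = 0)%R.
Proof.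
move=> su sv lap; have sh := smooth_on_laplacian sv lap.
have [s [U [X [r [sP sM]]]]] := chart_cover reg cM.
pose S y := \sum_(p <- s) bump p (r p) y.
have sS : smooth_on M S by apply: smooth_on_sum => p; exact: smooth_on_bump.
have S0 y : M y -> 0 < S y.
  move=> /sM[p ps py]; rewrite /S big_seq (big_rem p ps) /= ps.
  have [_ r0 _] := sP p ps; apply: ltr_pwDl; first exact: bump_gt0.
  by apply: sumr_ge0 => *; exact: bump_ge0.
have sSV : smooth_on M (fun y => (S y)^-1) by apply: smooth_onV => // p /S0; rewrite lt0r => /andP[].
pose phi p y := bump p (r p) y * ((S y)^-1 * u y).
have sphi p : smooth_on M (phi p).
  by apply: smooth_onM; [exact: smooth_on_bump|exact: smooth_onM].
pose W f y := f y * h y + gip M f v y.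
have sW f : smooth_on M f -> smooth_on M (W f).
  by move=> sf; apply: smooth_onD; [exact: smooth_onM|exact: smooth_on_gip].
have mM := measurable_surface cM.
have zero s' : {subset s' <= s} -> \int[sigma]_(p in M) W (fun y => \sum_(q <- s') phi q y) p = 0.
  elim: s' => [|q s' IH] ss.
    rewrite /Rintegral integral0_eq// => p Mp; congr EFin.
    have -> : (fun y => \sum_(q <- [::]) phi q y) = (fun=> 0) by apply/funext => y; rewrite big_nil.
    have s0 : smooth_on M (fun=> 0 : R) by exact: smooth_on_cst.
    have E : (fun p : R * R * R => -1 * 0 + 0) = (fun=> 0 : R) by apply/funext => y; rewrite mulr0 addr0.
    have := gip_comb reg (-1) Mp s0 s0 sv; rewrite E mulN1r addNr /W => ->.
    by rewrite mul0r addr0.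
  have sS' : smooth_on M (fun y => \sum_(q <- s') phi q y) by exact: smooth_on_sum.
  have -> : \int[sigma]_(p in M) W (fun y => \sum_(j <- q :: s') phi j y) p
     = \int[sigma]_(p in M) (W (phi q) p + W (fun y => \sum_(j <- s') phi j y) p).
    apply: eq_Rintegral => p /set_mem Mp.
    have -> : (fun y => \sum_(j <- q :: s') phi j y) = (fun y => 1 * phi q y + \sum_(j <- s') phi j y).
      by apply/funext => y; rewrite big_cons mul1r.
    by rewrite /W (gip_comb reg 1 Mp (sphi q) sS' sv) !mul1r mulrDl addrACA.
  rewrite RintegralD//; [|by apply: smooth_on_integrable; exact: sW..].
  rewrite IH ?addr0; last by move=> j js; apply: ss; rewrite inE js orbT.
  have [lX r0 MX] := sP q (ss _ (mem_head _ _)).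
  rewrite /Rintegral (@green_local (U q) (X q) [set y | `|q - y| <= r q])//.
  - exact: closed_cball.
  - by move=> y /= nC; rewrite /phi bump_eq0// mul0r.
rewrite -[RHS](zero s (fun _ => id)); apply: eq_Rintegral => p /set_mem Mp.
have sS' : smooth_on M (fun y => \sum_(q <- s) phi q y) by exact: smooth_on_sum.
have E y : M y -> u y = \sum_(q <- s) phi q y.
  by move=> My; rewrite /phi -mulr_suml -/(S y) mulrA divff ?mul1r// gt_eqF// S0.
rewrite /W (gip_eq reg Mp su sS' sv E); congr (_ * _ + _); exact: E.
Qed.

End Green.

(** * The rotation field and the axis *)

Lemma half_le0 (R : realType) (n : R) : n <= 2^-1 * n -> n <= 0.
Proof. by move=> H; lra. Qed.

Section RotationField.
Context (R : realType) (M : set (R * R * R)).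
Context (sigma : {measure set (R * R * R) -> \bar R}).
Implicit Types (u v phi h : R * R * R -> R) (U : set (R * R)) (X : R * R -> R * R * R).
Local Notation area X q := (enorm (chart_normal X q)).
Local Notation lam := (@lebesgue_measure R \x @lebesgue_measure R)%E.
Hypotheses (reg : regular_surface M) (cM : compact M) (Mrot : rotation_symmetric M).
Hypothesis sarea : is_area_measure M sigma.

Lemma smooth_on_X3 u : smooth_on M u -> smooth_on M (X3 u).
Proof.
move=> su U X lX; have [sE sF sG sD] := smooth_in_metric lX; have oU := local_param_open lX.
have su' := su _ _ lX.
have sX : smooth_in U X by case: lX.
have uu := smooth_in_derive ((1, 0) : R * R) su'; have uv := smooth_in_derive ((0, 1) : R * R) su'.
have [sx sy sz] := smooth_in_coord oU sX.
have D0 q' : U q' -> 0 < metdet X q'.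
  by move=> Uq'; apply: metdet_gt0; case: lX => _ _ n0 _ _; exact: n0.
have sDV : smooth_in U (fun q => (metdet X q)^-1).
  by apply: (smooth_inV oU sD) => q Uq; rewrite gt_eqF// D0.
have sdot (w : R * R) : smooth_in U (fun q => dot (X3_vec (X q)) ('D_w X q)).
  have [wx wy wz] := smooth_in_coord oU (smooth_in_derive w sX).
  have := smooth_inD oU (smooth_inN oU (smooth_inM oU sy wx)) (smooth_inM oU sx wy).
  apply: smooth_in_eq => // q Uq; rewrite /dot /X3_vec /= mul0r addr0 mulNr //.
have t1 := smooth_inM oU (smooth_inB oU (smooth_inM oU sG (sdot (1, 0))) (smooth_inM oU sF (sdot (0, 1)))) sDV.
have t2 := smooth_inM oU (smooth_inB oU (smooth_inM oU sE (sdot (0, 1))) (smooth_inM oU sF (sdot (1, 0)))) sDV.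
apply: (smooth_in_eq oU _ (smooth_inD oU (smooth_inM oU t1 uu) (smooth_inM oU t2 uv))) => q Uq.
by have [_ E _ _] := X3_chart Mrot lX Uq su; rewrite [RHS]E.
Qed.

Lemma is_derive_rot u p t : M p -> smooth_on M u ->
  is_derive (t : R) (1 : R) (fun t => u (rot t p) : R) (X3 u (rot t p)).
Proof.
move=> Mp su; have [U [X [lX [q Uq Xq]]]] := reg (Mrot t Mp).
have [_ _ [d0 D0] _] := X3_chart Mrot lX Uq su; rewrite Xq in d0 D0.
have E : (fun h : R => h^-1 *: (((fun t => u (rot t p)) \o shift t) (h *: 1) - u (rot t p)))
   = (fun h : R => h^-1 *: (((fun s => u (rot s (rot t p))) \o shift 0) (h *: 1) - u (rot 0 (rot t p)))).
  by apply/funext => h /=; rewrite addr0 -rotD rot0.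
by apply: DeriveDef; [rewrite /derivable E|rewrite /derive E].
Qed.

(** The rotation field is bounded on the compact surface. *)
Lemma X3_bound : exists2 C : R, 0 < C & forall u p, M p -> smooth_on M u ->
  (X3 u p) ^+ 2 <= C * gip M u u p.
Proof.
have [sx sy _] := smooth_on_coord M.
have sr : smooth_on M (fun p => dot (X3_vec p) (X3_vec p)).
  have -> : (fun p : R * R * R => dot (X3_vec p) (X3_vec p)) = (fun p => px p * px p + py p * py p).
    by apply/funext => p; rewrite /dot /X3_vec /px /py /=; ring.
  by apply: smooth_onD; exact: smooth_onM.
have [C HC] := smooth_on_bounded reg cM sr.
exists (`|C| + 1) => [|u p Mp su]; first by rewrite ltr_wpDl.
have [U [X [lX [q Uq Xq]]]] := reg Mp.
have [_ _ _] := X3_chart Mrot lX Uq su; rewrite -(gipE lX Uq su su) Xq => /le_trans; apply.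
apply: ler_wpM2r; first exact: gip_ge0.
apply: le_trans (ler_norm _) _; apply: le_trans (HC p Mp) _.
by apply: le_trans (ler_norm _) _; rewrite lerDl.
Qed.

Lemma dot_normal_tangent X q a : dot (chart_normal X q) (tangent X q a) = 0.
Proof.
rewrite /chart_normal /tangent; move: (du X q) (dv X q) => u v.
by rewrite /dot /cross /= /GRing.scale /=; ring.
Qed.

(** Near a point of the axis the surface is a graph over the horizontal plane:
the rotation field is tangent to the surface and vanishes at that point, so that
the tangent plane is invariant under the rotations. *)
Lemma axis_normal U X q : local_param M U X -> U q -> px (X q) = 0 -> py (X q) = 0 ->
  pz (chart_normal X q) != 0.
Proof.
move=> lX Uq x0 y0; have oU := local_param_open lX.
have sX : smooth_in U X by case: lX.
have n0 : chart_normal X q != 0 by case: lX => _ _ n0 _ _; exact: n0.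
have [sx sy sz] := smooth_in_coord oU sX.
have [ux uy uz] := smooth_in_coord oU (smooth_in_derive ((1, 0) : R * R) sX).
have [vx vy vz] := smooth_in_coord oU (smooth_in_derive ((0, 1) : R * R) sX).
pose nx (q : R * R) : R := py (du X q) * pz (dv X q) - pz (du X q) * py (dv X q).
pose ny (q : R * R) : R := pz (du X q) * px (dv X q) - px (du X q) * pz (dv X q).
have snx : smooth_in U nx := smooth_inB oU (smooth_inM oU uy vz) (smooth_inM oU uz vy).
have sny : smooth_in U ny := smooth_inB oU (smooth_inM oU uz vx) (smooth_inM oU ux vz).
have E (q' : R * R) : U q' -> ny q' * (@px R \o X) q' = nx q' * (@py R \o X) q'.
  move=> Uq'; have [tE _ _ _] := X3_chart Mrot lX Uq' (@smooth_on_cst R M 0).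
  have := dot_normal_tangent X q' (tcoord X q' (X3_vec (X q'))); rewrite tE.
  rewrite /dot /X3_vec /chart_normal /cross /= mulr0 addr0 mulrN => /eqP.
  by rewrite addrC subr_eq0 => /eqP.
(* both sides differentiated at a point where x = y = 0 *)
have D (w : R * R) : ny q * px ('D_w X q) = nx q * py ('D_w X q).
  have nE : \forall q' \near q, (ny * (@px R \o X)) q' = (nx * (@py R \o X)) q'.
    by have := open_nbhs_nbhs (conj oU Uq); apply: filterS => q' /E.
  have dX := smooth_in_differentiable sX Uq.
  have [dxX Dx] := derive_lin w (@px_continuous R) dX.
  have [dyX Dy] := derive_lin w (@py_continuous R) dX.
  have dnx : derivable nx q w by apply: diff_derivable; exact: smooth_in_differentiable snx Uq.
  have dny : derivable ny q w by apply: diff_derivable; exact: smooth_in_differentiable sny Uq.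
  have := near_eq_derive w nE.
  rewrite (deriveM dny (diff_derivable dxX)) (deriveM dnx (diff_derivable dyX)) Dx Dy.
  rewrite -[(@px R \o X) q]/(px (X q)) -[(@py R \o X) q]/(py (X q)) x0 y0 !scale0r !addr0.
  by [].
have := D (1, 0); have := D (0, 1); rewrite -/(du X q) -/(dv X q).
move: n0; rewrite /nx /ny /chart_normal /cross /pz /px /py /=.
move: (du X q) (dv X q) => [[a1 a2] a3] [[b1 b2] b3] /= n0 Hb Ha.
apply: contra_neq n0 => nz0.
set n1 := a2 * b3 - a3 * b2 in Ha Hb *; set n2 := a3 * b1 - a1 * b3 in Ha Hb *.
have Pa : n1 * a1 + n2 * a2 = 0.
  by rewrite -[RHS](mulr0 (- a3)) -[in RHS]nz0 /n1 /n2; ring.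
have Pb : n1 * b1 + n2 * b2 = 0.
  by rewrite -[RHS](mulr0 (- b3)) -[in RHS]nz0 /n1 /n2; ring.
have S0 : n1 ^+ 2 + n2 ^+ 2 = 0.
  apply/eqP; apply/negPn/negP => S0.
  have z x y : n1 * x + n2 * y = 0 -> n2 * x = n1 * y -> x = 0 /\ y = 0.
    move=> h1 h2; split; apply: (mulfI S0); rewrite mulr0.
      by transitivity (n1 * (n1 * x + n2 * y) + n2 * (n2 * x - n1 * y)); [ring|rewrite h1 h2 subrr !mulr0 addr0].
    by transitivity (n2 * (n1 * x + n2 * y) - n1 * (n2 * x - n1 * y)); [ring|rewrite h1 h2 subrr !mulr0 subr0].
  have [a10 a20] := z _ _ Pa Ha; have [b10 b20] := z _ _ Pb Hb.
  move: S0; rewrite /n1 /n2 a10 a20 b10 b20 !(mul0r, mulr0) subrr expr0n /= addr0.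
  by rewrite eqxx.
move/eqP: S0; rewrite paddr_eq0 ?sqr_ge0// !sqrf_eq0 => /andP[/eqP -> /eqP ->].
by rewrite nz0.
Qed.

Definition axis : set (R * R * R) := [set p | px p = 0 /\ py p = 0].

Lemma closed_axis : closed axis.
Proof.
have -> : axis = @px R @^-1` [set 0] `&` @py R @^-1` [set 0] by [].
apply: closedI; apply: preimage_closed; try exact: closed_eq.
  by move=> p _; exact: px_continuous.
by move=> p _; exact: py_continuous.
Qed.

(** By [axis_normal] the differential of the horizontal coordinates is injective at a point of the
axis. *)
Lemma axis_isolated U X q : local_param M U X -> U q -> axis (X q) ->
  \forall q' \near q, axis (X q') -> q' = q.
Proof.
move=> lX Uq [x0 y0]; have oU := local_param_open lX.
have sX : smooth_in U X by case: lX.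
have dX := smooth_in_differentiable sX Uq.
have nz := axis_normal lX Uq x0 y0.
pose Y (q : R * R) : R * R * R := (px (X q), py (X q), 0).
have [dx Dx] := derive_lin ((1, 0) : R * R) (@px_continuous R) dX.
have [dy Dy] := derive_lin ((1, 0) : R * R) (@py_continuous R) dX.
have [_ Dx'] := derive_lin ((0, 1) : R * R) (@px_continuous R) dX.
have [_ Dy'] := derive_lin ((0, 1) : R * R) (@py_continuous R) dX.
have dY : differentiable Y q.
  by apply: differentiable_pair; [apply: differentiable_pair; [exact: dx|exact: dy]|exact: differentiable_cst].
have DY (w : R * R) : 'D_w Y q = ('D_w (@px R \o X) q, 'D_w (@py R \o X) q, 0).
  have [_ e1] := derive_lin w (@px_continuous R) dY.
  have [_ e2] := derive_lin w (@py_continuous R) dY.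
  have [_ e3] := derive_lin w (@pz_continuous R) dY.
  have -> : 'D_w Y q = (px ('D_w Y q), py ('D_w Y q), pz ('D_w Y q)) by case: ('D_w Y q) => [[]].
  rewrite -e1 -e2 -e3; congr (_, _, _).
  by have -> : @pz R \o Y = cst 0 by []; rewrite derive_cst.
have D0 : metdet Y q != 0.
  rewrite metdet_normal gt_eqF// lt0r dot_ge0 andbT.
  apply: contra_neq nz => /dot_eq0 H; have := congr1 (@pz R) H.
  rewrite /chart_normal /cross /pz /= /du /dv !DY /= Dx Dy Dx' Dy'.
  by [].
have [k k0 kL] := linear_lipschitz (@tcoord_continuous R Y q).
have e0 : 0 < (2 * k)^-1 by rewrite invr_gt0 mulr_gt0.
have := diff_approx dY e0; apply: filterS => q' H [x0' y0'].
have Yq : Y q = 0 by rewrite /Y x0 y0.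
have Yq' : Y q' = 0 by rewrite /Y x0' y0'.
move: H; rewrite Yq Yq' subrr sub0r normrN => H.
have := kL ('d Y q (q' - q)); rewrite diff2E// -/(tangent Y q (q' - q)) /= tcoordK//.
rewrite /tangent -diff2E// => H2.
have H3 : `|q' - q| <= 2^-1 * `|q' - q|.
  apply: le_trans H2 _; apply: le_trans (ler_wpM2l (ltW k0) H) _.
  by rewrite mulrA; apply: ler_wpM2r => //; rewrite invfM mulrCA divff ?mulr1// gt_eqF.
by have := half_le0 H3; rewrite normr_le0 subr_eq0 => /eqP.
Qed.

Lemma sigma_point p : M p -> sigma [set p] = 0%E.
Proof.
move=> Mp; have [U [X [lX [q Uq Xq]]]] := reg Mp.
have m1 : measurable [set p].
  have -> : [set p] = [set p.1.1] `*` [set p.1.2] `*` [set p.2].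
    by apply/seteqP; split=> [x -> //|[[a b] c] [[/= -> ->] ->]]; case: p {Mp Xq} => [[]].
  by apply: measurableX => //; exact: measurableX.
have sub : [set p] `<=` X @` U by move=> _ ->; exists q.
rewrite (sarea lX m1 sub).
have -> : U `&` X @^-1` [set p] = [set q.1] `*` [set q.2].
  case: lX => _ _ _ inj _; apply/seteqP; split=> [q' [Uq' Xq']|[a b] [/= -> ->]].
    by have -> : q' = q by apply: inj => //; rewrite Xq.
  by rewrite -surjective_pairing.
have l0 : lam ([set q.1] `*` [set q.2]) = 0%E.
  transitivity (@lebesgue_measure R [set q.1] * @lebesgue_measure R [set q.2])%E.
    exact: product_measure1E.
  by rewrite lebesgue_measure_set1 mul0e.
have mq : measurable ([set q.1] `*` [set q.2]) by exact: measurableX.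
rewrite (eq_integral (fun=> (area X q)%:E)); last first.
  by move=> [a b] /set_mem[/= -> ->]; rewrite -surjective_pairing.
transitivity ((area X q)%:E * lam ([set q.1] `*` [set q.2]))%E; last by rewrite l0 mule0.
exact: integral_cst.
Qed.

(** Points isolated in a compact set are finitely many, and a point has measure zero. *)
Lemma sigma_axis : sigma (M `&` axis) = 0%E.
Proof.
have cA : compact (M `&` axis) by apply: compact_closedI => //; exact: closed_axis.
have H p : exists V : set (R * R * R), (M `&` axis) p ->
    [/\ open V, V p & M `&` axis `&` V `<=` [set p]].
  have [[Mp Ap]|nMp] := pselect ((M `&` axis) p); last by exists setT.
  have [U [X [lX [q Uq Xq]]]] := reg Mp.
  have iso : \forall q' \near q, axis (X q') -> q' = q by apply: (axis_isolated lX Uq); rewrite Xq.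
  have [oU _ _ _ homeo] := lX.
  have oN : open ([set q' | axis (X q') -> q' = q]° `&` U) by apply: openI => //; exact: open_interior.
  have [V oV E] := homeo _ oN (@subIsetr _ _ _).
  exists V => _; split=> //.
    have : (M `&` V) p; last by case.
    by rewrite -E; exists q => //; split.
  move=> y [[My Ay] Vy]; have : (M `&` V) y by [].
  rewrite -E => -[q' [/interior_subset H Uq'] Xq'] /=.
  by rewrite -Xq -Xq' H// Xq'.
have [V VP] := choice H.
have cM2 : cover_compact (M `&` axis) by rewrite -(@compact_cover ((R * R * R)%type : normedModType R)).
have [] := cM2 _ (M `&` axis) V.
- by move=> p /VP[].
- by move=> p Ap; exists p => //; have [] := VP p Ap.
move=> D sD cD.
have sD' y : (M `&` axis) y -> y \in finmap.enum_fset D.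
  move=> Ay; have [p /= pD Vy] := cD y Ay.
  have Ap := set_mem (sD _ pD).
  by have [_ _ H'] := VP p Ap; rewrite (H' y (conj Ay Vy)).
have mA : measurable (M `&` axis) by exact: compact_measurable3.
have m1 (p : R * R * R) : measurable [set p].
  by apply: closed_measurable3; apply: compact_closed; [exact: norm_hausdorff|exact: compact_set1].
have fin (l : seq (R * R * R)) (A : set (R * R * R)) : measurable A -> A `<=` M ->
    (forall y, A y -> y \in l) -> sigma A = 0%E.
  elim: l A => [|p l IH] A mA' AM Al.
    by have -> : A = set0 by [apply/seteqP; split=> // y /Al|]; rewrite measure0.
  have mAp : measurable (A `&` [set p]) by exact: measurableI.
  have mAD : measurable (A `\` [set p]) by exact: measurableD.
  have dis : (A `&` [set p]) `&` (A `\` [set p]) = set0.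
    by rewrite -setIA (setIC [set p]) setDE -setIA setICl !setI0.
  have zD : sigma (A `\` [set p]) = 0%E.
    apply: IH => // y [Ay nyp]; first exact: AM.
    by have := Al y Ay; rewrite inE => /predU1P[yp|//]; exfalso; apply: nyp.
  have : sigma A = (sigma (A `&` [set p]) + sigma (A `\` [set p]))%E.
    by rewrite -[in LHS](setUIDK A [set p]); exact: measureU.
  rewrite zD => ->.
  rewrite adde0; have [Ap|nAp] := pselect (A p).
    exact: (subset_measure0 mAp (m1 p) (@subIsetr _ _ _) (sigma_point (AM _ Ap))).
  by have -> : A `&` [set p] = set0 by [apply/seteqP; split=> // y [Ay yp]; apply: nAp; rewrite -yp|]; rewrite measure0.
by apply: (fin (finmap.enum_fset D)) => // y [].
Qed.

End RotationField.

(** * Functions of the zonal coordinate *)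

Section OneVariable.
Context (R : realType).

Lemma local_inverse (th dth : R -> R) :
  (\forall t \near (0 : R), is_derive t (1 : R) th (dth t)) ->
  {for 0, continuous dth} -> 0 < dth 0 -> exists g : R -> R, {near (0 : R), cancel th g}.
Proof.
move=> dthE cdth dth0.
have npos : \forall t \near (0 : R), 0 < dth t by exact: (cvgr_gt _ cdth).
have [e /= e0 eP] : \forall t \near (0 : R), is_derive t (1 : R) th (dth t) /\ 0 < dth t.
  by near=> t; split; near: t.
pose d := e / 2; have d0 : 0 < d by rewrite divr_gt0.
have inE t : `|t| <= d -> is_derive t (1 : R) th (dth t) /\ 0 < dth t.
  move=> td; apply: eP; rewrite /ball_ /= sub0r normrN; apply: le_lt_trans td _.
  by rewrite /d ltr_pdivrMr// ltr_pMr// ltr1n.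
have lt_th x y : - d <= x -> x < y -> y <= d -> th x < th y.
  apply: gtr0_derive1_incr => [z|z|].
  - by rewrite in_itv /= => /andP[z1 z2]; have [|[]] := inE z; first by rewrite ler_norml !ltW.
  - rewrite in_itv /= => /andP[z1 z2]; have [|[_ E] p] := inE z; first by rewrite ler_norml !ltW.
    by rewrite derive1E E.
  - apply: derivable_within_continuous => z; rewrite in_itv /= => /andP[z1 z2].
    by have [|[]] := inE z; first by rewrite ler_norml z1.
exists (fun y => xget 0 [set t | `|t| <= d /\ th t = y]).
near=> t; have td : `|t| <= d.
  by rewrite ltW//; near: t; apply: nbhs0_lt.
have [sd E] : [set s | `|s| <= d /\ th s = th t] (xget 0 [set s | `|s| <= d /\ th s = th t]).
  by apply: (@xgetI _ _ _ t).
set s := xget _ _ in sd E *.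
move: td sd; rewrite !ler_norml => /andP[t1 t2] /andP[s1 s2].
have [st|ts|//] := ltgtP s t.
  by have := lt_th _ _ s1 st t2; rewrite E ltxx.
by have := lt_th _ _ t1 ts s2; rewrite E ltxx.
Unshelve. all: by end_near. Qed.

(** Only the composite [F \o th] is known to be differentiable; since [th] is strictly increasing near
zero, [F] is the composite of it with a differentiable inverse of [th]. *)
Lemma derivable_through (F th dth : R -> R) :
  (\forall t \near (0 : R), is_derive t (1 : R) th (dth t)) ->
  {for 0, continuous dth} -> 0 < dth 0 -> derivable (F \o th) 0 1 -> derivable F (th 0) 1.
Proof.
move=> dthE cdth dth0 dF; have [g gK] := local_inverse dthE cdth dth0.
have cth : {near (0 : R), continuous th}.
  apply: filterS dthE => t [dt _]; apply/differentiable_continuous/derivable1_diffP.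
  exact: dt.
have [dg _] := is_derive_inverse gK cth (nbhs_singleton dthE) (lt0r_neq0 dth0).
have thK := near_continuous_can_sym cth gK.
have g0 : g (th 0) = 0 := nbhs_singleton gK.
have E : \forall y \near th 0, ((F \o th) \o g) y = F y by apply: filterS thK => y /= ->.
apply: near_eq_derivable E _; apply/derivable1_diffP; apply: differentiable_comp.
  exact/derivable1_diffP.
by rewrite g0; exact/derivable1_diffP.
Qed.

End OneVariable.

Section OffAxis.
Context (R : realType) (M : set (R * R * R)).
Implicit Types (u v phi h kappa : R * R * R -> R) (U : set (R * R)) (X : R * R -> R * R * R).

Definition axis_dist2 (p : R * R * R) : R := px p ^+ 2 + py p ^+ 2.

Definition off_axis : set (R * R * R) := M `&` [set p | 0 < axis_dist2 p].
Local Notation M0 := off_axis.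

Lemma axis_dist2_ge0 p : 0 <= axis_dist2 p.
Proof. by rewrite addr_ge0 ?sqr_ge0. Qed.

Lemma off_axisE : M0 = M `\` @axis R.
Proof.
apply/seteqP; split=> p [Mp H]; split=> //.
  by move=> [x0 y0]; move: H; rewrite /= /axis_dist2 x0 y0 expr0n addr0 ltxx.
rewrite /= lt0r axis_dist2_ge0 andbT; apply/eqP => /eqP.
by rewrite paddr_eq0 ?sqr_ge0// !sqrf_eq0 => /andP[/eqP x0 /eqP y0]; apply: H.
Qed.

Lemma axis_dist2_continuous : continuous axis_dist2.
Proof.
move=> p; apply: cvgD; rewrite expr2; under eq_fun do rewrite expr2.
  by apply: cvgM; exact: px_continuous.
by apply: cvgM; exact: py_continuous.
Qed.

Lemma open_axis_dist2 (c : R) : open [set p : R * R * R | c < axis_dist2 p].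
Proof.
have -> : [set p : R * R * R | c < axis_dist2 p] = axis_dist2 @^-1` [set x | c < x] by [].
by apply: open_comp => [p _|]; [exact: axis_dist2_continuous|exact: open_gt].
Qed.

Lemma smooth_on_axis_dist2 M' : smooth_on M' axis_dist2.
Proof.
have [sx sy _] := smooth_on_coord M'.
exact: smooth_onD (smooth_onM sx sx) (smooth_onM sy sy).
Qed.

Lemma local_param_off U X : local_param M0 U X -> local_param M U X.
Proof.
move=> [oU sX n0 inj homeo]; split=> // U' oU' sU'; have [V oV E] := homeo U' oU' sU'.
exists ([set p | 0 < axis_dist2 p] `&` V); first by apply: openI => //; exact: open_axis_dist2.
by rewrite E /off_axis setIA.
Qed.

Lemma smooth_on_off (W : normedModType R) (u : R * R * R -> W) : smooth_on M u -> smooth_on M0 u.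
Proof. by move=> su U X /local_param_off; exact: su. Qed.

Lemma local_param_restrict U X : local_param M U X ->
  local_param M0 (U `&` X @^-1` [set p | 0 < axis_dist2 p]) X.
Proof.
move=> [oU sX n0 inj homeo].
have oU0 : open (U `&` X @^-1` [set p | 0 < axis_dist2 p]).
  rewrite openE => q [Uq q0]; apply: filterI; first exact: open_nbhs_nbhs.
  have cX := smooth_in_continuous sX Uq; apply: cX.
  by apply: open_nbhs_nbhs; split=> //; exact: open_axis_dist2.
split=> //.
- by apply: smooth_inS sX => q [].
- by move=> q [/n0].
- by move=> q q' [Uq _] [Uq' _]; exact: inj.
- move=> U' oU' sU'; have sU : U' `<=` U by move=> q /sU'[].
  have [V oV E] := homeo U' oU' sU; exists V => //.
  apply/seteqP; split=> [p [q U'q <-]|p].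
    have : (M `&` V) (X q) by rewrite -E; exists q.
    by move=> [MX VX]; split=> //; split=> //; have [] := sU' _ U'q.
  by move=> [[Mp _] Vp]; rewrite E.
Qed.

Lemma regular_off_axis : regular_surface M -> regular_surface M0.
Proof.
move=> reg p [Mp p0]; have [U [X [lX [q Uq Xq]]]] := reg p Mp.
exists (U `&` X @^-1` [set p | 0 < axis_dist2 p]), X; split; first exact: local_param_restrict.
by exists q => //; split=> //=; rewrite Xq.
Qed.

(** The coefficients of the operator may be singular on the axis; a cutoff near the axis makes them
usable as factors of test functions. *)
Lemma smooth_on_cutoff kappa u (c : R) : 0 < c -> smooth_on M kappa ->
  (forall p, axis_dist2 p <= c -> kappa p = 0) -> smooth_on M0 u ->
  smooth_on M (fun p => kappa p * u p).
Proof.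
move=> c0 sk k0 su U X lX; have oU := local_param_open lX.
have sX : smooth_in U X by case: lX.
apply: smooth_in_local => q Uq; have [q0|q0] := ltP 0 (axis_dist2 (X q)).
  have l0 := local_param_restrict lX.
  exists (U `&` X @^-1` [set p | 0 < axis_dist2 p]), (fun q => kappa (X q) * u (X q)).
  split=> //; first exact: local_param_open l0.
  exact: smooth_inM (local_param_open l0) (smooth_on_off sk l0) (su _ _ l0).
have sd : smooth_in U (axis_dist2 \o X) := smooth_on_axis_dist2 lX.
exists (U `&` (axis_dist2 \o X) @^-1` [set x | x < c]), (fun=> 0); split.
- rewrite openE => q' [Uq' q'c]; apply: filterI; first exact: open_nbhs_nbhs.
  apply: (smooth_in_continuous sd Uq'); apply: open_nbhs_nbhs; split=> //; exact: open_lt.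
- by split=> //=; exact: le_lt_trans q0 c0.
- exact: smooth_in_cst.
- by move=> q' [Uq' q'c] /=; rewrite k0 ?mul0r// ltW.
Qed.

End OffAxis.

Lemma dot_comb (R : realType) (n u v : R * R * R) (a b : R) :
  dot n (a *: u + b *: v) = a * dot n u + b * dot n v.
Proof. by rewrite dotDr !dotZr. Qed.

Lemma dot_comb_eq (R : realType) (n u v : R * R * R) (a b c d : R) :
  dot n u = c -> dot n v = d -> dot n (a *: u + b *: v) = a * c + b * d.
Proof. by move=> <- <-; exact: dot_comb. Qed.

Section Zonal.
Context (R : realType) (M : set (R * R * R)).
Implicit Types (u v phi h : R * R * R -> R) (U : set (R * R)) (X : R * R -> R * R * R).
Local Notation M0 := (off_axis M).
Context (nu : R * R * R -> R * R * R) (xi : R * R * R -> R) (grad_xi : R * R * R -> R * R * R).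
Hypotheses (reg : regular_surface M) (Mrot : rotation_symmetric M).
Hypothesis nuN : forall U X, local_param M U X -> forall q, U q ->
     [/\ dot (nu (X q)) (nu (X q)) = 1, dot (nu (X q)) (du X q) = 0 & dot (nu (X q)) (dv X q) = 0].
Hypothesis xi_smooth : smooth_on M xi.
Hypothesis grad_xiE : is_gradient M xi grad_xi.
Hypothesis J_grad_xi : forall p, M p -> cross (nu p) (grad_xi p) = - X3_vec p.

(** A rotation by a right angle in the tangent plane preserves lengths: |grad xi| = |X3_vec| is the
distance to the axis. *)
Lemma nu_grad p : M p -> [/\ dot (nu p) (nu p) = 1, dot (nu p) (grad_xi p) = 0 &
  dot (grad_xi p) (grad_xi p) = axis_dist2 p].
Proof.
move=> Mp; have [U [X [lX [q Uq Xq]]]] := reg Mp; rewrite -Xq.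
have [n1 nu_u nu_v] := nuN lX Uq.
have [[a [b gE]] _ _] := grad_xiE lX Uq.
have ng : dot (nu (X q)) (grad_xi (X q)) = 0 by rewrite gE (dot_comb_eq a b nu_u nu_v) !mulr0 addr0.
split=> //; have := lagrange (nu (X q)) (grad_xi (X q)).
rewrite J_grad_xi; last exact: chart_sub lX Uq.
rewrite n1 ng expr0n subr0 mul1r => <-.
by rewrite /dot /X3_vec /axis_dist2 /px /py /=; ring.
Qed.

(** The gradient is obtained from the rotation field by a right-angle rotation, so that the two are
orthogonal. *)
Lemma X3_xi p : M p -> X3 xi p = 0.
Proof.
move=> Mp; have [U [X [lX [q Uq Xq]]]] := reg Mp; rewrite -Xq.
have [tE -> _ _] := X3_chart Mrot lX Uq xi_smooth.
have [_ <- <-] := grad_xiE lX Uq; rewrite -dot_comb.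
rewrite -/(tangent X q (tcoord X q (X3_vec (X q)))) tE.
rewrite -[X3_vec _]opprK -J_grad_xi; last exact: chart_sub lX Uq.
by rewrite /dot /cross /=; ring.
Qed.

Lemma xi_rot t p : M p -> xi (rot t p) = xi p.
Proof.
move=> Mp; rewrite -[in RHS](rot0 p).
apply: (@is_derive_0_is_cst _ (fun t => xi (rot t p))) => s.
by have := is_derive_rot reg Mrot s Mp xi_smooth; rewrite (X3_xi (Mrot s Mp)).
Qed.

Lemma dxi_gt0 U X q : local_param M0 U X -> U q ->
  0 < du (xi \o X) q ^+ 2 + dv (xi \o X) q ^+ 2.
Proof.
move=> lX0 Uq; have lX := local_param_off lX0.
rewrite lt0r addr_ge0 ?sqr_ge0// andbT; apply/eqP => /eqP.
rewrite paddr_eq0 ?sqr_ge0// !sqrf_eq0 => /andP[/eqP xu /eqP xv].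
have [_ /= r0] := chart_sub lX0 Uq.
have [[a [b gE]] gu gv] := grad_xiE lX Uq.
have [_ _] := nu_grad (chart_sub lX Uq).
rewrite xu in gu; rewrite xv in gv.
rewrite {2}gE (dot_comb_eq a b gu gv) !mulr0 addr0 => r00.
by move: r0; rewrite -r00 ltxx.
Qed.

Lemma near_line U (f : R * R -> R) (q w : R * R) : open U -> U q -> smooth_in U f ->
  \forall t \near (0 : R), U (t *: w + q) /\
    is_derive t (1 : R) (fun t => f (t *: w + q)) ('D_w f (t *: w + q)).
Proof.
move=> oU Uq sf.
have cl : {for (0 : R), continuous (fun t : R => t *: w + q)}.
  by apply: cvgD; [apply: cvgZr_tmp; exact: cvg_id|exact: cvg_cst].
have nU : \forall t \near (0 : R), U (t *: w + q).
  by apply: cl; rewrite /= scale0r add0r; exact: open_nbhs_nbhs.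
apply: filterS nU => t Ut; split=> //.
have df := smooth_in_differentiable sf Ut.
have E : (fun h : R => h^-1 *: (((fun t => f (t *: w + q)) \o shift t) (h *: 1) - f (t *: w + q)))
  = (fun h : R => h^-1 *: ((f \o shift (t *: w + q)) (h *: w) - f (t *: w + q))).
  by apply/funext => h /=; rewrite [_%:A]mulr1 scalerDl addrA.
have dw : derivable f (t *: w + q) w by exact: diff_derivable.
by apply: DeriveDef; [rewrite /derivable E|rewrite /derive E].
Qed.

(** Off the axis xi is strictly increasing along its gradient. On such a line [F \o xi] is smooth, and
inverting xi there makes [F] differentiable. *)
Lemma zonal_derive (F : R -> R) U X q : local_param M0 U X -> U q -> smooth_on M0 (F \o xi) ->
  derivable F (xi (X q)) 1 /\
  forall w, 'D_w ((F \o xi) \o X) q = F^`()%classic (xi (X q)) * 'D_w (xi \o X) q.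
Proof.
move=> lX Uq sF; have oU := local_param_open lX.
have sxi : smooth_in U (xi \o X) := smooth_on_off xi_smooth lX.
have sFX : smooth_in U ((F \o xi) \o X) := sF _ _ lX.
(* along its coordinate gradient, xi has a positive derivative *)
pose w : R * R := (du (xi \o X) q, dv (xi \o X) q).
have Dw : 'D_w (xi \o X) q = du (xi \o X) q ^+ 2 + dv (xi \o X) q ^+ 2.
  have dxi := smooth_in_differentiable sxi Uq.
  by rewrite deriveE// diff2E// !expr2.
have l0 : 0 *: w + q = q by rewrite scale0r add0r.
have dF : derivable F (xi (X q)) 1.
  have n1 := near_line w oU Uq sxi; have n2 := near_line w oU Uq sFX.
  have := @derivable_through _ F (fun t => (xi \o X) (t *: w + q)) (fun t => 'D_w (xi \o X) (t *: w + q)).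
  rewrite l0; apply.
  - by apply: filterS n1 => t [].
  - have cD : {for q, continuous (fun q => 'D_w (xi \o X) q)}.
      exact: smooth_in_continuous (smooth_in_derive w sxi) Uq.
    have cl : {for (0 : R), continuous (fun t : R => t *: w + q)}.
      by apply: cvgD; [apply: cvgZr_tmp; exact: cvg_id|exact: cvg_cst].
    have cD' : {for ((fun t : R => t *: w + q) 0), continuous (fun q => 'D_w (xi \o X) q)} by rewrite l0.
    exact: (continuous_comp cl cD').
  - by rewrite Dw; exact: dxi_gt0 lX Uq.
  - by have [_ []] := nbhs_singleton n2.
split=> // k; have H : is_derive ((xi \o X) q) (1 : R) F (F^`()%classic (xi (X q))).
  by apply: DeriveDef => //; rewrite derive1E.
exact: (derive_comp1 k H (smooth_in_differentiable sxi Uq)).2.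
Qed.

Lemma smooth_on_zonal_derive (F : R -> R) : smooth_on M0 (F \o xi) -> smooth_on M0 (F^`()%classic \o xi).
Proof.
move=> sF U X lX; have oU := local_param_open lX.
have sxi : smooth_in U (xi \o X) := smooth_on_off xi_smooth lX.
have sFX : smooth_in U ((F \o xi) \o X) := sF _ _ lX.
have x1 := smooth_in_derive ((1, 0) : R * R) sxi; have x2 := smooth_in_derive ((0, 1) : R * R) sxi.
have f1 := smooth_in_derive ((1, 0) : R * R) sFX; have f2 := smooth_in_derive ((0, 1) : R * R) sFX.
have sN := smooth_inD oU (smooth_inM oU x1 f1) (smooth_inM oU x2 f2).
have sD := smooth_inD oU (smooth_inM oU x1 x1) (smooth_inM oU x2 x2).
have D0 (q : R * R) : U q -> 'D_(1, 0) (xi \o X) q * 'D_(1, 0) (xi \o X) q + 'D_(0, 1) (xi \o X) q * 'D_(0, 1) (xi \o X) q != 0.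
  by move=> Uq; rewrite -!expr2 gt_eqF//; exact: dxi_gt0 lX Uq.
apply: (smooth_in_eq oU _ (smooth_inM oU sN (smooth_inV oU sD D0))) => q Uq.
have [_ E] := zonal_derive lX Uq sF; rewrite !E.
have := D0 q Uq; move: ('D__ _ q) ('D__ _ q) => a b d0.
rewrite -[RHS]/(F^`()%classic (xi (X q))); move: (F^`()%classic _) => f'.
by field.
Qed.

(** An extremal point of xi is a critical point, and these lie on the axis. *)
Lemma xi_interior (alpha0 alpha1 : R) p : M0 p -> (forall p, M p -> alpha0 <= xi p) ->
  (forall p, M p -> xi p <= alpha1) -> alpha0 < xi p < alpha1.
Proof.
move=> M0p lo hi; have [Mp _] := M0p; have [U [X [lX [q Uq Xq]]]] := regular_off_axis reg M0p.
have sxi : smooth_in U (xi \o X) := smooth_on_off xi_smooth lX.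
have oU := local_param_open lX.
pose w : R * R := (du (xi \o X) q, dv (xi \o X) q).
have Dw : 'D_w (xi \o X) q = du (xi \o X) q ^+ 2 + dv (xi \o X) q ^+ 2.
  have dxi := smooth_in_differentiable sxi Uq.
  by rewrite deriveE// diff2E// !expr2.
have l0 : 0 *: w + q = q by rewrite scale0r add0r.
have [e /= e0 eP] := near_line w oU Uq sxi.
have itv t : t \in `]- e, e[ -> U (t *: w + q) /\
    is_derive t (1 : R) (fun t => (xi \o X) (t *: w + q)) ('D_w (xi \o X) (t *: w + q)).
  by rewrite in_itv /= => te; apply: eP; rewrite /ball_ /= sub0r normrN ltr_norml.
have i0 : (0 : R) \in `]- e, e[ by rewrite in_itv /= oppr_lt0 e0.
have ee : - e <= e by rewrite ge0_cp // ltW.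
have dpos := dxi_gt0 lX Uq.
have XM t : t \in `]- e, e[ -> M (X (t *: w + q)).
  by move=> /itv[Ut _]; exact: chart_sub (local_param_off lX) Ut.
pose th (t : R) : R := (xi \o X) (t *: w + q).
have dth t : t \in `]- e, e[ -> derivable th t 1 by move=> /itv[_ []].
have th0 : th 0 = xi p by rewrite /th l0 /= Xq.
have Dth : 'D_1 th 0 = du (xi \o X) q ^+ 2 + dv (xi \o X) q ^+ 2.
  by have [_ [_ E]] := itv _ i0; rewrite [LHS]E l0.
apply/andP; split; rewrite lt_neqAle ?lo ?hi// andbT; apply/eqP => E.
  have thlo t : t \in `]- e, e[ -> th 0 <= th t by rewrite th0 -E => te; exact: lo (XM t te).
  have [_ E1] := derive1_at_min ee dth i0 thlo.
  by move: dpos; rewrite -Dth E1 ltxx.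
have thhi t : t \in `]- e, e[ -> th t <= th 0 by rewrite th0 E => te; exact: hi (XM t te).
have [_ E1] := derive1_at_max ee dth i0 thhi.
by move: dpos; rewrite -Dth E1 ltxx.
Qed.

(** The vector product of grad xi with nu x grad xi = - X3_vec recovers nu |grad xi|^2. Its vertical
component expresses chi r^2 through the horizontal derivatives of xi, where r is the distance to the
axis. *)
Lemma smooth_on_chi (chi : R -> R) : (forall p, M p -> chi (xi p) = dot (@e3 R) (nu p)) ->
  smooth_on M0 (chi \o xi).
Proof.
move=> chiE U X lX0; have lX := local_param_off lX0; have oU := local_param_open lX.
have sX : smooth_in U X by case: lX.
have [sE sF sG sD] := smooth_in_metric lX.
have sxi := xi_smooth lX.
have x1 := smooth_in_derive ((1, 0) : R * R) sxi; have x2 := smooth_in_derive ((0, 1) : R * R) sxi.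
have [sx sy _] := smooth_in_coord oU sX.
have [ux uy _] := smooth_in_coord oU (smooth_in_derive ((1, 0) : R * R) sX).
have [vx vy _] := smooth_in_coord oU (smooth_in_derive ((0, 1) : R * R) sX).
have D0 q : U q -> metdet X q != 0.
  by move=> Uq; rewrite gt_eqF// metdet_gt0//; case: lX => _ _ n0 _ _; exact: n0.
have sDV := smooth_inV oU sD D0.
have sr : smooth_in U (@axis_dist2 R \o X) := smooth_on_axis_dist2 lX.
have r0 q : U q -> (@axis_dist2 R \o X) q != 0.
  by move=> Uq; have [_ /= H] := chart_sub lX0 Uq; rewrite gt_eqF.
have sA := smooth_inM oU (smooth_inB oU (smooth_inM oU sG x1) (smooth_inM oU sF x2)) sDV.
have sB := smooth_inM oU (smooth_inB oU (smooth_inM oU sE x2) (smooth_inM oU sF x1)) sDV.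
have s1 := smooth_inM oU sA (smooth_inD oU (smooth_inM oU ux sx) (smooth_inM oU uy sy)).
have s2 := smooth_inM oU sB (smooth_inD oU (smooth_inM oU vx sx) (smooth_inM oU vy sy)).
apply: (smooth_in_eq oU _ (smooth_inM oU (smooth_inN oU (smooth_inD oU s1 s2)) (smooth_inV oU sr r0))) => q Uq.
have Mq := chart_sub lX Uq.
rewrite -[RHS]/(chi (xi (X q))) chiE//.
have [[a [b gE]] gu gv] := grad_xiE lX Uq.
have [n1 ng gg] := nu_grad Mq.
have ab : (a, b) = tcoord X q (grad_xi (X q)) by rewrite gE -[X in tcoord _ _ X]/(tangent X q (a, b)) tcoordK// D0.
move: ab; rewrite (tcoord_eq gu gv) => -[aE bE].
have nz : dot (@e3 R) (nu (X q)) * axis_dist2 (X q)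
    = - (px (grad_xi (X q)) * px (X q) + py (grad_xi (X q)) * py (X q)).
  have triple (n g : R * R * R) : dot (@e3 R) n * dot g g
      = dot (@e3 R) (cross g (cross n g)) + pz g * dot n g.
    by rewrite /dot /cross /e3 /pz /=; ring.
  rewrite -gg triple ng mulr0 addr0 J_grad_xi//.
  by rewrite /dot /cross /e3 /X3_vec /px /py /=; ring.
apply: (mulIf (r0 q Uq)); rewrite [RHS]nz divfK ?r0//.
have -> : px (grad_xi (X q)) = a * px (du X q) + b * px (dv X q) by rewrite gE.
have -> : py (grad_xi (X q)) = a * py (du X q) + b * py (dv X q) by rewrite gE.
rewrite aE bE /= .
rewrite -!/(du _ q) -!/(dv _ q).
move: (du X q) (dv X q) (X q) (du (xi \o X) q) (dv (xi \o X) q) => w1 w2 p d1 d2.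
move: (metE X q) (metF X q) (metG X q) (metdet X q)^-1 => e f g d; ring.
Qed.

End Zonal.

(** * Square integrable functions *)

Section SquareIntegrable.
Context (R : realType) (M : set (R * R * R)).
Context (sigma : {measure set (R * R * R) -> \bar R}).
Implicit Types (u v w phi g : R * R * R -> R).
Hypotheses (mM : measurable M) (fM : (sigma M < +oo)%E).
Local Notation L2 := (L2 M sigma).

Definition ip u v : R := \int[sigma]_(p in M) (u p * v p).
Definition nrm u : R := Num.sqrt (ip u u).

Lemma L2M u v : L2 u -> L2 v -> sigma.-integrable M (EFin \o (fun p => u p * v p)).
Proof.
move=> [mu iu] [mv iv].
apply: (le_integrable mM _ _ (integrableD mM iu iv)).
  by apply/measurable_EFinP; exact: measurable_funM.
move=> p Mp /=; rewrite lee_fin normrM [leRHS]ger0_norm ?addr_ge0 ?sqr_ge0//.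
rewrite -(real_normK (num_real (u p))) -(real_normK (num_real (v p))).
move: (`|u p|) (`|v p|) (normr_ge0 (u p)) (normr_ge0 (v p)) => a b a0 b0.
have := sqr_ge0 (a - b); have := mulr_ge0 a0 b0; rewrite sqrrB; lra.
Qed.

Lemma L2_bounded_mul g u (C : R) : measurable_fun M g -> (forall p, M p -> `|g p| <= C) -> L2 u ->
  L2 (fun p => g p * u p).
Proof.
move=> mg gC [mu iu]; split; first exact: measurable_funM.
apply: (le_integrable mM _ _ (integrableZl mM (C ^+ 2) iu)).
  by apply/measurable_EFinP; apply: measurable_funX; exact: measurable_funM.
move=> p Mp /=; rewrite lee_fin exprMn !(ger0_norm (mulr_ge0 (sqr_ge0 _) (sqr_ge0 _))).
apply: ler_wpM2r; first exact: sqr_ge0.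
rewrite -(real_normK (num_real (g p))).
by rewrite lerXn2r ?nnegrE ?gC//; exact: le_trans (gC p Mp).
Qed.

Lemma L2_bounded u (C : R) : measurable_fun M u -> (forall p, M p -> `|u p| <= C) -> L2 u.
Proof.
move=> mu uC; split=> //; apply: measurable_bounded_integrable => //.
  exact: measurable_funX.
exists (C ^+ 2); split; rewrite ?num_real// => x Cx p Mp /=.
apply: le_trans (ltW Cx); rewrite normrX lerXn2r ?nnegrE//; last exact: uC.
exact: le_trans (uC p Mp).
Qed.

Lemma L2Z (a : R) u : L2 u -> L2 (fun p => a * u p).
Proof. by apply: (@L2_bounded_mul (fun=> a) u `|a|) => //; exact: measurable_cst. Qed.

Lemma L2D u v : L2 u -> L2 v -> L2 (fun p => u p + v p).
Proof.
move=> [mu iu] [mv iv]; split; first exact: measurable_funD.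
have i2 : sigma.-integrable M (EFin \o (fun p => 2 * (u p) ^+ 2 + 2 * (v p) ^+ 2)).
  have := integrableD mM (integrableZl mM 2 iu) (integrableZl mM 2 iv).
  by apply: eq_integrable => // p _ /=; rewrite EFinD !EFinM.
apply: (le_integrable mM _ _ i2).
  by apply/measurable_EFinP; apply: measurable_funX; exact: measurable_funD.
move=> p Mp /=; rewrite lee_fin !ger0_norm ?sqr_ge0//; last first.
  by rewrite addr_ge0// mulr_ge0// sqr_ge0.
by rewrite -subr_ge0 (_ : _ - _ = (u p - v p) ^+ 2) ?sqr_ge0//; ring.
Qed.

Lemma L2N u : L2 u -> L2 (fun p => - u p).
Proof.
by move=> /(L2Z (-1)); under eq_fun do rewrite mulN1r.
Qed.

Lemma L2B u v : L2 u -> L2 v -> L2 (fun p => u p - v p).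
Proof. by move=> Lu Lv; apply: L2D => //; exact: L2N. Qed.

Lemma ipC u v : ip u v = ip v u.
Proof. by apply: eq_Rintegral => p _; rewrite mulrC. Qed.

Lemma eq_ip u v u' v' : (forall p, M p -> u p = u' p) -> (forall p, M p -> v p = v' p) ->
  ip u v = ip u' v'.
Proof. by move=> uu vv; apply: eq_Rintegral => p /set_mem Mp; rewrite uu// vv. Qed.

Lemma ipDl u v w : L2 u -> L2 v -> L2 w -> ip (fun p => u p + v p) w = ip u w + ip v w.
Proof.
move=> Lu Lv Lw; rewrite /ip -RintegralD//; [|exact: L2M..].
by apply: eq_Rintegral => p _; rewrite mulrDl.
Qed.

Lemma ipZl (a : R) u w : L2 u -> L2 w -> ip (fun p => a * u p) w = a * ip u w.
Proof.
move=> Lu Lw; rewrite /ip -RintegralZl//; last exact: L2M.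
by apply: eq_Rintegral => p _; rewrite mulrA.
Qed.

Lemma ipBl u v w : L2 u -> L2 v -> L2 w -> ip (fun p => u p - v p) w = ip u w - ip v w.
Proof.
move=> Lu Lv Lw; rewrite /ip -RintegralB//; [|exact: L2M..].
by apply: eq_Rintegral => p _; rewrite mulrBl.
Qed.

Lemma ipDr u v w : L2 u -> L2 v -> L2 w -> ip w (fun p => u p + v p) = ip w u + ip w v.
Proof. by move=> Lu Lv Lw; rewrite ipC ipDl// !(ipC w). Qed.

Lemma ipBr u v w : L2 u -> L2 v -> L2 w -> ip w (fun p => u p - v p) = ip w u - ip w v.
Proof. by move=> Lu Lv Lw; rewrite ipC ipBl// !(ipC w). Qed.

Lemma ipZr (a : R) u w : L2 u -> L2 w -> ip w (fun p => a * u p) = a * ip w u.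
Proof. by move=> Lu Lw; rewrite ipC ipZl// (ipC w). Qed.

Lemma ip_ge0 u : 0 <= ip u u.
Proof. by apply: Rintegral_ge0 => p _; rewrite -expr2 sqr_ge0. Qed.

Lemma nrm_ge0 u : 0 <= nrm u. Proof. exact: sqrtr_ge0. Qed.

Lemma sqr_nrm u : nrm u ^+ 2 = ip u u.
Proof. by rewrite /nrm sqr_sqrtr// ip_ge0. Qed.

Lemma quadratic_CS (a b c : R) : 0 <= a -> 0 <= c -> (forall s, 0 <= a + 2 * s * b + s ^+ 2 * c) ->
  b ^+ 2 <= a * c.
Proof.
move=> a0 c0 H; have [c_eq|c_neq] := eqVneq c 0.
  rewrite c_eq mulr0; have [->|b0] := eqVneq b 0; first by rewrite expr0n.
  have := H (- (a + 1) / (2 * b)); rewrite c_eq mulr0 addr0.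
  have -> : 2 * (- (a + 1) / (2 * b)) * b = - (a + 1) by field.
  lra.
have cp : 0 < c by rewrite lt0r c_neq.
have := H (- b / c); have -> : a + 2 * (- b / c) * b + (- b / c) ^+ 2 * c = (a * c - b ^+ 2) / c by field.
by rewrite pmulr_lge0 ?invr_gt0// subr_ge0.
Qed.

Lemma ip_CS u v : L2 u -> L2 v -> `|ip u v| <= nrm u * nrm v.
Proof.
move=> Lu Lv; rewrite -sqrtr_sqr /nrm -sqrtrM ?ip_ge0//; apply: ler_wsqrtr.
apply: quadratic_CS; [exact: ip_ge0|exact: ip_ge0|move=> s].
have := ip_ge0 (fun p => u p + s * v p).
have Lsv := L2Z s Lv.
rewrite ipDl ?ipDr ?ipZl ?ipZr//; try exact: L2D.
by rewrite (ipC v u) => /le_trans; apply; rewrite le_eqVlt; apply/orP; left; apply/eqP; ring.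
Qed.

Lemma nrmD u v : L2 u -> L2 v -> nrm (fun p => u p + v p) <= nrm u + nrm v.
Proof.
move=> Lu Lv; rewrite -(@ler_pXn2r _ 2)// ?nnegrE ?addr_ge0 ?nrm_ge0//.
rewrite sqrrD !sqr_nrm ipDl ?ipDr//; last exact: L2D.
have := ip_CS Lu Lv; rewrite (ipC v u) => /(le_trans (ler_norm _)); lra.
Qed.

Lemma nrmZ (a : R) u : L2 u -> nrm (fun p => a * u p) = `|a| * nrm u.
Proof.
move=> Lu; have La := L2Z a Lu.
by rewrite /nrm ipZl// ipZr// mulrA -expr2 sqrtrM ?sqr_ge0// sqrtr_sqr.
Qed.

Lemma nrmN u : nrm (fun p => - u p) = nrm u.
Proof. by rewrite /nrm; congr Num.sqrt; apply: eq_Rintegral => p _; rewrite mulrNN. Qed.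

Lemma nrmB u v : L2 u -> L2 v -> nrm (fun p => u p - v p) <= nrm u + nrm v.
Proof. by move=> Lu Lv; apply: le_trans (nrmD Lu (L2N Lv)) _; rewrite nrmN. Qed.

Lemma nrm_distC u v : nrm (fun p => u p - v p) = nrm (fun p => v p - u p).
Proof.
by rewrite /nrm; congr Num.sqrt; apply: eq_Rintegral => p _; rewrite -mulrNN !opprB.
Qed.

Lemma nrm_dist_trans u v w : L2 u -> L2 v -> L2 w ->
  nrm (fun p => u p - w p) <= nrm (fun p => u p - v p) + nrm (fun p => v p - w p).
Proof.
move=> Lu Lv Lw; apply: le_trans (nrmD (L2B Lu Lv) (L2B Lv Lw)).
rewrite le_eqVlt; apply/orP; left; apply/eqP; rewrite /nrm; congr Num.sqrt.
by apply: eq_ip => p _; rewrite addrA subrK.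
Qed.

Lemma le_nrm u v : L2 u -> L2 v -> (forall p, M p -> `|u p| <= `|v p|) -> nrm u <= nrm v.
Proof.
move=> Lu Lv uv; apply: ler_wsqrtr; apply: le_Rintegral => //; [exact: L2M|exact: L2M|].
by move=> p Mp; rewrite -!expr2 -(real_normK (num_real (u p))) -(real_normK (num_real (v p))) lerXn2r ?nnegrE ?uv.
Qed.

Lemma nrm_bounded u (C : R) : measurable_fun M u -> 0 <= C -> (forall p, M p -> `|u p| <= C) ->
  nrm u <= C * nrm (fun=> 1).
Proof.
move=> mu C0 uC; have L1 : L2 (fun=> 1 : R).
  by apply: (@L2_bounded _ 1) => [|p _]; [exact: measurable_cst|rewrite normr1].
rewrite -{1}(ger0_norm C0) -nrmZ//; apply: le_nrm; [exact: L2_bounded uC|exact: L2Z|].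
by move=> p Mp; rewrite mulr1 (ger0_norm C0) uC.
Qed.

Lemma L2_cvg_nrm (u_ : nat -> R * R * R -> R) u : (forall n, L2 (u_ n)) -> L2 u ->
  L2_cvg M sigma u_ u -> nrm (fun p => u_ n p - u p) @[n --> \oo] --> (0 : R).
Proof.
move=> Lu_ Lu H.
have E n : (\int[sigma]_(p in M) ((u_ n p - u p) ^+ 2)%:E)%E = (ip (fun p => u_ n p - u p) (fun p => u_ n p - u p))%:E.
  rewrite /ip /Rintegral fineK.
    by apply: eq_integral => p _; rewrite expr2.
  by apply: integrable_fin_num => //; apply: L2M; exact: L2B.
have H2 : ip (fun p => u_ n p - u p) (fun p => u_ n p - u p) @[n --> \oo] --> (0 : R).
  by move: H; rewrite /L2_cvg; under eq_fun do rewrite E; move/fine_cvgP => [_].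
have := cvg_comp _ _ H2 (@sqrt_continuous R 0); by rewrite sqrtr0.
Qed.

Lemma ip_cvgl (u_ : nat -> R * R * R -> R) u v : (forall n, L2 (u_ n)) -> L2 u -> L2 v ->
  nrm (fun p => u_ n p - u p) @[n --> \oo] --> (0 : R) -> ip (u_ n) v @[n --> \oo] --> ip u v.
Proof.
move=> Lu_ Lu Lv H; apply/subr_cvg0.
have H0 : nrm (fun p => u_ n p - u p) * nrm v @[n --> \oo] --> (0 : R).
  by rewrite -(mul0r (nrm v)); apply: cvgM => //; exact: cvg_cst.
apply/norm_cvg0P; apply: (squeeze_cvgr _ (cvg_cst 0) H0).
by apply: nearW => n; rewrite normr_ge0/= -ipBl//; apply: ip_CS => //; exact: L2B.
Qed.

Lemma ip_cvg2 (u_ v_ : nat -> R * R * R -> R) u v : (forall n, L2 (u_ n)) -> L2 u ->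
  (forall n, L2 (v_ n)) -> L2 v ->
  nrm (fun p => u_ n p - u p) @[n --> \oo] --> (0 : R) ->
  nrm (fun p => v_ n p - v p) @[n --> \oo] --> (0 : R) ->
  ip (u_ n) (v_ n) @[n --> \oo] --> ip u v.
Proof.
move=> Lu_ Lu Lv_ Lv Hu Hv; apply/subr_cvg0.
have H0 : (nrm (fun p => u_ n p - u p) + nrm u) * nrm (fun p => v_ n p - v p)
   + nrm (fun p => u_ n p - u p) * nrm v @[n --> \oo] --> (0 : R).
  have -> : (0 : R) = (0 + nrm u) * 0 + 0 * nrm v by rewrite mulr0 mul0r addr0.
  apply: cvgD; apply: cvgM => //; last exact: cvg_cst.
  by apply: cvgD => //; exact: cvg_cst.
apply/norm_cvg0P; apply: (squeeze_cvgr _ (cvg_cst 0) H0).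
apply: nearW => n; rewrite normr_ge0/=.
have L1 := L2B (Lu_ n) Lu; have L3 := L2B (Lv_ n) Lv.
have -> : ip (u_ n) (v_ n) - ip u v = ip (u_ n) (fun p => v_ n p - v p) + ip (fun p => u_ n p - u p) v.
  by rewrite ipBr// ipBl//; ring.
apply: le_trans (ler_normD _ _) _; apply: lerD; last exact: ip_CS.
apply: le_trans (ip_CS (Lu_ n) L3) _; apply: ler_wpM2r; first exact: nrm_ge0.
apply: le_trans (nrmD L1 Lu); rewrite le_eqVlt; apply/orP; left; apply/eqP.
by rewrite /nrm; congr Num.sqrt; apply: eq_ip => p _; rewrite subrK.
Qed.

Lemma ip_eq0_ae u : L2 u -> ip u u = 0 -> {ae sigma, forall p, M p -> u p = 0}.
Proof.
move=> Lu u0; have iuu := L2M Lu Lu.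
have mf : measurable_fun M (EFin \o (fun p => u p * u p)) by case/integrableP: iuu.
have /(ae_eq_integral_abs _ mM mf) : (\int[sigma]_(x in M) `|(u x * u x)%:E| = 0)%E.
  have -> : (\int[sigma]_(x in M) `|(u x * u x)%:E| = \int[sigma]_(x in M) (u x * u x)%:E)%E.
    by apply: eq_integral => x _ /=; rewrite ger0_norm// -expr2 sqr_ge0.
  rewrite -[LHS]fineK; last exact: integrable_fin_num.
  by congr EFin.
apply: filterS => p H Mp; have /eqP := H Mp.
by rewrite /= eqe mulf_eq0 orbb => /eqP.
Qed.

Definition bcoef (c : R * R * R -> R) : Prop :=
  measurable_fun M c /\ exists C : R, forall p, M p -> `|c p| <= C.

Lemma bcoef_cst (k : R) : bcoef (fun=> k).
Proof. by split; [exact: measurable_cst|exists `|k|]. Qed.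

Lemma bcoefM u v : bcoef u -> bcoef v -> bcoef (fun p => u p * v p).
Proof.
move=> [mu [C uC]] [mv [D vD]]; split; first exact: measurable_funM.
by exists (C * D) => p Mp; rewrite normrM ler_pM ?uC ?vD.
Qed.

Lemma bcoefD u v : bcoef u -> bcoef v -> bcoef (fun p => u p + v p).
Proof.
move=> [mu [C uC]] [mv [D vD]]; split; first exact: measurable_funD.
by exists (C + D) => p Mp; apply: le_trans (ler_normD _ _) _; rewrite lerD ?uC ?vD.
Qed.

Lemma bcoefN u : bcoef u -> bcoef (fun p => - u p).
Proof.
move=> /(bcoefM (bcoef_cst (-1))) H.
by have -> : (fun p => - u p) = (fun p => -1 * u p) by apply/funext => p; rewrite mulN1r.
Qed.

Lemma bcoefB u v : bcoef u -> bcoef v -> bcoef (fun p => u p - v p).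
Proof. by move=> bu bv; apply: bcoefD => //; exact: bcoefN. Qed.

Lemma L2_bcoef c u : bcoef c -> L2 u -> L2 (fun p => c p * u p).
Proof. by move=> [mc [C cC]] Lu; exact: (L2_bounded_mul mc cC Lu). Qed.

Lemma ip_bcoef c u v : ip (fun p => c p * u p) v = ip u (fun p => c p * v p).
Proof. by apply: eq_Rintegral => p _; rewrite mulrCA mulrA. Qed.

(** Dominated convergence, with a multiple of [u ^+ 2] as the dominating function. *)
Lemma nrm_dominated (c : nat -> R * R * R -> R) u (C : R) (A : set (R * R * R)) :
  L2 u -> (forall n, measurable_fun M (c n)) -> (forall n p, M p -> `|c n p| <= C) ->
  sigma.-negligible A ->
  (forall p, M p -> ~ A p -> c n p @[n --> \oo] --> (0 : R)) ->
  nrm (fun p => c n p * u p) @[n --> \oo] --> (0 : R).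
Proof.
move=> Lu mc cC nA c0; have [mu iu] := Lu.
have mcu n : measurable_fun M (fun p => c n p * u p) by exact: measurable_funM.
have m2 n : measurable_fun M (fun p => ((c n p * u p) * (c n p * u p))%:E).
  by apply/measurable_EFinP; exact: measurable_funM.
have l2 : {ae sigma, forall p, M p -> ((c n p * u p) * (c n p * u p))%:E @[n --> \oo] --> cst 0%E p}.
  have [B [mB B0 AB]] := nA; exists B; split=> // p /= H; apply: AB.
  apply: contrapT => nAp; apply: H => Mp; apply: cvg_EFin; first exact: nearW.
  rewrite -(mul0r (0 * u p)) -{1}(mul0r (u p)).
  by apply: cvgM; apply: cvgM => //; [exact: c0|exact: cvg_cst|exact: c0|exact: cvg_cst].
have b2 : {ae sigma, forall p n, M p ->
    (`|((c n p * u p) * (c n p * u p))%:E| <= (C ^+ 2)%:E * (u p ^+ 2)%:E)%E}.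
  apply: aeW => p n Mp /=; rewrite lee_fin -expr2 exprMn.
  rewrite ger0_norm ?(mulr_ge0 (sqr_ge0 _) (sqr_ge0 _))//; apply: ler_wpM2r; first exact: sqr_ge0.
  rewrite -(real_normK (num_real (c n p))) lerXn2r ?nnegrE ?cC//; exact: le_trans (cC n p Mp).
have [_ _] := dominated_convergence mM m2 (@measurable_cst _ _ _ _ M 0%E) l2 (integrableZl mM (C ^+ 2) iu) b2.
rewrite integral0 => H.
have H2 : ip (fun p => c n p * u p) (fun p => c n p * u p) @[n --> \oo] --> (0 : R).
  by have /fine_cvgP [_] := H.
have := cvg_comp _ _ H2 (@sqrt_continuous R 0); by rewrite sqrtr0.
Qed.

End SquareIntegrable.

(** * Rotation differences *)

Lemma mean_value (R : realType) (f df : R -> R) (a b : R) :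
  (forall x, is_derive (x : R) (1 : R) f (df x)) ->
  exists c, `|c - a| <= `|b - a| /\ f b - f a = df c * (b - a).
Proof.
move=> H; have fc x y : {within `[x, y], continuous f}.
  apply: continuous_subspaceT => z; apply: differentiable_continuous.
  by apply/derivable1_diffP; case: (H z).
have [ab|/ltW ba] := leP a b.
  have [c /itvP cI E] := MVT_segment ab (fun x _ => H x) (@fc a b).
  exists c; split=> //; rewrite !ger0_norm ?subr_ge0 ?cI//.
  by rewrite lerD2r cI.
have [c /itvP cI E] := MVT_segment ba (fun x _ => H x) (@fc b a).
exists c; split; last by rewrite -opprB E; ring.
by rewrite distrC (distrC b) !ger0_norm ?subr_ge0 ?cI// lerD2l lerN2 cI.
Qed.

Section RotationDifference.
Context (R : realType) (M : set (R * R * R)).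
Context (sigma : {measure set (R * R * R) -> \bar R}).
Implicit Types (u v phi theta eta m : R * R * R -> R).
Hypotheses (reg : regular_surface M) (cM : compact M) (Mrot : rotation_symmetric M).
Hypothesis sarea : is_area_measure M sigma.
Local Notation L2 := (L2 M sigma).
Local Notation ip := (ip M sigma).
Local Notation nrm := (nrm M sigma).
Let mM := measurable_surface cM.
Let fM := sigma_fin reg cM sarea.

Lemma smooth_bcoef u : smooth_on M u -> bcoef M u.
Proof.
move=> su; split; first exact: (smooth_on_measurable reg cM su).
exact: (smooth_on_bounded reg cM su).
Qed.

Lemma bcoef_L2 u : bcoef M u -> L2 u.
Proof. by move=> [mu [C uC]]; exact: (L2_bounded mM fM mu uC). Qed.

Lemma smooth_L2 u : smooth_on M u -> L2 u.
Proof. by move=> su; exact: (bcoef_L2 (smooth_bcoef su)). Qed.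

Lemma L2_rot t u : L2 u -> L2 (fun p => u (rot t p)).
Proof.
move=> [mu iu]; split; first exact: (measurable_comp_rot cM Mrot t mu).
have [mi fi] := integrableP _ _ _ iu.
apply/integrableP; split; first exact: (measurable_comp_rot cM Mrot t mi).
have := integral_rot reg cM Mrot sarea t (measurableT_comp (@abse_measurable R setT) mi).
by move=> /= ->.
Qed.

Lemma ip_rot t u v : L2 u -> L2 v -> ip (fun p => u (rot t p)) (fun p => v (rot t p)) = ip u v.
Proof.
move=> Lu Lv; have := L2M mM Lu Lv => /integrableP [mi _].
by rewrite /ip /Rintegral -(integral_rot reg cM Mrot sarea t mi).
Qed.

Lemma ip_rotN t u v : L2 u -> L2 v -> ip (fun p => u (rot t p)) v = ip u (fun p => v (rot (- t) p)).
Proof.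
move=> Lu Lv; rewrite -(ip_rot (- t) (L2_rot t Lu) Lv).
by apply: eq_ip => // p _; rewrite rotNK.
Qed.

Lemma nrm_rot t u : L2 u -> nrm (fun p => u (rot t p)) = nrm u.
Proof. by move=> Lu; rewrite /nrm ip_rot. Qed.

(** The symmetric difference quotient along the rotations. Unlike the one-sided quotient it is exactly
skew for the scalar product. *)
Definition Dq (h : R) u : R * R * R -> R := fun p => (2 * h)^-1 * (u (rot h p) - u (rot (- h) p)).

Lemma L2_Dq h u : L2 u -> L2 (Dq h u).
Proof. by move=> Lu; apply: (L2Z mM); apply: (L2B mM); exact: L2_rot. Qed.

Lemma nrm_Dq h u : L2 u -> nrm (Dq h u) <= `|(2 * h)^-1| * (2 * nrm u).
Proof.
move=> Lu; have L1 := L2_rot h Lu; have L2 := L2_rot (- h) Lu.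
rewrite /Dq nrmZ//; last exact: L2B.
apply: ler_wpM2l; first exact: normr_ge0.
by apply: le_trans (nrmB mM L1 L2) _; rewrite !nrm_rot// mulr2n mulrDl mul1r.
Qed.

Lemma DqB h u v : Dq h (fun p => u p - v p) = (fun p => Dq h u p - Dq h v p).
Proof. by apply/funext => p; rewrite /Dq; ring. Qed.

Definition zonal_on m := forall t p, M p -> m (rot t p) = m p.

(** Rotations preserve area, so difference quotients along them are skew. *)
Lemma ip_Dq_skew h m u v : zonal_on m -> bcoef M m -> L2 u -> L2 v ->
  ip (fun p => m p * u p) (Dq h v) = - ip (fun p => m p * Dq h u p) v.
Proof.
move=> zm bm Lu Lv; have Lmu := L2_bcoef mM bm Lu.
have L1 := L2_rot h Lv; have L2 := L2_rot (- h) Lv.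
have L3 := L2_rot h Lu; have L4 := L2_rot (- h) Lu.
have -> : ip (fun p => m p * Dq h u p) v = ip (Dq h u) (fun p => m p * v p) by rewrite ip_bcoef.
have Lmv := L2_bcoef mM bm Lv.
rewrite /Dq ipZl// ?ipZr//; try exact: L2B.
rewrite ipBl// ipBr// -mulrN opprB; congr (_ * (_ - _)).
  rewrite ip_rotN// opprK ip_bcoef; apply: eq_ip => // p Mp; rewrite zm//.
rewrite ip_rotN// ip_bcoef; apply: eq_ip => // p Mp; rewrite zm//.
Qed.

Lemma Dq_zonal h m u p : zonal_on m -> M p -> Dq h (fun p => m p * u p) p = m p * Dq h u p.
Proof. by move=> zm Mp; rewrite /Dq !zm//; ring. Qed.

Lemma ip_Dq0 h m u : zonal_on m -> bcoef M m -> L2 u -> ip (fun p => m p * u p) (Dq h u) = 0.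
Proof.
move=> zm bm Lu; have := ip_Dq_skew h zm bm Lu Lu.
have -> : ip (fun p => m p * Dq h u p) u = ip (fun p => m p * u p) (Dq h u).
  by rewrite ip_bcoef ipC.
lra.
Qed.

Lemma X3_zonal m u p : zonal_on m -> smooth_on M u -> M p ->
  X3 (fun p => m p * u p) p = m p * X3 u p.
Proof.
move=> zm su Mp; rewrite /X3.
have -> : (fun t => m (rot t p) * u (rot t p)) = (fun t => m p *: (fun t => u (rot t p)) t).
  by apply/funext => t; rewrite zm.
have [du _] := is_derive_rot reg Mrot 0 Mp su.
by rewrite !derive1E deriveZ.
Qed.

(** The remainder is uniform, because the second derivative along the rotations is bounded on the
compact surface. *)
Lemma rot_taylor phi : smooth_on M phi -> exists2 C, 0 <= C &
  forall p h, M p -> `|phi (rot h p) - phi p - h * X3 phi p| <= h ^+ 2 * C.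
Proof.
move=> sp; have sX := smooth_on_X3 Mrot sp; have sXX := smooth_on_X3 Mrot sX.
have [C HC] := smooth_on_bounded reg cM sXX.
exists `|C| => [//|p h Mp].
have d1 t := is_derive_rot reg Mrot t Mp sp.
have d2 t := is_derive_rot reg Mrot t Mp sX.
have [c [ch E]] := mean_value 0 h d1; have [d [dh F]] := mean_value 0 c d2.
rewrite !rot0 !subr0 in E F ch dh.
have -> : phi (rot h p) - phi p - h * X3 phi p = X3 (X3 phi) (rot d p) * c * h.
  by rewrite E -F; ring.
rewrite !normrM -(real_normK (num_real h)) expr2 [leRHS]mulrC mulrA.
apply: ler_wpM2r => //; apply: ler_pM => //.
by apply: le_trans (HC _ (Mrot d Mp)) _; exact: ler_norm.
Qed.

(** The uniform remainder of [rot_taylor] permits differentiation under the integral. *)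
Lemma ip_rot_derive theta phi t : L2 theta -> smooth_on M phi ->
  is_derive (t : R) (1 : R) (fun t => ip theta (fun p => phi (rot t p)))
    (ip theta (fun p => X3 phi (rot t p))).
Proof.
move=> Lt sp; have [C C0 HC] := rot_taylor sp.
have Lp := smooth_L2 sp; have LX := smooth_L2 (smooth_on_X3 Mrot sp).
have L1 := bcoef_L2 (bcoef_cst M (1 : R)).
suff H : h^-1 *: (((fun t => ip theta (fun p => phi (rot t p))) \o shift t) (h *: 1)
      - ip theta (fun p => phi (rot t p))) @[h --> 0^'] --> ip theta (fun p => X3 phi (rot t p)).
  by apply: DeriveDef; [apply/cvg_ex; eexists; exact: H|exact/cvg_lim].
apply/subr_cvg0/norm_cvg0P.
have H0 : `|h| * (C * nrm theta * nrm (fun=> 1)) @[h --> (0 : R)^'] --> (0 : R).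
  have A : `|h| @[h --> (0 : R)^'] --> `|0 : R|.
    by apply: cvg_norm; apply: cvg_within_filter; exact: cvg_id.
  rewrite normr0 in A; rewrite -[X in _ --> X](mul0r (C * nrm theta * nrm (fun=> 1))).
  by apply: cvgM => //; exact: cvg_cst.
apply: (squeeze_cvgr _ (cvg_cst 0) H0).
near=> h; rewrite normr_ge0/=.
have h0 : h != 0 by near: h; exact: nbhs_dnbhs_neq.
pose g p := h^-1 * (phi (rot (h + t) p) - phi (rot t p)).
have Lg : L2 g by apply: (L2Z mM); apply: (L2B mM); exact: L2_rot.
have -> : h^-1 *: (ip theta (fun p => phi (rot (h *: 1 + t) p)) - ip theta (fun p => phi (rot t p)))
      - ip theta (fun p => X3 phi (rot t p)) = ip theta (fun p => g p - X3 phi (rot t p)).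
  have -> : h *: (1 : R) = h by rewrite /GRing.scale /= mulr1.
  rewrite ipBr//; last exact: L2_rot.
  rewrite /g ipZr//; last by apply: (L2B mM); exact: L2_rot.
  by rewrite ipBr//; exact: L2_rot.
have LgX : L2 (fun p => g p - X3 phi (rot t p)) by apply: (L2B mM) => //; exact: L2_rot.
apply: le_trans (ip_CS mM Lt LgX) _.
have : nrm (fun p => g p - X3 phi (rot t p)) <= (`|h| * C) * nrm (fun=> 1).
  apply: (nrm_bounded mM fM); first by case: LgX.
    by rewrite mulr_ge0.
  move=> p Mp; rewrite /g rotD.
  have := HC (rot t p) h (Mrot t Mp).
  set A := phi _; set B := phi _; set D := X3 _ _ => HA.
  have -> : h^-1 * (A - B) - D = h^-1 * (A - B - h * D) by field.
  rewrite normrM normfV mulrC ler_pdivrMr ?normr_gt0//.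
  by rewrite mulrAC -expr2 real_normK ?num_real.
move=> /(ler_wpM2l (nrm_ge0 M sigma theta)) /le_trans; apply.
by rewrite le_eqVlt; apply/orP; left; apply/eqP; ring.
Unshelve. all: by end_near. Qed.

Lemma ip_Dq_mean h theta phi : 0 < h -> L2 theta -> smooth_on M phi ->
  exists c, ip theta (Dq h phi) = ip theta (fun p => X3 phi (rot c p)).
Proof.
move=> h0 Lt sp; have Lp := smooth_L2 sp.
have [c [_ E]] := mean_value (- h) h (fun t => ip_rot_derive t Lt sp).
exists c; rewrite /Dq ipZr//; last by apply: (L2B mM); exact: L2_rot.
rewrite ipBr//; try exact: L2_rot.
rewrite E; have h1 : h != 0 by rewrite gt_eqF.
by field.
Qed.

Lemma ip_Dq_smooth theta phi : L2 theta -> smooth_on M phi ->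
  ip theta (Dq h phi) @[h --> 0^'+] --> ip theta (X3 phi).
Proof.
move=> Lt sp; have [C C0 HC] := rot_taylor sp.
have Lp := smooth_L2 sp; have LX := smooth_L2 (smooth_on_X3 Mrot sp).
apply/subr_cvg0/norm_cvg0P.
have H0 : h * (C * nrm theta * nrm (fun=> 1)) @[h --> (0 : R)^'+] --> (0 : R).
  rewrite -[X in _ --> X](mul0r (C * nrm theta * nrm (fun=> 1))).
  by apply: cvgM; [apply: cvg_at_right_filter; exact: cvg_id|exact: cvg_cst].
apply: (squeeze_cvgr _ (cvg_cst 0) H0).
near=> h; rewrite normr_ge0/=.
have h0 : 0 < h by [].
have LD := L2_Dq h Lp; rewrite -ipBr//; have LDX := L2B mM LD LX.
apply: le_trans (ip_CS mM Lt LDX) _.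
have : nrm (fun p => Dq h phi p - X3 phi p) <= (h * C) * nrm (fun=> 1).
  apply: (nrm_bounded mM fM); first by case: LDX.
    by rewrite mulr_ge0// ltW.
  move=> p Mp; have := HC p h Mp; have := HC p (- h) Mp.
  rewrite /Dq; set A := phi _; set B := phi _; set D := X3 _ _; set F := phi _.
  rewrite sqrrN => H1 H2.
  have -> : (2 * h)^-1 * (F - A) - D = (2 * h)^-1 * ((F - B - h * D) - (A - B - - h * D)).
    by field; rewrite gt_eqF.
  rewrite normrM gtr0_norm ?invr_gt0 ?mulr_gt0// mulrC ler_pdivrMr ?mulr_gt0//.
  apply: le_trans (ler_normB _ _) _; apply: le_trans (lerD H2 H1) _.
  by rewrite le_eqVlt; apply/orP; left; apply/eqP; ring.
move=> /(ler_wpM2l (nrm_ge0 M sigma theta)) /le_trans; apply.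
by rewrite le_eqVlt; apply/orP; left; apply/eqP; ring.
Unshelve. all: by end_near. Qed.

End RotationDifference.

(** * Distributional rotation derivative and graph of the Laplacian *)

Lemma le_cvg0 (R : realType) (x y : R) (e : nat -> R) : (forall n, x <= y + e n) ->
  e n @[n --> \oo] --> (0 : R) -> x <= y.
Proof.
move=> H e0; have H1 : y + e n @[n --> \oo] --> y.
  by rewrite -[X in _ --> X]addr0; apply: cvgD => //; exact: cvg_cst.
by apply: (ler_cvg_to (cvg_cst x) H1); exact: nearW.
Qed.

Section Graph.
Context (R : realType) (M : set (R * R * R)).
Context (sigma : {measure set (R * R * R) -> \bar R}).
Implicit Types (u v phi theta eta m : R * R * R -> R).
Hypotheses (reg : regular_surface M) (cM : compact M) (Mrot : rotation_symmetric M).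
Hypothesis sarea : is_area_measure M sigma.
Local Notation L2 := (L2 M sigma).
Local Notation ip := (ip M sigma).
Local Notation nrm := (nrm M sigma).
Let mM := measurable_surface cM.
Let smL2 := smooth_L2 reg cM sarea.

(** The square integrable functions that can serve as test functions, see [weak_lim]. *)
Definition L2smooth phi := L2 phi /\ exists2 phi_ : nat -> R * R * R -> R,
  forall n, smooth_on M (phi_ n) & nrm (fun p => phi_ n p - phi p) @[n --> \oo] --> (0 : R).

Lemma L2smoothM m phi : smooth_on M m -> L2smooth phi -> L2smooth (fun p => m p * phi p).
Proof.
move=> sm [Lp [phi_ sp cp]]; have bm := smooth_bcoef reg cM sm.
split; first exact: L2_bcoef; exists (fun n p => m p * phi_ n p).
  by move=> n; exact: smooth_onM.
have [mm [C HC]] := bm.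
have C0 : `|C| * nrm (fun p => phi_ n p - phi p) @[n --> \oo] --> (0 : R).
  by rewrite -[X in _ --> X](mulr0 `|C|); apply: cvgM => //; exact: cvg_cst.
apply: (squeeze_cvgr _ (cvg_cst 0) C0); apply: nearW => n; rewrite nrm_ge0/=.
have Ln := smL2 (sp n); have LD := L2B mM Ln Lp.
rewrite -{1}(normr_id C) -nrmZ//; apply: (le_nrm mM); last first.
- move=> p Mp; rewrite -mulrBr !normrM normr_id; apply: ler_wpM2r => //.
  by apply: le_trans (HC p Mp) _; exact: ler_norm.
- exact: L2Z.
- by apply: (L2B mM); exact: L2_bcoef.
Qed.

Lemma L2smoothB u v : L2smooth u -> smooth_on M v -> L2smooth (fun p => u p - v p).
Proof.
move=> [Lu [u_ su cu]] sv; have Lv := smL2 sv; split; first exact: L2B.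
exists (fun n p => u_ n p - v p) => [n|]; first exact: smooth_onB.
apply: cvg_trans cu; apply: near_eq_cvg; apply: nearW => n; rewrite /nrm; congr Num.sqrt.
by apply: eq_ip => p _; ring.
Qed.

Lemma X3_comp_rot phi c p : X3 (fun q => phi (rot c q)) p = X3 phi (rot c p).
Proof. by rewrite /X3; congr (derive1 _ 0); apply/funext => t; rewrite -!rotD addrC. Qed.

Section Weak.
Variables (eta theta : R * R * R -> R).
Hypotheses (Leta : L2 eta) (Ltheta : L2 theta).
Hypothesis weak : forall phi, smooth_on M phi -> ip eta phi = - ip theta (X3 phi).

(** By the mean value theorem the quotient of [phi], paired with [theta], is the pairing of [theta] with
X3 of a rotated copy of [phi], which the weak equation turns into a pairing with [eta]. *)
Lemma weak_bound_smooth h phi : 0 < h -> smooth_on M phi ->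
  `|ip theta (Dq h phi)| <= nrm eta * nrm phi.
Proof.
move=> h0 sp; have [c ->] := ip_Dq_mean reg cM Mrot sarea h0 Ltheta sp.
have Lp := smL2 sp.
rewrite (_ : ip _ _ = - ip eta (fun p => phi (rot c p))).
  rewrite normrN -(nrm_rot reg cM Mrot sarea c Lp); apply: (ip_CS mM) => //.
  exact: (L2_rot reg cM Mrot sarea c Lp).
rewrite weak ?opprK; first by apply: eq_ip => // p _; rewrite X3_comp_rot.
exact: (smooth_on_rot c Mrot sp).
Qed.

Lemma weak_bound h phi : 0 < h -> L2smooth phi -> `|ip theta (Dq h phi)| <= nrm eta * nrm phi.
Proof.
move=> h0 [Lp [phi_ sp cp]].
pose K := nrm theta * (`|(2 * h)^-1| * 2) + nrm eta.
have cK : K * nrm (fun p => phi_ n p - phi p) @[n --> \oo] --> (0 : R).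
  by rewrite -[X in _ --> X](mulr0 K); apply: cvgM => //; exact: cvg_cst.
apply: (le_cvg0 _ cK) => n.
have Ln := smL2 (sp n); have LD := L2B mM Lp Ln.
have LDp := L2_Dq reg cM Mrot sarea h Lp; have LDn := L2_Dq reg cM Mrot sarea h Ln.
have -> : ip theta (Dq h phi) = ip theta (Dq h (fun p => phi p - phi_ n p)) + ip theta (Dq h (phi_ n)).
  by rewrite DqB ipBr// subrK.
apply: le_trans (ler_normD _ _) _.
have H1 := weak_bound_smooth h0 (sp n).
have H2 := ip_CS mM Ltheta (L2_Dq reg cM Mrot sarea h LD).
have H3 := nrm_Dq reg cM Mrot sarea h LD.
have H4 : nrm (phi_ n) <= nrm phi + nrm (fun p => phi_ n p - phi p).
  rewrite addrC; apply: le_trans (nrmD mM (L2B mM Ln Lp) Lp).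
  rewrite le_eqVlt; apply/orP; left; apply/eqP; rewrite /nrm; congr Num.sqrt.
  by apply: eq_ip => p _; rewrite subrK.
have H5 := ler_wpM2l (nrm_ge0 M sigma theta) H3.
have H6 := ler_wpM2l (nrm_ge0 M sigma eta) H4.
rewrite nrm_distC in H5.
apply: le_trans (lerD (le_trans H2 H5) (le_trans H1 H6)) _.
by rewrite le_eqVlt; apply/orP; left; apply/eqP; rewrite /K; ring.
Qed.

(** Since the difference quotients are uniformly bounded against [theta], the identity defining
    the distributional derivative extends from smooth functions to their limits. *)
Lemma weak_lim phi : L2smooth phi -> ip theta (Dq h phi) @[h --> (0 : R)^'+] --> - ip eta phi.
Proof.
move=> [Lp [phi_ sp cp]]; apply/cvgrPdist_lt => e e0.
have cK : 2 * nrm eta * nrm (fun p => phi_ n p - phi p) @[n --> \oo] --> (0 : R).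
  by rewrite -[X in _ --> X](mulr0 (2 * nrm eta)); apply: cvgM => //; exact: cvg_cst.
have e2 : 0 < e / 2 by rewrite divr_gt0.
have /cvgrPdist_lt/(_ _ e2) [n _ /(_ n (leqnn n)) Hn] := cK.
have Ln := smL2 (sp n); have LD := L2B mM Lp Ln.
have /cvgrPdist_lt/(_ _ e2) Hc := ip_Dq_smooth reg cM Mrot sarea Ltheta (sp n).
have lsD : L2smooth (fun p => phi p - phi_ n p).
  by apply: L2smoothB; [split=> //; exists phi_|].
near=> h.
have h0 : 0 < h by [].
have H1 : `|ip theta (X3 (phi_ n)) - ip theta (Dq h (phi_ n))| < e / 2 by near: h.
have H2 := weak_bound h0 lsD.
have H3 := ip_CS mM Leta LD.
have LDp := L2_Dq reg cM Mrot sarea h Lp; have LDn := L2_Dq reg cM Mrot sarea h Ln.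
have -> : - ip eta phi - ip theta (Dq h phi) = (ip theta (X3 (phi_ n)) - ip theta (Dq h (phi_ n)))
   - ip theta (Dq h (fun p => phi p - phi_ n p)) - ip eta (fun p => phi p - phi_ n p).
  by rewrite DqB ipBr// (ipBr mM Lp Ln Leta) (weak (sp n)); ring.
apply: le_lt_trans (ler_normB _ _) _; apply: le_lt_trans (lerD (ler_normB _ _) (lexx _)) _.
move: Hn; rewrite sub0r normrN ger0_norm; last by rewrite !mulr_ge0 ?nrm_ge0.
rewrite nrm_distC; set N := nrm (fun p => phi p - phi_ n p) in H2 H3 *; move: H1 H2 H3.
move: (`|_|) (`|_|) (`|_|) => x y z; lra.
Unshelve. all: by end_near. Qed.

End Weak.

End Graph.

Lemma quad_expand (R : realType) (s x y z : R) :
  s * (s * x + y) + (s * y + z) = s ^+ 2 * x + (2 * s * y + z).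
Proof. by ring. Qed.

Section LaplacianGraph.
Context (R : realType) (M : set (R * R * R)).
Context (sigma : {measure set (R * R * R) -> \bar R}).
Implicit Types (u v phi theta eta m : R * R * R -> R).
Hypotheses (reg : regular_surface M) (cM : compact M) (Mrot : rotation_symmetric M).
Hypothesis sarea : is_area_measure M sigma.
Local Notation L2 := (L2 M sigma).
Local Notation ip := (ip M sigma).
Local Notation nrm := (nrm M sigma).
Local Notation lapl := (L2_laplacian M sigma).
Local Notation L2smooth := (L2smooth M sigma).
Let mM := measurable_surface cM.
Let smL2 := smooth_L2 reg cM sarea.

Lemma Rintegral_comb (f g k : R * R * R -> R) (a b : R) : sigma.-integrable M (EFin \o f) ->
  sigma.-integrable M (EFin \o g) -> sigma.-integrable M (EFin \o k) ->
  \int[sigma]_(p in M) (a * f p + (b * g p + k p)) =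
  a * \int[sigma]_(p in M) f p + (b * \int[sigma]_(p in M) g p + \int[sigma]_(p in M) k p).
Proof.
move=> i1 i2 i3.
have j1 : sigma.-integrable M (EFin \o (fun p => a * f p)) := integrableZl mM a i1.
have j2 : sigma.-integrable M (EFin \o (fun p => b * g p)) := integrableZl mM b i2.
have j3 : sigma.-integrable M (EFin \o (fun p => b * g p + k p)) := integrableD mM j2 i3.
by rewrite (RintegralD mM j1 j3) (RintegralD mM j2 i3) (RintegralZl _ mM i1) (RintegralZl _ mM i2).
Qed.

Definition dirichlet u v : R := \int[sigma]_(p in M) gip M u v p.

Lemma dirichlet_integrable u v : smooth_on M u -> smooth_on M v ->
  sigma.-integrable M (EFin \o gip M u v).
Proof. by move=> su sv; exact: (smooth_on_integrable reg cM sarea (smooth_on_gip su sv)). Qed.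

Lemma dirichlet_sym u v : smooth_on M u -> smooth_on M v -> dirichlet u v = dirichlet v u.
Proof. by move=> su sv; apply: eq_Rintegral => p /set_mem Mp; exact: gip_sym. Qed.

Lemma dirichlet_ge0 u : smooth_on M u -> 0 <= dirichlet u u.
Proof. by move=> su; apply: Rintegral_ge0 => p Mp; exact: gip_ge0. Qed.

Lemma dirichlet_CS u v : smooth_on M u -> smooth_on M v ->
  dirichlet u v ^+ 2 <= dirichlet u u * dirichlet v v.
Proof.
move=> su sv; rewrite mulrC; apply: quadratic_CS; try exact: dirichlet_ge0.
move=> s.
have sw : smooth_on M (fun p => s * u p + v p).
  exact: (smooth_onD (smooth_onM (@smooth_on_cst R M s) su) sv).
have i1 := dirichlet_integrable su su; have i2 := dirichlet_integrable su sv.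
have i3 := dirichlet_integrable sv sv.
have := dirichlet_ge0 sw.
have -> : dirichlet (fun p => s * u p + v p) (fun p => s * u p + v p)
   = \int[sigma]_(p in M) (s ^+ 2 * gip M u u p + (2 * s * gip M u v p + gip M v v p)).
  apply: eq_Rintegral => p /set_mem Mp; rewrite (gip_comb reg s Mp su sv sw).
  rewrite (gip_sym reg Mp su sw) (gip_sym reg Mp sv sw) (gip_comb reg s Mp su sv su).
  rewrite (gip_comb reg s Mp su sv sv) (gip_sym reg Mp sv su).
  exact: (quad_expand s (gip M u u p) (gip M u v p) (gip M v v p)).
rewrite (Rintegral_comb _ _ i1 i2 i3) -/(dirichlet u u) -/(dirichlet u v) -/(dirichlet v v).
move: (dirichlet u u) (dirichlet u v) (dirichlet v v) => x y z; lra.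
Qed.

Lemma ip_laplacian u v h : smooth_on M u -> smooth_on M v -> is_laplacian M v h ->
  ip u h = - dirichlet u v.
Proof.
move=> su sv vh; have sh := smooth_on_laplacian sv vh.
have := Green reg cM sarea su sv vh; rewrite RintegralD//; first by move=> /eqP; rewrite addr_eq0 => /eqP.
  exact: (L2M mM (smL2 su) (smL2 sh)).
exact: dirichlet_integrable.
Qed.

Lemma lapl_approx u v : lapl u v -> exists u_ v_ : nat -> R * R * R -> R,
  [/\ forall n, smooth_on M (u_ n), forall n, smooth_on M (v_ n), forall n, is_laplacian M (u_ n) (v_ n),
      nrm (fun p => u_ n p - u p) @[n --> \oo] --> (0 : R) &
      nrm (fun p => v_ n p - v p) @[n --> \oo] --> (0 : R)].
Proof.
move=> [Lu Lv [u_ [v_ [su uv cu cv]]]].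
have sv n : smooth_on M (v_ n) := smooth_on_laplacian (su n) (uv n).
exists u_, v_; split=> //.
  exact: (L2_cvg_nrm mM (fun n => smL2 (su n)) Lu cu).
exact: (L2_cvg_nrm mM (fun n => smL2 (sv n)) Lv cv).
Qed.

Lemma lapl_L2smooth u v : lapl u v -> L2smooth u /\ L2smooth v.
Proof.
move=> uv; have [Lu Lv _] := uv; have [u_ [v_ [su sv _ cu cv]]] := lapl_approx uv.
by split; split=> //; [exists u_|exists v_].
Qed.

Lemma lapl_sym u v u' v' : lapl u v -> lapl u' v' -> ip u v' = ip u' v.
Proof.
move=> uv uv'; have [Lu Lv _] := uv; have [Lu' Lv' _] := uv'.
have [u_ [v_ [su sv h cu cv]]] := lapl_approx uv.
have [u'_ [v'_ [su' sv' h' cu' cv']]] := lapl_approx uv'.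
have C1 := ip_cvg2 mM (fun n => smL2 (su n)) Lu (fun n => smL2 (sv' n)) Lv' cu cv'.
have C2 := ip_cvg2 mM (fun n => smL2 (su' n)) Lu' (fun n => smL2 (sv n)) Lv cu' cv.
suff E : (fun n => ip (u_ n) (v'_ n)) = (fun n => ip (u'_ n) (v_ n)).
  by rewrite E in C1; exact: (cvg_unique _ C1 C2).
apply/funext => n; rewrite (ip_laplacian (su n) (su' n) (h' n)).
by rewrite (ip_laplacian (su' n) (su n) (h n)) (dirichlet_sym (su n) (su' n)).
Qed.

Lemma lapl_le0 u v : lapl u v -> ip u v <= 0.
Proof.
move=> uv; have [Lu Lv _] := uv; have [u_ [v_ [su sv h cu cv]]] := lapl_approx uv.
have C1 := ip_cvg2 mM (fun n => smL2 (su n)) Lu (fun n => smL2 (sv n)) Lv cu cv.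
apply: (ler_cvg_to C1 (cvg_cst 0)); apply: nearW => n.
by rewrite (ip_laplacian (su n) (su n))// oppr_le0 dirichlet_ge0.
Qed.

(** The Dirichlet integrals of the functions approximating [u] tend to zero, so that [v] is orthogonal
to every smooth function, hence to the functions approximating [v] itself. *)
Lemma lapl_eq0 u v : lapl u v -> ip u v = 0 -> ip v v = 0.
Proof.
move=> uv uv0; have [Lu Lv _] := uv; have [u_ [v_ [su sv h cu cv]]] := lapl_approx uv.
have C1 := ip_cvg2 mM (fun n => smL2 (su n)) Lu (fun n => smL2 (sv n)) Lv cu cv.
have H w : smooth_on M w -> ip v w = 0.
  move=> sw; have Lw := smL2 sw.
  have C2 := ip_cvgl mM (fun n => smL2 (sv n)) Lv Lw cv.
  have C3 : dirichlet w w * - ip (u_ n) (v_ n) @[n --> \oo] --> (0 : R).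
    have -> : (0 : R) = dirichlet w w * - ip u v by rewrite uv0 oppr0 mulr0.
    by apply: cvgM; [exact: cvg_cst|exact: cvgN].
  have C4 : ip (v_ n) w ^+ 2 @[n --> \oo] --> ip v w ^+ 2 by rewrite !expr2; exact: cvgM.
  have : ip v w ^+ 2 <= 0.
    apply: (ler_cvg_to C4 C3); apply: nearW => n.
    rewrite ipC (ip_laplacian sw (su n) (h n)) (ip_laplacian (su n) (su n) (h n)).
    by rewrite opprK sqrrN; exact: dirichlet_CS.
  by move=> H0; apply/eqP; rewrite -sqrf_eq0 eq_le H0 sqr_ge0.
have C5 := ip_cvgl mM (fun n => smL2 (sv n)) Lv Lv cv.
have E : (fun n => ip (v_ n) v) = (fun=> 0) by apply/funext => n; rewrite ipC H.
by rewrite E in C5; exact: (cvg_unique _ C5 (cvg_cst 0)).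
Qed.

Lemma lapl_rot t u v : lapl u v -> lapl (fun p => u (rot t p)) (fun p => v (rot t p)).
Proof.
move=> [Lu Lv [u_ [v_ [su uv cu cv]]]].
have sv n : smooth_on M (v_ n) := smooth_on_laplacian (su n) (uv n).
split; [exact: (L2_rot reg cM Mrot sarea t Lu)|exact: (L2_rot reg cM Mrot sarea t Lv)|].
have E (f_ : nat -> R * R * R -> R) f : (forall n, smooth_on M (f_ n)) -> L2 f ->
   L2_cvg M sigma f_ f -> L2_cvg M sigma (fun n p => f_ n (rot t p)) (fun p => f (rot t p)).
  move=> sf Lf; rewrite /L2_cvg => H; apply: cvg_trans H; apply: near_eq_cvg; apply: nearW => n.
  have [mf _] := L2B mM (smL2 (sf n)) Lf.
  have mf2 : measurable_fun M (fun p => ((f_ n p - f p) ^+ 2)%:E).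
    by apply/measurable_EFinP; exact: measurable_funX.
  by rewrite -(integral_rot reg cM Mrot sarea t mf2).
exists (fun n p => u_ n (rot t p)), (fun n p => v_ n (rot t p)); split.
- by move=> n; exact: (smooth_on_rot t Mrot (su n)).
- by move=> n; exact: (is_laplacian_rot t Mrot (uv n)).
- exact: E.
- exact: E.
Qed.

(** The Laplacian is symmetric and commutes with rotations, while a rotation
    difference is skew. *)
Lemma lapl_Dq_orth h u v : lapl u v -> ip (Dq h u) v = 0.
Proof.
move=> uv; have [Lu Lv _] := uv.
have L1 := L2_rot reg cM Mrot sarea h Lu; have L2 := L2_rot reg cM Mrot sarea (- h) Lu.
rewrite /Dq (ipZl mM)//; last exact: L2B.
rewrite ipBl// (lapl_sym (lapl_rot h uv) uv) (ipC _ _ u).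
rewrite (ip_rotN reg cM Mrot sarea h Lv Lu) ipC subrr mulr0//.
Qed.

(** The energy identity bounds the rotation derivative of [u] by [ip u v],
    uniformly in the step. *)
Lemma lapl_Dq_bound u v : lapl u v -> exists2 C, 0 <= C &
  forall theta h, L2 theta -> 0 < h -> `|ip (Dq h u) theta| <= C * nrm theta.
Proof.
move=> uv; have [Lu Lv _] := uv; have [u_ [v_ [su sv l cu cv]]] := lapl_approx uv.
have [K K0 HK] := X3_bound reg cM Mrot.
exists (Num.sqrt (K * - ip u v)) => [|theta h Lt h0]; first exact: sqrtr_ge0.
have C1 := ip_cvg2 mM (fun n => smL2 (su n)) Lu (fun n => smL2 (sv n)) Lv cu cv.
have C2 : Num.sqrt (K * - ip (u_ n) (v_ n)) * nrm theta @[n --> \oo] --> Num.sqrt (K * - ip u v) * nrm theta.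
  apply: cvgM; last exact: cvg_cst.
  apply: (continuous_cvg _ (@sqrt_continuous R _)).
  by apply: cvgM; [exact: cvg_cst|exact: cvgN].
have LDu := L2_Dq reg cM Mrot sarea h Lu.
have C3 : nrm (fun p => Dq h (u_ n) p - Dq h u p) @[n --> \oo] --> (0 : R).
  have C4 : `|(2 * h)^-1| * (2 * nrm (fun p => u_ n p - u p)) @[n --> \oo] --> (0 : R).
    rewrite -[X in _ --> X](mulr0 `|(2 * h)^-1|); apply: cvgM; first exact: cvg_cst.
    by rewrite -[X in _ --> X](mulr0 2); apply: cvgM => //; exact: cvg_cst.
  apply: (squeeze_cvgr _ (cvg_cst 0) C4); apply: nearW => n; rewrite nrm_ge0/= -DqB.
  exact: (nrm_Dq reg cM Mrot sarea h (L2B mM (smL2 (su n)) Lu)).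
have C5 := ip_cvgl mM (fun n => L2_Dq reg cM Mrot sarea h (smL2 (su n))) LDu Lt C3.
apply: (ler_cvg_to (cvg_norm C5) C2); apply: nearW => n.
have [c E] := ip_Dq_mean reg cM Mrot sarea h0 Lt (su n).
have sX := smooth_on_X3 Mrot (su n).
rewrite ipC E; apply: le_trans (ip_CS mM Lt (L2_rot reg cM Mrot sarea c (smL2 sX))) _.
rewrite (nrm_rot reg cM Mrot sarea c (smL2 sX)) mulrC; apply: ler_wpM2r; first exact: nrm_ge0.
apply: ler_wsqrtr; rewrite (ip_laplacian (su n) (su n))// opprK /dirichlet -RintegralZl//; last first.
  exact: dirichlet_integrable.
apply: le_Rintegral => //.
- exact: (L2M mM (smL2 sX) (smL2 sX)).
- exact: (integrableZl mM K (dirichlet_integrable (su n) (su n))).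
- by move=> p Mp; rewrite -expr2; exact: HK.
Qed.

End LaplacianGraph.

(** * The energy argument *)

Lemma weighted_AMGM (R : realType) (x d : R) : 0 <= x -> 0 <= d -> x * d ^+ 2 <= d * (x ^+ 2 + d ^+ 2).
Proof.
move=> x0 d0; rewrite expr2 mulrA (mulrC _ d); apply: ler_wpM2l => //.
have := sqr_ge0 (x - d); have := mulr_ge0 x0 d0; rewrite sqrrB; lra.
Qed.

Section Pairing.
Context (R : realType) (M : set (R * R * R)).
Context (sigma : {measure set (R * R * R) -> \bar R}).
Hypotheses (reg : regular_surface M) (cM : compact M) (Mrot : rotation_symmetric M).
Hypothesis sarea : is_area_measure M sigma.
Local Notation L2 := (L2 M sigma).
Local Notation ip := (ip M sigma).
Local Notation nrm := (nrm M sigma).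
Local Notation lapl := (L2_laplacian M sigma).
Let mM := measurable_surface cM.
Let sbc := @smooth_bcoef R M reg cM.

Variables (A B zeta psi eta : R * R * R -> R).
Hypotheses (sA : smooth_on M A) (zA : zonal_on M A) (sB : smooth_on M B) (zB : zonal_on M B).
Hypotheses (lpz : lapl psi zeta) (Leta : L2 eta).
Hypothesis weak : forall phi, smooth_on M phi ->
  ip eta phi = - ip (fun p => A p * zeta p + B p * psi p) (X3 phi).

Let Lz : L2 zeta. Proof. by case: lpz. Qed.
Let Lp : L2 psi. Proof. by case: lpz. Qed.

Lemma zonal_onM (m m' : R * R * R -> R) : zonal_on M m -> zonal_on M m' ->
  zonal_on M (fun p => m p * m' p).
Proof. by move=> z z' t p Mp; rewrite z// z'. Qed.

Let Lth : L2 (fun p => A p * zeta p + B p * psi p).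
Proof. by apply: (L2D mM); apply: (L2_bcoef mM) => //; exact: sbc. Qed.

Lemma ip_theta_Dq h m u : smooth_on M m -> zonal_on M m -> L2 u ->
  ip (fun p => A p * zeta p + B p * psi p) (Dq h (fun p => m p * u p)) =
  ip (fun p => (A p * m p) * zeta p) (Dq h u) + ip (fun p => (B p * m p) * psi p) (Dq h u).
Proof.
move=> sm zm Lu; have LD := L2_Dq reg cM Mrot sarea h Lu.
have bAm := sbc (smooth_onM sA sm); have bBm := sbc (smooth_onM sB sm).
rewrite -(ipDl mM (L2_bcoef mM bAm Lz) (L2_bcoef mM bBm Lp) LD).
by apply: eq_Rintegral => p /set_mem Mp; rewrite (Dq_zonal h u zm Mp); ring.
Qed.

(** The equation tested with [m zeta]. The term in [A] drops out because difference quotients are skew,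
and in the term in [B] the quotient moves from [zeta] to [psi]. *)
Lemma pairing_zeta m : smooth_on M m -> zonal_on M m ->
  ip (Dq h psi) (fun p => (B p * m p) * zeta p) @[h --> (0 : R)^'+] --> ip eta (fun p => m p * zeta p).
Proof.
move=> sm zm; have [_ ls] := lapl_L2smooth reg cM sarea lpz.
have H := weak_lim reg cM Mrot sarea Leta Lth weak (L2smoothM reg cM sarea sm ls).
suff -> : (fun h => ip (Dq h psi) (fun p => (B p * m p) * zeta p))
   = (fun h => - ip (fun p => A p * zeta p + B p * psi p) (Dq h (fun p => m p * zeta p))).
  by rewrite -[X in _ --> X]opprK; exact: cvgN.
apply/funext => h.
have bAm := sbc (smooth_onM sA sm); have bBm := sbc (smooth_onM sB sm).
have zAm := zonal_onM zA zm; have zBm := zonal_onM zB zm.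
rewrite ip_theta_Dq// (ip_Dq0 reg cM Mrot sarea h zAm bAm Lz) add0r.
by rewrite (ip_Dq_skew reg cM Mrot sarea h zBm bBm Lp Lz) opprK ip_bcoef.
Qed.

(** The equation tested with [m psi]: this time skewness removes the term in [B]. *)
Lemma pairing_psi m : smooth_on M m -> zonal_on M m ->
  ip (Dq h psi) (fun p => (A p * m p) * zeta p) @[h --> (0 : R)^'+] --> - ip eta (fun p => m p * psi p).
Proof.
move=> sm zm; have [ls _] := lapl_L2smooth reg cM sarea lpz.
have H := weak_lim reg cM Mrot sarea Leta Lth weak (L2smoothM reg cM sarea sm ls).
suff -> : (fun h => ip (Dq h psi) (fun p => (A p * m p) * zeta p))
   = (fun h => ip (fun p => A p * zeta p + B p * psi p) (Dq h (fun p => m p * psi p))) by [].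
apply/funext => h.
have bBm := sbc (smooth_onM sB sm); have zBm := zonal_onM zB zm.
by rewrite ip_theta_Dq// (ip_Dq0 reg cM Mrot sarea h zBm bBm Lp) addr0 ipC.
Qed.

End Pairing.

Section Cutoff.
Context (R : realType) (M : set (R * R * R)).

Definition cutoff (n : nat) (p : R * R * R) : R := flat (n.+1%:R * axis_dist2 p - 1).

Lemma cutoff_ge0 n p : 0 <= cutoff n p. Proof. exact: flat_ge0. Qed.
Lemma cutoff_le1 n p : cutoff n p <= 1. Proof. exact: flat_le1. Qed.

Lemma axis_dist2_rot t (p : R * R * R) : axis_dist2 (rot t p) = axis_dist2 p.
Proof.
rewrite /axis_dist2 /rot /px /py /=; have := cos2Dsin2 t.
move: (cos t) (sin t) => c s cs.
transitivity ((c ^+ 2 + s ^+ 2) * (p.1.1 ^+ 2 + p.1.2 ^+ 2)); first by ring.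
by rewrite cs mul1r.
Qed.

Lemma zonal_cutoff n : zonal_on M (cutoff n).
Proof. by move=> t p _; rewrite /cutoff axis_dist2_rot. Qed.

Lemma smooth_cutoff n : smooth_on M (cutoff n).
Proof.
apply: smooth_on_flat; apply: smooth_onB; last exact: (@smooth_on_cst R M 1).
by apply: smooth_onM; [exact: (@smooth_on_cst R M n.+1%:R)|exact: smooth_on_axis_dist2].
Qed.

Lemma cutoff_eq0 n (p : R * R * R) : axis_dist2 p <= n.+1%:R^-1 -> cutoff n p = 0.
Proof. by move=> H; apply: flat_le0; rewrite subr_le0 -ler_pdivlMl// mulr1. Qed.

Lemma smooth_cutoffM n u : smooth_on (off_axis M) u -> smooth_on M (fun p => cutoff n p * u p).
Proof.
move=> su; apply: (@smooth_on_cutoff R M (cutoff n) u n.+1%:R^-1); rewrite ?invr_gt0//.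
  exact: smooth_cutoff.
by move=> p; exact: cutoff_eq0.
Qed.

Lemma cutoff_cvg p : off_axis M p -> cutoff n p @[n --> \oo] --> (1 : R).
Proof.
move=> [Mp p0]; apply: flat_cvg1; apply/cvgryPge => C; near=> n.
have : (C + 1) / axis_dist2 p <= n%:R by near: n; exact: nbhs_infty_ger.
rewrite ler_pdivrMr// => H; rewrite lerBrDr; apply: le_trans H _.
by rewrite ler_pM2r// ler_nat.
Unshelve. all: by end_near. Qed.

Lemma cutoff_cases n (p : R * R * R) : M p -> cutoff n p = 0 \/ off_axis M p.
Proof.
move=> Mp; have [p0|p0] := ltP 0 (axis_dist2 p); [by right|left].
by rewrite cutoff_eq0//; apply: (le_trans p0); rewrite invr_ge0.
Qed.

End Cutoff.

Section Energy.
Context (R : realType) (M : set (R * R * R)).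
Context (sigma : {measure set (R * R * R) -> \bar R}).
Hypotheses (reg : regular_surface M) (cM : compact M) (Mrot : rotation_symmetric M).
Hypothesis sarea : is_area_measure M sigma.
Local Notation L2 := (L2 M sigma).
Local Notation ip := (ip M sigma).
Local Notation nrm := (nrm M sigma).
Local Notation lapl := (L2_laplacian M sigma).
Local Notation kap n := (@cutoff R n).
Let mM := measurable_surface cM.
Let sbc := @smooth_bcoef R M reg cM.

Variables (a b z1 z2 s1 s2 : R * R * R -> R) (mu om : R).
Hypotheses (sa : smooth_on (off_axis M) a) (za : zonal_on M a).
Hypotheses (sb : smooth_on (off_axis M) b) (zb : zonal_on M b).
Hypotheses (l1 : lapl s1 z1) (l2 : lapl s2 z2).
Hypothesis mu0 : mu != 0.
Let eta1 p := mu * z1 p - om * z2 p.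
Let eta2 p := om * z1 p + mu * z2 p.
Hypothesis weak1 : forall n phi, smooth_on M phi -> ip (fun p => kap n p * eta1 p) phi =
  - ip (fun p => (kap n p * a p) * z1 p + (kap n p * b p) * s1 p) (X3 phi).
Hypothesis weak2 : forall n phi, smooth_on M phi -> ip (fun p => kap n p * eta2 p) phi =
  - ip (fun p => (kap n p * a p) * z2 p + (kap n p * b p) * s2 p) (X3 phi).

Let Lz1 : L2 z1. Proof. by case: l1. Qed.
Let Lz2 : L2 z2. Proof. by case: l2. Qed.
Let Ls1 : L2 s1. Proof. by case: l1. Qed.
Let Ls2 : L2 s2. Proof. by case: l2. Qed.
Let Le1 : L2 eta1. Proof. by apply: (L2B mM); exact: (L2Z mM). Qed.
Let Le2 : L2 eta2. Proof. by apply: (L2D mM); exact: (L2Z mM). Qed.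
Let skap n : smooth_on M (kap n) := smooth_cutoff n.
Let bkap n : bcoef M (kap n) := sbc (skap n).
Let ska n : smooth_on M (fun p => kap n p * a p) := smooth_cutoffM n sa.
Let skb n : smooth_on M (fun p => kap n p * b p) := smooth_cutoffM n sb.
Let zkap n : zonal_on M (kap n) := @zonal_cutoff R M n.

(** With zeta = z1 + i z2, psi = s1 + i s2 and lambda = mu + i om, [energy] is the integral of
c |zeta|^2, while [power] and [flux] are the real parts of the integrals of c lambda zeta conj(psi) and
of c (Dq h psi) conj(zeta). The norm of c zeta is controlled by [mass]. *)
Definition energy (c : R * R * R -> R) : R :=
  ip (fun p => c p * z1 p) z1 + ip (fun p => c p * z2 p) z2.
Definition power (c : R * R * R -> R) : R :=
  ip (fun p => c p * eta1 p) s1 + ip (fun p => c p * eta2 p) s2.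
Definition flux (h : R) (c : R * R * R -> R) : R :=
  ip (Dq h s1) (fun p => c p * z1 p) + ip (Dq h s2) (fun p => c p * z2 p).
Definition mass (c : R * R * R -> R) : R :=
  nrm (fun p => c p * z1 p) + nrm (fun p => c p * z2 p).

Lemma mass_ge0 c : 0 <= mass c. Proof. by rewrite addr_ge0// nrm_ge0. Qed.

Lemma le_mass c d : bcoef M c -> bcoef M d -> (forall p, M p -> `|c p| <= `|d p|) -> mass c <= mass d.
Proof.
move=> bc bd cd; apply: lerD; apply: (le_nrm mM); try exact: L2_bcoef.
  by move=> p Mp; rewrite !normrM ler_wpM2r ?cd.
by move=> p Mp; rewrite !normrM ler_wpM2r ?cd.
Qed.

Lemma massZ k c : bcoef M c -> mass (fun p => k * c p) = `|k| * mass c.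
Proof.
move=> bc; rewrite /mass mulrDr -!nrmZ//; try exact: L2_bcoef.
by congr (Num.sqrt _ + Num.sqrt _); apply: eq_ip => p _; rewrite mulrA.
Qed.

Lemma eq_mass c d : (forall p, M p -> c p = d p) -> mass c = mass d.
Proof.
by move=> cd; congr (Num.sqrt _ + Num.sqrt _); apply: eq_ip => p Mp; rewrite cd.
Qed.

Lemma le_energy c d : bcoef M c -> bcoef M d -> (forall p, M p -> c p <= d p) -> energy c <= energy d.
Proof.
move=> bc bd cd; apply: lerD; apply: le_Rintegral => //.
- exact: (L2M mM (L2_bcoef mM bc Lz1) Lz1).
- exact: (L2M mM (L2_bcoef mM bd Lz1) Lz1).
- by move=> p Mp; rewrite -!mulrA -expr2 ler_wpM2r ?sqr_ge0// cd.
- exact: (L2M mM (L2_bcoef mM bc Lz2) Lz2).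
- exact: (L2M mM (L2_bcoef mM bd Lz2) Lz2).
- by move=> p Mp; rewrite -!mulrA -expr2 ler_wpM2r ?sqr_ge0// cd.
Qed.

Lemma energyD c d : bcoef M c -> bcoef M d -> energy (fun p => c p + d p) = energy c + energy d.
Proof.
move=> bc bd; rewrite /energy addrACA; congr (_ + _); rewrite -ipDl//; try exact: L2_bcoef.
  by apply: eq_ip => p _; rewrite // mulrDl.
by apply: eq_ip => p _; rewrite // mulrDl.
Qed.

Lemma energyZ k c : bcoef M c -> energy (fun p => k * c p) = k * energy c.
Proof.
move=> bc; rewrite /energy mulrDr -!ipZl//; try exact: L2_bcoef.
by congr (_ + _); apply: eq_ip => p _; rewrite // mulrA.
Qed.

Lemma energy_ge0 c : (forall p, M p -> 0 <= c p) -> 0 <= energy c.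
Proof.
by move=> c0; apply: addr_ge0; apply: Rintegral_ge0 => p Mp; rewrite -mulrA -expr2 mulr_ge0 ?sqr_ge0 ?c0.
Qed.

Lemma mass_sqr c : bcoef M c -> mass c ^+ 2 <= 2 * energy (fun p => c p * c p).
Proof.
move=> bc.
have -> : energy (fun p => c p * c p) = nrm (fun p => c p * z1 p) ^+ 2 + nrm (fun p => c p * z2 p) ^+ 2.
  by rewrite !sqr_nrm; congr (_ + _); apply: eq_Rintegral => p _; ring.
rewrite /mass; move: (nrm _) (nrm _) => x y; have := sqr_ge0 (x - y); rewrite sqrrB sqrrD; lra.
Qed.

(** X3 commutes with the Laplacian. *)
Lemma flux1 h : flux h (fun=> 1) = 0.
Proof.
rewrite /flux -[RHS](addr0 0); congr (_ + _).
  by rewrite -(lapl_Dq_orth reg cM Mrot sarea h l1); apply: eq_ip => p _; rewrite // mul1r.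
by rewrite -(lapl_Dq_orth reg cM Mrot sarea h l2); apply: eq_ip => p _; rewrite // mul1r.
Qed.

Lemma fluxD h c d : bcoef M c -> bcoef M d -> flux h (fun p => c p + d p) = flux h c + flux h d.
Proof.
have LD1 := L2_Dq reg cM Mrot sarea h Ls1; have LD2 := L2_Dq reg cM Mrot sarea h Ls2.
move=> bc bd; rewrite /flux addrACA; congr (_ + _); rewrite -ipDr//; try exact: L2_bcoef.
  by apply: eq_ip => p _; rewrite // mulrDl.
by apply: eq_ip => p _; rewrite // mulrDl.
Qed.

Lemma fluxZ h k c : bcoef M c -> flux h (fun p => k * c p) = k * flux h c.
Proof.
have LD1 := L2_Dq reg cM Mrot sarea h Ls1; have LD2 := L2_Dq reg cM Mrot sarea h Ls2.
move=> bc; rewrite /flux mulrDr -!ipZr//; try exact: L2_bcoef.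
by congr (_ + _); apply: eq_ip => p _; rewrite // mulrA.
Qed.

Lemma eq_flux h c d : (forall p, M p -> c p = d p) -> flux h c = flux h d.
Proof. by move=> cd; congr (_ + _); apply: eq_ip => p Mp; rewrite // cd. Qed.

Lemma flux_bound : exists2 Q, 0 <= Q & forall h c, 0 < h -> bcoef M c -> `|flux h c| <= Q * mass c.
Proof.
have [C1 C10 H1] := lapl_Dq_bound reg cM Mrot sarea l1.
have [C2 C20 H2] := lapl_Dq_bound reg cM Mrot sarea l2.
exists (C1 + C2) => [|h c h0 bc]; first exact: addr_ge0.
apply: le_trans (ler_normD _ _) _.
apply: le_trans (lerD (H1 _ h (L2_bcoef mM bc Lz1) h0) (H2 _ h (L2_bcoef mM bc Lz2) h0)) _.
rewrite mulrDl; apply: lerD; apply: ler_wpM2l => //; rewrite /mass ?lerDl ?lerDr nrm_ge0//.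
Qed.

(** The equation multiplied by m conj(zeta). *)
Lemma flux_energy n m : smooth_on M m -> zonal_on M m ->
  flux h (fun p => (kap n p * b p) * m p) @[h --> (0 : R)^'+] --> mu * energy (fun p => kap n p * m p).
Proof.
move=> sm zm; have zA : zonal_on M (fun p => kap n p * a p) := zonal_onM (@zkap n) za.
have zB : zonal_on M (fun p => kap n p * b p) := zonal_onM (@zkap n) zb.
have H1 := pairing_zeta reg cM Mrot sarea (ska n) zA (skb n) zB l1 (L2_bcoef mM (bkap n) Le1) (@weak1 n) sm zm.
have H2 := pairing_zeta reg cM Mrot sarea (ska n) zA (skb n) zB l2 (L2_bcoef mM (bkap n) Le2) (@weak2 n) sm zm.
suff -> : mu * energy (fun p => kap n p * m p) = ip (fun p => kap n p * eta1 p) (fun p => m p * z1 p)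
   + ip (fun p => kap n p * eta2 p) (fun p => m p * z2 p) by exact: cvgD.
have bkm := bcoefM (bkap n) (sbc sm).
have Lk1 := L2_bcoef mM bkm Lz1; have Lk2 := L2_bcoef mM bkm Lz2.
have -> : ip (fun p => kap n p * eta1 p) (fun p => m p * z1 p) = ip (fun p => (kap n p * m p) * z1 p) eta1.
  by apply: eq_Rintegral => p _; ring.
have -> : ip (fun p => kap n p * eta2 p) (fun p => m p * z2 p) = ip (fun p => (kap n p * m p) * z2 p) eta2.
  by apply: eq_Rintegral => p _; ring.
have Lm k z : L2 z -> L2 (fun p => k * z p) by move=> Lz; exact: L2Z.
rewrite /eta1 /eta2 (ipBr mM (Lm mu _ Lz1) (Lm om _ Lz2) Lk1) (ipDr mM (Lm om _ Lz1) (Lm mu _ Lz2) Lk2).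
rewrite !(ipZr mM)// /energy.
rewrite (ip_bcoef _ _ _ z2 z1) (ipC _ _ z2); ring.
Qed.

(** The equation multiplied by m conj(psi). *)
Lemma flux_power n m : smooth_on M m -> zonal_on M m ->
  flux h (fun p => (kap n p * a p) * m p) @[h --> (0 : R)^'+] --> - power (fun p => kap n p * m p).
Proof.
move=> sm zm; have zB : zonal_on M (fun p => kap n p * b p) := zonal_onM (@zkap n) zb.
have H1 := pairing_psi reg cM Mrot sarea (ska n) (skb n) zB l1 (L2_bcoef mM (bkap n) Le1) (@weak1 n) sm zm.
have H2 := pairing_psi reg cM Mrot sarea (ska n) (skb n) zB l2 (L2_bcoef mM (bkap n) Le2) (@weak2 n) sm zm.
suff -> : - power (fun p => kap n p * m p) = - ip (fun p => kap n p * eta1 p) (fun p => m p * s1 p)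
   + - ip (fun p => kap n p * eta2 p) (fun p => m p * s2 p) by exact: cvgD.
by rewrite /power opprD; congr (- _ + - _); apply: eq_Rintegral => p _; ring.
Qed.

(** [recip d] regularizes 1 / b. What is lost, [defect d] = 1 - b recip d, is concentrated where b is
small. *)
Definition defect (d : R) (p : R * R * R) : R := d ^+ 2 / (b p ^+ 2 + d ^+ 2).
Definition recip (d : R) (p : R * R * R) : R := b p / (b p ^+ 2 + d ^+ 2).

Let den_gt0 d p : 0 < d -> 0 < b p ^+ 2 + d ^+ 2.
Proof. by move=> d0; rewrite ltr_wpDl ?sqr_ge0// exprn_gt0. Qed.

Lemma defect_ge0 d p : 0 < d -> 0 <= defect d p.
Proof. by move=> d0; rewrite divr_ge0 ?sqr_ge0// ltW// den_gt0. Qed.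

Lemma defect_le1 d p : 0 < d -> defect d p <= 1.
Proof. by move=> d0; rewrite ler_pdivrMr ?den_gt0// mul1r lerDr sqr_ge0. Qed.

Lemma b_defect d p : 0 < d -> `|b p * defect d p| <= d.
Proof.
move=> d0; rewrite /defect mulrA normrM normfV (gtr0_norm (den_gt0 p d0)).
rewrite ler_pdivrMr ?den_gt0// normrM (ger0_norm (sqr_ge0 d)).
by rewrite -(real_normK (num_real (b p))); apply: weighted_AMGM => //; exact: ltW.
Qed.

Lemma b_recip d p : 0 < d -> b p * recip d p = 1 - defect d p.
Proof. by move=> d0; rewrite /recip /defect; field; rewrite gt_eqF// den_gt0. Qed.

Lemma smooth_defect d : 0 < d -> smooth_on (off_axis M) (defect d) /\ smooth_on (off_axis M) (recip d).
Proof.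
move=> d0; have sd : smooth_on (off_axis M) (fun p => (b p ^+ 2 + d ^+ 2)^-1).
  apply: smooth_onV => [|p _]; last by rewrite gt_eqF// den_gt0.
  apply: smooth_onD; last exact: (@smooth_on_cst R (off_axis M) (d ^+ 2)).
  exact: (smooth_onM sb sb).
split; last exact: smooth_onM.
exact: (smooth_onM (@smooth_on_cst R (off_axis M) (d ^+ 2)) sd).
Qed.

Lemma zonal_defect d : zonal_on M (defect d) /\ zonal_on M (recip d).
Proof. by split=> t p Mp; rewrite /defect /recip zb. Qed.

Let skdef n d : 0 < d -> smooth_on M (fun p => kap n p * defect d p).
Proof. by move=> d0; apply: smooth_cutoffM; have [] := smooth_defect d0. Qed.

(** Take the defect itself as the multiplier: b times the defect is at most d, so that the flux, and
with it the energy, is small with d. In the limit zeta vanishes where b does. *)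
Lemma defect_energy : exists2 Q, 0 <= Q & forall n d, 0 < d ->
  energy (fun p => kap n p * (kap n p * defect d p)) <= Q * d.
Proof.
have [Q Q0 HQ] := flux_bound; exists (Q * mass (fun=> 1) / `|mu|) => [|n d d0].
  by rewrite divr_ge0 ?mulr_ge0 ?mass_ge0.
have zm : zonal_on M (fun p => kap n p * defect d p).
  by apply: zonal_onM; [exact: zkap|have [] := zonal_defect d].
have H := @flux_energy n _ (skdef n d0) zm.
have bc : bcoef M (fun p => (kap n p * b p) * (kap n p * defect d p)).
  by apply: bcoefM; apply: sbc; [exact: skb|exact: skdef].
have : `|mu * energy (fun p => kap n p * (kap n p * defect d p))| <= Q * (d * mass (fun=> 1)).
  apply: (ler_cvg_to (cvg_norm H) (cvg_cst _)); near=> h.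
  apply: le_trans (HQ h _ _ bc) _ => //; apply: ler_wpM2l => //.
  have b1 := bcoef_cst M (1 : R); have bd := bcoef_cst M d.
  rewrite -{2}(ger0_norm (ltW d0)) -massZ//; apply: le_mass => //; first exact: bcoefM.
  move=> p Mp; rewrite mulr1 (ger0_norm (ltW d0)).
  rewrite (_ : _ * _ = (kap n p * kap n p) * (b p * defect d p)); last by ring.
  rewrite normrM -[leRHS]mul1r; apply: ler_pM => //; last exact: b_defect.
  by rewrite ger0_norm ?mulr_ge0 ?cutoff_ge0// mulr_ile1 ?cutoff_ge0 ?cutoff_le1.
rewrite normrM (ger0_norm (energy_ge0 _)) => [H1|p Mp].
  have m0 : 0 < `|mu| by rewrite normr_gt0.
  by rewrite mulrAC ler_pdivlMr// mulrC -mulrA (mulrC _ d).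
by apply: mulr_ge0; [|apply: mulr_ge0]; first [exact: cutoff_ge0|exact: defect_ge0].
Unshelve. all: by end_near. Qed.

Lemma mass_defect n (c : R * R * R -> R) : smooth_on (off_axis M) c ->
  exists2 Q, 0 <= Q & forall d, 0 < d ->
  mass (fun p => kap n p * (kap n p * (c p * defect d p))) ^+ 2 <= Q * d.
Proof.
move=> sc; have [Q Q0 HQ] := defect_energy.
have [_ [C HC]] := sbc (smooth_cutoffM n sc).
exists (`|C| ^+ 2 * (2 * Q)) => [|d d0]; first by rewrite !mulr_ge0.
have bkd : bcoef M (fun p => kap n p * defect d p) by apply: sbc; exact: skdef.
have bkc : bcoef M (fun p => kap n p * c p) by apply: sbc; exact: smooth_cutoffM.
have H1 : mass (fun p => kap n p * (kap n p * (c p * defect d p))) <=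
   `|C| * mass (fun p => kap n p * defect d p).
  rewrite -(normr_id C) -massZ//.
  rewrite (@eq_mass _ (fun p => (kap n p * c p) * (kap n p * defect d p))) => [|p _]; last by ring.
  apply: le_mass; [exact: bcoefM|by apply: bcoefM => //; exact: bcoef_cst|].
  move=> p Mp; rewrite !normrM normr_id ler_wpM2r//.
  by rewrite -normrM; apply: le_trans (HC p Mp) _; exact: ler_norm.
apply: (@le_trans _ _ ((`|C| * mass (fun p => kap n p * defect d p)) ^+ 2)).
  by rewrite lerXn2r ?nnegrE ?mulr_ge0 ?mass_ge0.
rewrite exprMn -[leRHS]mulrA; apply: ler_wpM2l; first exact: sqr_ge0.
apply: le_trans (mass_sqr bkd) _.
rewrite -[leRHS]mulrA; apply: ler_wpM2l => //; apply: le_trans _ (HQ n d d0).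
apply: le_energy.
- exact: bcoefM.
- by apply: bcoefM => //; exact: bkap.
- move=> p Mp; rewrite mulrCA mulrA; apply: ler_piMr; last exact: defect_le1.
  by apply: mulr_ge0; [|apply: mulr_ge0]; first [exact: cutoff_ge0|exact: defect_ge0].
Qed.

(** The multiplier is c / b up to the defect, where c = K - e a. The constant K carries no flux and the
part in e a is evaluated by [flux_power], so that only the cutoff and the defect leave an error. *)
Lemma energy_power (K e : R) n d : 0 < d -> let c p := K - e * a p in
  forall Q, (forall h c, 0 < h -> bcoef M c -> `|flux h c| <= Q * mass c) ->
  `|mu * energy (fun p => kap n p * (kap n p * (c p * recip d p))) - e * power (fun p => kap n p * kap n p)|
  <= Q * (`|K| * mass (fun p => 1 - kap n p * kap n p) +
          mass (fun p => kap n p * (kap n p * (c p * defect d p)))).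
Proof.
move=> d0 c Q HQ.
have sc : smooth_on (off_axis M) c.
  apply: smooth_onB; first exact: (@smooth_on_cst R (off_axis M) K).
  exact: (smooth_onM (@smooth_on_cst R (off_axis M) e) sa).
have [sdef srec] := smooth_defect d0; have [zdef zrec] := zonal_defect d.
have zc : zonal_on M c by move=> t p Mp; rewrite /c za.
have sm : smooth_on M (fun p => kap n p * (c p * recip d p)).
  by apply: smooth_cutoffM; exact: smooth_onM.
have zm : zonal_on M (fun p => kap n p * (c p * recip d p)).
  by apply: zonal_onM; [exact: zkap|exact: zonal_onM].
have H1 := @flux_energy n _ sm zm.
have H2 : e * flux h (fun p => (kap n p * a p) * kap n p) @[h --> (0 : R)^'+] --> e * - power (fun p => kap n p * kap n p).
  by apply: cvgM; [exact: cvg_cst|exact: flux_power].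
have H3 : `|flux h (fun p => (kap n p * b p) * (kap n p * (c p * recip d p))) +
    e * flux h (fun p => (kap n p * a p) * kap n p)| @[h --> (0 : R)^'+] -->
    `|mu * energy (fun p => kap n p * (kap n p * (c p * recip d p))) - e * power (fun p => kap n p * kap n p)|.
  by rewrite -mulrN; apply: cvg_norm; exact: cvgD.
apply: (ler_cvg_to H3 (cvg_cst _)); near=> h.
have h0 : 0 < h by [].
pose k2 p := 1 - kap n p * kap n p.
pose g p := kap n p * (kap n p * (c p * defect d p)).
have bk2 : bcoef M k2 by apply: bcoefB; [exact: bcoef_cst|exact: bcoefM].
have bg : bcoef M g.
  by apply: bcoefM => //; apply: sbc; apply: smooth_cutoffM; exact: smooth_onM.
have bka : bcoef M (fun p => (kap n p * a p) * kap n p) by apply: bcoefM => //; exact: sbc.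
have bm : bcoef M (fun p => (kap n p * b p) * (kap n p * (c p * recip d p))).
  by apply: bcoefM; apply: sbc.
have E : flux h (fun p => (kap n p * b p) * (kap n p * (c p * recip d p))) +
   e * flux h (fun p => (kap n p * a p) * kap n p) = - (K * flux h k2) - flux h g.
  have bKk2 : bcoef M (fun p => K * k2 p) by apply: bcoefM => //; exact: bcoef_cst.
  have beka : bcoef M (fun p => e * ((kap n p * a p) * kap n p)) by apply: bcoefM => //; exact: bcoef_cst.
  have : K * flux h (fun=> 1) = 0 by rewrite flux1 mulr0.
  rewrite -fluxZ; last exact: bcoef_cst.
  rewrite (@eq_flux h _ (fun p => ((kap n p * b p) * (kap n p * (c p * recip d p)) +
     e * ((kap n p * a p) * kap n p)) + (K * k2 p + g p))).
    rewrite (fluxD h (bcoefD bm beka) (bcoefD bKk2 bg)) (fluxD h bm beka) (fluxD h bKk2 bg).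
    rewrite (fluxZ h e bka) (fluxZ h K bk2).
    move: (flux h _) (flux h _) (flux h k2) (flux h g) => x y z t; lra.
  move=> p Mp.
  have -> : (kap n p * b p) * (kap n p * (c p * recip d p)) = kap n p * kap n p * c p * (b p * recip d p) by ring.
  by rewrite b_recip// /g /k2 /c; ring.
rewrite E; apply: le_trans (ler_normB _ _) _; rewrite normrN normrM mulrDr.
apply: lerD; last exact: HQ.
by rewrite mulrCA; apply: ler_wpM2l => //; exact: HQ.
Unshelve. all: by end_near. Qed.

Lemma mass_defect_cvg n (c : R * R * R -> R) : smooth_on (off_axis M) c ->
  mass (fun p => kap n p * (kap n p * (c p * defect (harmonic k) p))) @[k --> \oo] --> (0 : R).
Proof.
move=> sc; have [Q Q0 HQ] := mass_defect n sc.
have H : Num.sqrt (Q * harmonic k) @[k --> \oo] --> (0 : R).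
  rewrite -[X in _ --> X]sqrtr0; apply: (continuous_cvg _ (@sqrt_continuous R _)).
  rewrite -[X in _ --> X](mulr0 Q); apply: cvgM; [exact: cvg_cst|exact: cvg_harmonic].
apply: (squeeze_cvgr _ (cvg_cst 0) H); apply: nearW => k; rewrite mass_ge0/=.
rewrite -[leLHS]ger0_norm ?mass_ge0// -sqrtr_sqr; apply: ler_wsqrtr; apply: HQ.
exact: harmonic_gt0.
Qed.

Lemma axis_negligible : sigma.-negligible (M `&` (@axis R)).
Proof.
exists (M `&` (@axis R)); split=> //; last exact: (sigma_axis reg cM Mrot sarea).
apply: compact_measurable3; apply: compact_closedI => //; exact: closed_axis.
Qed.

Lemma nrm_cutoff u : L2 u -> nrm (fun p => kap n p * u p - u p) @[n --> \oo] --> (0 : R).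
Proof.
move=> Lu.
have E : (fun n => nrm (fun p => kap n p * u p - u p)) = (fun n => nrm (fun p => (kap n p - 1) * u p)).
  by apply/funext => n; congr Num.sqrt; apply: eq_ip => p _; rewrite mulrBl mul1r.
rewrite E; apply: (@nrm_dominated R M sigma mM (fun n p => kap n p - 1) u 1 _ Lu _ _ axis_negligible).
- by move=> n; have [] := bcoefB (bkap n) (bcoef_cst M 1).
- move=> n p Mp; rewrite distrC ger0_norm ?subr_ge0 ?cutoff_le1//.
  by rewrite lerBlDr lerDl cutoff_ge0.
- move=> p Mp nA; rewrite -[X in _ --> X](subrr (1 : R)); apply: cvgB; last exact: cvg_cst.
  by apply: (@cutoff_cvg R M); rewrite off_axisE; split=> // pA; apply: nA.
Qed.

Lemma nrm_cutoff2 u : L2 u -> nrm (fun p => (kap n p * kap n p) * u p - u p) @[n --> \oo] --> (0 : R).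
Proof.
move=> Lu; have H : nrm (fun p => kap n p * u p - u p) + nrm (fun p => kap n p * u p - u p)
    @[n --> \oo] --> (0 : R).
  by rewrite -[X in _ --> X]addr0; apply: cvgD; exact: nrm_cutoff.
apply: (squeeze_cvgr _ (cvg_cst 0) H); apply: nearW => n; rewrite nrm_ge0/=.
have Lk := L2_bcoef mM (bkap n) Lu; have Lkk := L2_bcoef mM (bkap n) Lk.
have Lkk' : L2 (fun p => (kap n p * kap n p) * u p).
  by apply: L2_bcoef => //; exact: bcoefM.
apply: le_trans (nrm_dist_trans mM Lkk' Lk Lu) _; apply: lerD => //.
apply: (le_nrm mM); [exact: L2B|exact: L2B|move=> p Mp].
rewrite -mulrA -mulrBr normrM; apply: ler_piMl => //.
by rewrite ger0_norm ?cutoff_ge0 ?cutoff_le1.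
Qed.

Lemma mass_cutoff_cvg : mass (fun p => 1 - kap n p * kap n p) @[n --> \oo] --> (0 : R).
Proof.
suff -> : (fun n => mass (fun p => 1 - kap n p * kap n p)) =
  (fun n => nrm (fun p => (kap n p * kap n p) * z1 p - z1 p)
          + nrm (fun p => (kap n p * kap n p) * z2 p - z2 p)).
  by rewrite -[X in _ --> X]addr0; apply: cvgD; exact: nrm_cutoff2.
apply/funext => n; rewrite nrm_distC (nrm_distC _ _ _ z2).
by congr (Num.sqrt _ + Num.sqrt _); apply: eq_ip => p _; rewrite mulrBl mul1r.
Qed.

Lemma ip_cutoff2 u v : L2 u -> L2 v ->
  ip (fun p => (kap n p * kap n p) * u p) v @[n --> \oo] --> ip u v.
Proof.
move=> Lu Lv; apply: (ip_cvgl mM) => //; last exact: nrm_cutoff2.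
by move=> n; apply: L2_bcoef => //; exact: bcoefM.
Qed.

Lemma power_cvg : power (fun p => kap n p * kap n p) @[n --> \oo] --> mu * (ip s1 z1 + ip s2 z2).
Proof.
suff -> : mu * (ip s1 z1 + ip s2 z2) = ip eta1 s1 + ip eta2 s2 by apply: cvgD; exact: ip_cutoff2.
have Lm k z : L2 z -> L2 (fun p => k * z p) by move=> Lz; exact: L2Z.
rewrite /eta1 /eta2 (ipBl mM (Lm mu _ Lz1) (Lm om _ Lz2) Ls1) (ipDl mM (Lm om _ Lz1) (Lm mu _ Lz2) Ls2).
rewrite !(ipZl mM)// !(ipC _ _ _ s1) !(ipC _ _ _ s2) (lapl_sym reg cM sarea l1 l2).
ring.
Qed.

(** In the limit the integral of (K - a) / b |zeta|^2, which is nonnegative, equals the pairing of psi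
and zeta, which is nonpositive. *)
Lemma no_growth_shear (K : R) : (forall p, off_axis M p -> 0 <= b p * (K - a p)) ->
  ip z1 z1 = 0 /\ ip z2 z2 = 0.
Proof.
move=> sgn; have [Q Q0 HQ] := flux_bound.
have n1 := lapl_le0 reg cM sarea l1; have n2 := lapl_le0 reg cM sarea l2.
suff : 0 <= ip s1 z1 + ip s2 z2.
  move=> H; have [E1 E2] : ip s1 z1 = 0 /\ ip s2 z2 = 0 by split; lra.
  by split; [exact: (lapl_eq0 reg cM sarea l1)|exact: (lapl_eq0 reg cM sarea l2)].
have sc : smooth_on (off_axis M) (fun p => K - 1 * a p).
  apply: smooth_onB; first exact: (@smooth_on_cst R (off_axis M) K).
  exact: (smooth_onM (@smooth_on_cst R (off_axis M) 1) sa).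
have step n : - (mu * power (fun p => kap n p * kap n p)) <=
    `|mu| * (Q * (`|K| * mass (fun p => 1 - kap n p * kap n p))).
  have H0 := mass_defect_cvg n sc.
  have H1 : `|mu| * (Q * mass (fun p => kap n p * (kap n p * ((K - 1 * a p) * defect (harmonic k) p))))
      @[k --> \oo] --> (0 : R).
    rewrite -[X in _ --> X](mulr0 `|mu|); apply: cvgM; first exact: cvg_cst.
    by rewrite -[X in _ --> X](mulr0 Q); apply: cvgM => //; exact: cvg_cst.
  apply: (le_cvg0 _ H1) => k.
  have d0 : 0 < harmonic k :> R by exact: harmonic_gt0.
  have := energy_power K 1 n d0 HQ; rewrite mul1r -!mulrDr.
  set x := energy _; set P := power _; set r := Q * _ => H2.
  have x0 : 0 <= x.
    apply: energy_ge0 => p Mp; rewrite mulrA; have [->|pM] := cutoff_cases n Mp; first by rewrite !mul0r.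
    apply: mulr_ge0; first by rewrite mulr_ge0 ?cutoff_ge0.
    rewrite /recip mulrA; apply: divr_ge0; last by apply: ltW; exact: den_gt0.
    by rewrite mulrC mul1r sgn.
  rewrite (_ : - (mu * P) = mu * (mu * x - P) - mu ^+ 2 * x); last by ring.
  rewrite lerBlDr; apply: le_trans (ler_norm _) _; rewrite normrM.
  apply: le_trans (ler_wpM2l (normr_ge0 mu) H2) _.
  by rewrite lerDl mulr_ge0 ?sqr_ge0.
have C1 : - (mu * power (fun p => kap n p * kap n p)) @[n --> \oo] --> - (mu * (mu * (ip s1 z1 + ip s2 z2))).
  by apply: cvgN; apply: cvgM; [exact: cvg_cst|exact: power_cvg].
have C2 : `|mu| * (Q * (`|K| * mass (fun p => 1 - kap n p * kap n p))) @[n --> \oo] --> (0 : R).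
  rewrite -[X in _ --> X](mulr0 `|mu|); apply: cvgM; first exact: cvg_cst.
  rewrite -[X in _ --> X](mulr0 Q); apply: cvgM; first exact: cvg_cst.
  by rewrite -[X in _ --> X](mulr0 `|K|); apply: cvgM; [exact: cvg_cst|exact: mass_cutoff_cvg].
have : - (mu * (mu * (ip s1 z1 + ip s2 z2))) <= 0.
  by apply: (ler_cvg_to C1 C2); exact: nearW.
by rewrite oppr_le0 mulrA -expr2 pmulr_rge0// exprn_even_gt0.
Qed.

(** In the limit the integral of |zeta|^2 / |b| vanishes. Since a cutoff makes b bounded, the
part of |zeta|^2 outside the defect is at most a multiple of this integral; the rest is handled by
[defect_energy]. *)
Lemma no_growth_sign (e : R) : `|e| = 1 -> (forall p, off_axis M p -> 0 <= e * b p) ->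
  ip z1 z1 = 0 /\ ip z2 z2 = 0.
Proof.
move=> e1 sgn; have [Q Q0 HQ] := flux_bound; have [Q1 Q10 HQ1] := defect_energy.
have m0 : 0 < `|mu| by rewrite normr_gt0.
have ee : e * e = 1 by rewrite -expr2 -real_normK ?num_real// e1 expr1n.
(* two cutoffs: n tends to infinity first, with k fixed *)
suff H : energy (fun=> 1) <= 0.
  have E1 : ip z1 z1 = ip (fun p => 1 * z1 p) z1 by apply: eq_ip => // p _; rewrite mul1r.
  have E2 : ip z2 z2 = ip (fun p => 1 * z2 p) z2 by apply: eq_ip => // p _; rewrite mul1r.
  have := ip_ge0 M sigma z1; have := ip_ge0 M sigma z2.
  by move: H; rewrite /energy -E1 -E2 => *; split; lra.
have sc : smooth_on (off_axis M) (fun p => e - 0 * a p).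
  apply: smooth_onB; first exact: (@smooth_on_cst R (off_axis M) e).
  exact: (smooth_onM (@smooth_on_cst R (off_axis M) 0) sa).
have step k : exists C, forall n, energy (fun p => kap k p * (kap n p * kap n p)) <=
    C * mass (fun p => 1 - kap n p * kap n p).
  have [_ [C HC]] := sbc (skb k).
  exists (`|C| / `|mu| * Q) => n.
  have H0 := mass_defect_cvg n sc.
  have H1 : Q1 * harmonic i + `|C| / `|mu| * (Q *
       mass (fun p => kap n p * (kap n p * ((e - 0 * a p) * defect (harmonic i) p))))
      @[i --> \oo] --> (0 : R).
    rewrite [X in _ --> X](_ : 0 = Q1 * 0 + `|C| / `|mu| * (Q * 0)); last by rewrite !mulr0 addr0.
    apply: cvgD; first by apply: cvgM; [exact: cvg_cst|exact: cvg_harmonic].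
    apply: cvgM; [exact: cvg_cst|apply: cvgM; [exact: cvg_cst|]].
    exact: H0.
  apply: (le_cvg0 _ H1) => i; set d := harmonic i.
  have d0 : 0 < d :> R by exact: harmonic_gt0.
  have := energy_power e 0 n d0 HQ; rewrite mul0r subr0 e1 mul1r.
  have := HQ1 n _ d0; set y := energy _; set x := energy (fun p => kap n p * (kap n p * _)).
  set m1 := mass _; set m2 := mass _ => H2 H3.
  have : energy (fun p => kap k p * (kap n p * kap n p)) <= y + `|C| * x.
    have [sdef srec] := smooth_defect d0.
    have bdef : bcoef M (fun p => kap n p * (kap n p * defect d p)).
      by apply: bcoefM => //; apply: sbc; exact: smooth_cutoffM.
    have brec : bcoef M (fun p => kap n p * (kap n p * ((e - 0 * a p) * recip d p))).
      by apply: bcoefM => //; apply: sbc; apply: smooth_cutoffM; exact: smooth_onM.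
    have bC := bcoefM (bcoef_cst M `|C|) brec.
    rewrite /x -energyZ// -energyD//; apply: le_energy; first by do 2?apply: bcoefM.
      exact: bcoefD.
    move=> p Mp; have [->|pM] := cutoff_cases n Mp; first by rewrite !(mul0r, mulr0) addr0.
    have k0 := cutoff_ge0 k p; have k1 := cutoff_le1 k p; have n0 := cutoff_ge0 n p.
    have D0 := defect_ge0 p d0; have E := b_recip p d0.
    have r0 : 0 <= e * recip d p.
      by rewrite /recip mulrA; apply: divr_ge0; [exact: sgn|apply: ltW; exact: den_gt0].
    have kb : kap k p * (e * b p) <= `|C|.
      apply: le_trans (ler_norm _) _; rewrite mulrCA normrM e1 mul1r.
      by apply: le_trans (HC p Mp) _; exact: ler_norm.
    rewrite (_ : kap k p * (kap n p * kap n p) = kap n p * kap n p * (kap k p * defect d p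
        + (kap k p * (e * b p)) * (e * recip d p))); last first.
      rewrite (_ : kap k p * (e * b p) * _ = kap k p * (e * e) * (b p * recip d p)); last by ring.
      by rewrite ee E; ring.
    rewrite [leRHS](_ : _ = kap n p * kap n p * (defect d p + `|C| * (e * recip d p))); last by ring.
    apply: ler_wpM2l; first exact: mulr_ge0.
    by apply: lerD; [exact: ler_piMl|exact: ler_wpM2r].
  move=> /le_trans; apply.
  have H4 : x <= Q * (m1 + m2) / `|mu|.
    rewrite ler_pdivlMr// mulrC; apply: le_trans _ H3; rewrite normrM.
    by apply: ler_wpM2l => //; exact: ler_norm.
  apply: le_trans (lerD H2 (ler_wpM2l (normr_ge0 C) H4)) _.
  by rewrite le_eqVlt; apply/orP; left; apply/eqP; field; rewrite gt_eqF.
have step2 k : energy (kap k) <= 0.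
  have [C HC] := step k.
  have C1 : energy (fun p => kap k p * (kap n p * kap n p)) @[n --> \oo] --> energy (kap k).
    have E n : energy (fun p => kap k p * (kap n p * kap n p)) =
       ip (fun p => (kap n p * kap n p) * z1 p) (fun p => kap k p * z1 p)
     + ip (fun p => (kap n p * kap n p) * z2 p) (fun p => kap k p * z2 p).
      by congr (_ + _); apply: eq_Rintegral => p _; ring.
    have E' : energy (kap k) = ip z1 (fun p => kap k p * z1 p) + ip z2 (fun p => kap k p * z2 p).
      by rewrite /energy !ip_bcoef.
    rewrite (funext E) E'; apply: cvgD; apply: ip_cutoff2 => //; exact: L2_bcoef.
  have C2 : C * mass (fun p => 1 - kap n p * kap n p) @[n --> \oo] --> (0 : R).
    by rewrite -[X in _ --> X](mulr0 C); apply: cvgM; [exact: cvg_cst|exact: mass_cutoff_cvg].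
  by apply: (ler_cvg_to C1 C2); exact: nearW.
have C3 : energy (kap k) @[k --> \oo] --> energy (fun=> 1).
  have E1 : energy (fun=> 1) = ip z1 z1 + ip z2 z2.
    by congr (_ + _); apply: eq_ip => // p _; rewrite mul1r.
  rewrite E1; apply: cvgD; apply: (ip_cvgl mM) => //; try exact: nrm_cutoff.
    by move=> k; exact: L2_bcoef.
  by move=> k; exact: L2_bcoef.
by apply: (ler_cvg_to C3 (cvg_cst 0)); exact: nearW.
Qed.

End Energy.

(** * The eigenvalue equation *)

Section Complex.
Context (R : realType).
Implicit Types (z u : R[i]).

Lemma ReM z u : complex.Re (z * u) = complex.Re z * complex.Re u - complex.Im z * complex.Im u.
Proof. by case: z u => [a b] [c d]. Qed.

Lemma ImM z u : complex.Im (z * u) = complex.Im z * complex.Re u + complex.Re z * complex.Im u.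
Proof. by case: z u => [a b] [c d] /=; rewrite addrC [X in _ + X]mulrC (mulrC b). Qed.

Lemma ReD z u : complex.Re (z + u) = complex.Re z + complex.Re u.
Proof. by case: z u => [a b] [c d]. Qed.

Lemma ImD z u : complex.Im (z + u) = complex.Im z + complex.Im u.
Proof. by case: z u => [a b] [c d]. Qed.

End Complex.

Section Eigenfunction.
Context (R : realType) (M : set (R * R * R)).
Context (sigma : {measure set (R * R * R) -> \bar R}).
Local Notation ip := (ip M sigma).

Lemma inverse_laplacian_lapl (zeta psi : R * R * R -> R) : Rintegral sigma M zeta = 0 ->
  inverse_laplacian M sigma zeta psi -> L2_laplacian M sigma psi zeta.
Proof.
move=> z0 [_]; rewrite /average z0 mul0r.
by under [X in L2_laplacian _ _ _ X]eq_fun do rewrite subr0.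
Qed.

(** The weak equation split into its real and imaginary parts. The averages subtracted in
[inverse_laplacian] vanish, because zeta has mean zero. *)
Lemma zonal_operator_eigen (xi : R * R * R -> R) (a b : R -> R) (zeta : R * R * R -> R[i])
  (mu om : R) :
  zonal_operator M sigma xi a b zeta (fun p => Complex mu om * zeta p) ->
  exists s1 s2, let z1 := cRe zeta in let z2 := cIm zeta in
  [/\ L2_laplacian M sigma s1 z1, L2_laplacian M sigma s2 z2,
      (forall phi, smooth_on M phi -> ip (fun p => mu * z1 p - om * z2 p) phi =
         - ip (fun p => a (xi p) * z1 p + b (xi p) * s1 p) (X3 phi)) &
      (forall phi, smooth_on M phi -> ip (fun p => om * z1 p + mu * z2 p) phi =
         - ip (fun p => a (xi p) * z2 p + b (xi p) * s2 p) (X3 phi))].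
Proof.
move=> [[Lz1 Lz2 z0] _ [psi [i1 i2] H]]; exists (cRe psi), (cIm psi) => z1 z2.
have z10 : Rintegral sigma M z1 = 0 := congr1 (@complex.Re R) z0.
have z20 : Rintegral sigma M z2 = 0 := congr1 (@complex.Im R) z0.
split; [exact: (inverse_laplacian_lapl z10 i1)|exact: (inverse_laplacian_lapl z20 i2)| |] => phi sp.
  have := congr1 (@complex.Re R) (H phi sp).
  rewrite [LHS]/= [RHS]/= => E; rewrite /ip; etransitivity; last (etransitivity; first exact: E).
    by apply: eq_Rintegral => p _; rewrite /cRe ReM [complex.Im _]/= mulr0 subr0 ReM.
  congr (- _); apply: eq_Rintegral => p _.
  by rewrite /cRe ReM [complex.Im _]/= mulr0 subr0 ReD !ReM /= !mul0r !subr0.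
have := congr1 (@complex.Im R) (H phi sp).
rewrite [LHS]/= [RHS]/= => E; rewrite /ip; etransitivity; last (etransitivity; first exact: E).
  by apply: eq_Rintegral => p _; rewrite /cIm ImM [complex.Im _%:C%C]/= mulr0 addr0 ImM.
congr (- _); apply: eq_Rintegral => p _.
by rewrite /cIm ImM [complex.Im _%:C%C]/= mulr0 addr0 ImD !ImM /= !mul0r !add0r.
Qed.

End Eigenfunction.

Section Main.
Context (R : realType) (M : set (R * R * R)).
Context (sigma : {measure set (R * R * R) -> \bar R}).
Hypotheses (reg : regular_surface M) (cM : compact M) (Mrot : rotation_symmetric M).
Hypothesis sarea : is_area_measure M sigma.
Local Notation ip := (ip M sigma).
Let mM := measurable_surface cM.

Variables (nu : R * R * R -> R * R * R) (xi : R * R * R -> R) (grad_xi : R * R * R -> R * R * R).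
Hypothesis nu_normal : outward_unit_normal M nu.
Hypotheses (xi_smooth : smooth_on M xi) (grad_xiE : is_gradient M xi grad_xi).
Hypothesis J_grad_xi : forall p, M p -> cross (nu p) (grad_xi p) = - X3_vec p.
Variables (f w chi : R -> R) (Omega : R).
Hypotheses (f_smooth : smooth_on M (f \o xi)) (wE : is_laplacian M (f \o xi) (w \o xi)).
Hypothesis chiE : forall p, M p -> chi (xi p) = dot (@e3 R) (nu p).
Variables (lambda : R[i]) (zeta : R * R * R -> R[i]).
Hypothesis Re_lambda : complex.Re lambda <> 0.
Hypothesis zeta_neq0 : ~ {ae sigma, forall p, M p -> zeta p = 0}.
Hypothesis eigen : Gamma M sigma xi f w chi Omega zeta (fun p => lambda * zeta p).

Let a p := derive1 f (xi p).
Let b p := Omega * derive1 chi (xi p) - derive1 w (xi p).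

Lemma no_growth_contra : ip (cRe zeta) (cRe zeta) = 0 /\ ip (cIm zeta) (cIm zeta) = 0 -> False.
Proof.
have [[L1 L2 _] _ _] := eigen => -[E1 E2]; apply: zeta_neq0.
apply: filterS2 (ip_eq0_ae mM L1 E1) (ip_eq0_ae mM L2 E2) => p H1 H2 Mp.
by apply/eqP; rewrite eq_complex; apply/andP; split; apply/eqP; [exact: H1|exact: H2].
Qed.

(** The two sign conditions are those under which the identities above force zeta to vanish. *)
Lemma eigen_no_growth : (exists e : R, `|e| = 1 /\ forall p, off_axis M p -> 0 <= e * b p) \/
  (exists K : R, forall p, off_axis M p -> 0 <= b p * (K - a p)) -> False.
Proof.
move=> H; apply: no_growth_contra; move: Re_lambda eigen.
case: lambda => mu om /= /eqP mu0 eig.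
have [s1 [s2 [l1 l2 w1 w2]]] := zonal_operator_eigen eig.
have nu_unit := nu_normal.1.
have w_smooth := smooth_on_laplacian f_smooth wE.
have chi_smooth := smooth_on_chi reg nu_unit xi_smooth grad_xiE J_grad_xi chiE.
have D := smooth_on_zonal_derive reg nu_unit xi_smooth grad_xiE J_grad_xi.
have sa : smooth_on (off_axis M) a := D f (smooth_on_off f_smooth).
have sb : smooth_on (off_axis M) b.
  apply: smooth_onB; last exact: (D w (smooth_on_off w_smooth)).
  exact: (smooth_onM (@smooth_on_cst R (off_axis M) Omega) (D chi chi_smooth)).
have xr := xi_rot reg Mrot xi_smooth grad_xiE J_grad_xi.
have za : zonal_on M a by move=> t p Mp; rewrite /a xr.
have zb : zonal_on M b by move=> t p Mp; rewrite /b xr.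
(* the cutoff is invariant under the rotations, so that X3 commutes with it *)
have W (n : nat) phi (eta z s : R * R * R -> R) : smooth_on M phi ->
    (forall phi, smooth_on M phi -> ip eta phi = - ip (fun p => a p * z p + b p * s p) (X3 phi)) ->
    ip (fun p => cutoff n p * eta p) phi =
    - ip (fun p => (cutoff n p * a p) * z p + (cutoff n p * b p) * s p) (X3 phi).
  move=> sp /(_ (fun p => cutoff n p * phi p)); rewrite -ip_bcoef => ->; last first.
    exact: (@smooth_onM R M (cutoff n) phi (smooth_cutoff n) sp).
  apply: (congr1 (fun x => - x)); apply: eq_Rintegral => p /set_mem Mp.
  rewrite (X3_zonal reg Mrot (@zonal_cutoff R M n) sp Mp).
  move: (cutoff n p) (X3 phi p) => k t; ring.
have W1 n phi sp := @W n phi _ _ _ sp w1; have W2 n phi sp := @W n phi _ _ _ sp w2.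
case: H => [[e [e1 sgn]]|[K sgn]].
  exact: (no_growth_sign reg cM Mrot sarea sa za sb zb l1 l2 mu0 W1 W2 e1 sgn).
exact: (no_growth_shear reg cM Mrot sarea sa za sb zb l1 l2 mu0 W1 W2 sgn).
Qed.

End Main.

Theorem proposition4p2p3 (R : realType) (M : set (R * R * R))
  (M_surface : regular_surface M)
  (M_compact : compact M)
  (M_sphere : diffeomorphic (@sphere R) M)
  (M_curvature : positive_curvature M)
  (M_rot : rotation_symmetric M)
  (sigma : {measure set (R * R * R) -> \bar R})
  (sigma_area : is_area_measure M sigma)
  (nu : R * R * R -> R * R * R)
  (nu_normal : outward_unit_normal M nu)
  (xi : R * R * R -> R)
  (xi_smooth : smooth_on M xi)
  (grad_xi : R * R * R -> R * R * R)
  (grad_xiE : is_gradient M xi grad_xi)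
  (J_grad_xi : forall p, M p -> cross (nu p) (grad_xi p) = - X3_vec p)
  (f w chi : R -> R)
  (f_smooth : smooth_on M (f \o xi))
  (f_zonal : forall p, M p -> X3 (f \o xi) p = 0)
  (wE : is_laplacian M (f \o xi) (w \o xi))
  (chiE : forall p, M p -> chi (xi p) = dot (@e3 R) (nu p))
  (Omega : R)
  (alpha0 alpha1 : R)
  (alpha0_min : (exists2 p, M p & xi p = alpha0) /\
                (forall p, M p -> alpha0 <= xi p))
  (alpha1_max : (exists2 p, M p & xi p = alpha1) /\
                (forall p, M p -> xi p <= alpha1))
  (unstable : exists lambda : R[i],
     complex.Re lambda <> 0 /\
     eigenvalue_of M sigma (Gamma M sigma xi f w chi Omega) lambda) :
  (exists s1 s2 : R,
     [/\ alpha0 < s1 < alpha1, alpha0 < s2 < alpha1,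
         derive1 w s1 - Omega * derive1 chi s1 < 0 &
         0 < derive1 w s2 - Omega * derive1 chi s2]) /\
  (forall K : R, exists s : R,
     alpha0 < s < alpha1 /\
     (derive1 w s - Omega * derive1 chi s) * (derive1 f s - K) < 0).
Proof.
have off_int p : off_axis M p -> alpha0 < xi p < alpha1.
  move=> pM; exact: (xi_interior M_surface nu_normal.1 xi_smooth grad_xiE J_grad_xi pM
    alpha0_min.2 alpha1_max.2).
have [lambda [Re0 [zeta [zeta0 eig]]]] := unstable.
have contra := eigen_no_growth M_surface M_compact M_rot sigma_area nu_normal xi_smooth
  grad_xiE J_grad_xi f_smooth wE chiE Re0 zeta0 eig.
split=> [|K]; apply: contrapT => H; apply: contra; [left|right].
  have [[s1 s1I n1]|no1] := pselect (exists2 s1, alpha0 < s1 < alpha1 & derive1 w s1 - Omega * derive1 chi s1 < 0).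
    exists 1; split=> [|p pM]; first by rewrite normr1.
    rewrite mul1r -oppr_le0 opprB leNgt; apply/negP => p2; apply: H.
    by exists s1, (xi p); split=> //; exact: off_int.
  exists (- 1); split=> [|p pM]; first by rewrite normrN1.
  rewrite mulN1r opprB leNgt; apply/negP => p1; apply: no1.
  by exists (xi p) => //; exact: off_int.
exists K => p pM; rewrite -mulrNN !opprB leNgt; apply/negP => n; apply: H.
by exists (xi p); split=> //; exact: off_int.
Qed.
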